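(* Let $n\ge 2$ and let $(g,\nabla)$ be a statistical structure on a manifold $M$ diffeomorphic to the Euclidean sphere $S^n$. 1) If the Ricci tensor of $\nabla$ is symmetric and non-degenerate and $\nabla$ is projectively flat, then $\nabla$ is complete on $M$. 2) If the structure $(g,\nabla)$ is conjugate symmetric and the connection $\nabla$ is projectively flat, then $\nabla$ and its dual connection $\overline\nabla$ are both complete on $M$.
   Context: A statistical structure on a manifold $M$ is a pair $(g,\nabla)$, where $g$ is a positive definite metric tensor field and $\nabla$ is a torsion-free connection on $M$ such that the cubic form $\nabla g$ is symmetric in all its arguments. The dual connection $\overline\nabla$ is defined by $Xg(Y,Z)=g(\nabla_XY,Z)+g(Y,\overline\nabla_XZ)$; it is torsion-free and $(g,\overline\nabla)$ is again a statistical structure. Let $R,\overline R$ be the curvature tensors of $\nabla,\overline\nabla$. The structure is conjugate symmetric if $R=\overline R$ (equivalently, $g(R(X,Y)Z,W)$ is skew-symmetric in $Z,W$). The Ricci tensor of $\nabla$ is $\mathrm{Ric}(Y,Z)=\mathrm{tr}\{X\mapsto R(X,Y)Z\}$. A torsion-free connection $\nabla$ is projectively flat if around each point there is a flat torsion-free connection $\nabla'$ and a $1$-form $\omega$ with $\nabla_XY=\nabla'_XY+\omega(X)Y+\omega(Y)X$. A connection is complete if each of its maximal geodesics, parametrized by an affine parameter, is defined on all of $\mathbb{R}$. *)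

(* Defs.v *)
From HB Require Import structures.
From mathcomp Require Import all_boot all_order all_algebra.
From mathcomp Require Import all_classical all_reals all_analysis.
Set Implicit Arguments.
Unset Strict Implicit.
Unset Printing Implicit Defensive.
Import Order.TTheory GRing.Theory Num.Theory.
Import numFieldNormedType.Exports.
Local Open Scope classical_set_scope.
Local Open Scope ring_scope.

(** * Smooth functions on open subsets of [R^m] *)

(* [Ck k U f] is meant for [U] open. Asking for the derivatives in all constant
   directions [v], rather than only along the basis, does not change the
   notion. *)
Fixpoint Ck (R : realType) (m : nat) (W : normedModType R) (k : nat)
    (U : set 'rV[R]_m) (f : 'rV[R]_m -> W) : Prop :=
  (forall x, U x -> {for x, continuous f}) /\
  (if k is k'.+1 then
     forall v : 'rV[R]_m,
       (forall x, U x -> derivable f x v) /\ Ck k' U ('D_v f)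
   else True).

Definition smooth_on (R : realType) (m : nat) (W : normedModType R)
    (U : set 'rV[R]_m) (f : 'rV[R]_m -> W) : Prop :=
  forall k, Ck k U f.

(** * Smooth manifolds *)

(* A smooth structure is given by an atlas (not necessarily maximal).
   [coord i : dom i -> cod i] is the i-th chart and [param i] its inverse; both
   are total functions whose values outside [dom i], resp. [cod i], are
   irrelevant. *)
Record manifold (R : realType) (n : nat) := Manifold {
  point_of :> topologicalType;
  chart : Type;
  dom : chart -> set point_of;
  cod : chart -> set 'rV[R]_n;
  coord : chart -> point_of -> 'rV[R]_n;
  param : chart -> 'rV[R]_n -> point_of;
  manifold_hausdorff : hausdorff_space point_of;
  manifold_second_countable : @second_countable point_of;
  dom_open : forall i, open (dom i);
  cod_open : forall i, open (cod i);
  coord_cod : forall i p, dom i p -> cod i (coord i p);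
  param_dom : forall i x, cod i x -> dom i (param i x);
  coordK : forall i p, dom i p -> param i (coord i p) = p;
  paramK : forall i x, cod i x -> coord i (param i x) = x;
  coord_continuous : forall i p, dom i p -> {for p, continuous (coord i)};
  param_continuous : forall i x, cod i x -> {for x, continuous (param i)};
  charts_cover : forall p, exists i, dom i p;
  transition_smooth : forall i j,
    smooth_on (cod i `&` param i @^-1` dom j) (coord j \o param i) }.

Definition overlap (R : realType) (n : nat) (M : manifold R n)
    (i j : chart M) : set 'rV[R]_n :=
  cod i `&` param i @^-1` dom j.

Definition transition (R : realType) (n : nat) (M : manifold R n)
    (i j : chart M) : 'rV[R]_n -> 'rV[R]_n :=
  coord j \o param i.

(** * The Euclidean sphere *)

Definition sphere (R : realType) (n : nat) : set 'rV[R]_n.+1 :=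
  [set y | \sum_(k < n.+1) y 0 k ^+ 2 = 1].

Definition smooth_to_space (R : realType) (n m : nat) (M : manifold R n)
    (F : M -> 'rV[R]_m) : Prop :=
  forall i : chart M, smooth_on (cod i) (F \o param i).

Definition smooth_from_open (R : realType) (n m : nat) (M : manifold R n)
    (U : set 'rV[R]_m) (H : 'rV[R]_m -> M) : Prop :=
  (forall y, U y -> {for y, continuous H}) /\
  forall i : chart M, smooth_on (U `&` H @^-1` dom i) (coord i \o H).

(* The sphere carries the smooth structure of a submanifold of [R^n.+1]: a map
   into it is smooth iff it is smooth as a map into [R^n.+1], and a map from it
   is smooth iff it is locally the restriction of a smooth map defined on an
   open subset of [R^n.+1]. *)
Definition diffeomorphic_to_sphere (R : realType) (n : nat)
    (M : manifold R n) : Prop :=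
  exists (F : M -> 'rV[R]_n.+1) (G : 'rV[R]_n.+1 -> M),
    [/\ forall p, sphere (F p),
        forall p, G (F p) = p,
        forall y, sphere y -> F (G y) = y,
        smooth_to_space F
      & forall y, sphere y ->
          exists (U : set 'rV[R]_n.+1) (H : 'rV[R]_n.+1 -> M),
            [/\ open U, U y, smooth_from_open U H
              & forall z, U z -> sphere z -> H z = G z] ].

(** * Connections on an open subset of [R^n]

   A connection on an open [V] is given by its Christoffel map
   [Gamma x u v] (components [Gamma^k_ij]), i.e. by [nabla Gamma] below. *)

Definition is_christoffel (R : realType) (n : nat) (V : set 'rV[R]_n)
    (Gamma : 'rV[R]_n -> 'rV[R]_n -> 'rV[R]_n -> 'rV[R]_n) : Prop :=
  (forall x, V x -> bilinear_for *:%R *:%R (Gamma x)) /\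
  (forall u v, smooth_on V (fun x => Gamma x u v)).

Section LocalConnection.
Variables (R : realType) (n : nat).
Local Notation E := 'rV[R]_n.
Implicit Types (V : set E) (Gamma : E -> E -> E -> E) (X Y Z : E -> E).

Definition nabla Gamma X Y : E -> E :=
  fun x => 'D_(X x) Y x + Gamma x (X x) (Y x).

Definition lie_bracket X Y : E -> E :=
  fun x => 'D_(X x) Y x - 'D_(Y x) X x.

Definition torsion Gamma X Y : E -> E :=
  fun x => nabla Gamma X Y x - nabla Gamma Y X x - lie_bracket X Y x.

Definition curvature Gamma X Y Z : E -> E :=
  fun x => nabla Gamma X (nabla Gamma Y Z) x
         - nabla Gamma Y (nabla Gamma X Z) x
         - nabla Gamma (lie_bracket X Y) Z x.

(* The Ricci tensor is a tensor, so tangent vectors at [x] may be extended to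
   constant vector fields in order to compute it. *)
Definition ricci Gamma (x v w : E) : R :=
  \tr (lin1_mx (fun u : E => curvature Gamma (cst u) (cst v) (cst w) x)).

Definition torsion_free_on V Gamma : Prop :=
  forall X Y, smooth_on V X -> smooth_on V Y ->
  forall x, V x -> torsion Gamma X Y x = 0.

Definition flat_on V Gamma : Prop :=
  forall X Y Z, smooth_on V X -> smooth_on V Y -> smooth_on V Z ->
  forall x, V x -> curvature Gamma X Y Z x = 0.

End LocalConnection.

Definition is_one_form (R : realType) (n : nat) (V : set 'rV[R]_n)
    (omega : 'rV[R]_n -> 'rV[R]_n -> R) : Prop :=
  (forall x, V x -> scalar (omega x)) /\
  (forall v, smooth_on V (fun x => omega x v : R^o)).

(** * Connections and metrics on a manifold

   They are given by their local expressions in the charts, subject to the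
   usual transformation laws. *)

Record connection (R : realType) (n : nat) (M : manifold R n) := Connection {
  christoffel :> chart M -> 'rV[R]_n -> 'rV[R]_n -> 'rV[R]_n -> 'rV[R]_n;
  christoffelP : forall i, is_christoffel (cod i) (christoffel i);
  christoffel_transition : forall (i j : chart M) (x u v : 'rV[R]_n),
    overlap i j x ->
    let t := transition i j in
    'D_(christoffel i x u v) t x
      = 'D_u ('D_v t) x + christoffel j (t x) ('D_u t x) ('D_v t x) }.

Record metric (R : realType) (n : nat) (M : manifold R n) := Metric {
  inner :> chart M -> 'rV[R]_n -> 'rV[R]_n -> 'rV[R]_n -> R;
  inner_bilinear : forall i x, cod i x -> bilinear_for *%R *%R (inner i x);
  inner_smooth : forall i u v, smooth_on (cod i) (fun x => inner i x u v : R^o);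
  inner_sym : forall i x u v, cod i x -> inner i x u v = inner i x v u;
  inner_pos : forall i x u, cod i x -> u != 0 -> 0 < inner i x u u;
  inner_transition : forall (i j : chart M) (x u v : 'rV[R]_n),
    overlap i j x ->
    let t := transition i j in
    inner i x u v = inner j (t x) ('D_u t x) ('D_v t x) }.

Section Statistical.
Variables (R : realType) (n : nat) (M : manifold R n).
Local Notation E := 'rV[R]_n.
Implicit Types (g : metric M) (N Nb : connection M) (i : chart M).

Definition torsion_free N : Prop := forall i, torsion_free_on (cod i) (N i).

Definition cubic_form g N i (X Y Z : E -> E) (x : E) : R :=
  'D_(X x) (fun y => g i y (Y y) (Z y) : R^o) x
  - g i x (nabla (N i) X Y x) (Z x)
  - g i x (Y x) (nabla (N i) X Z x).

Definition statistical g N : Prop :=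
  torsion_free N /\
  forall i (X Y Z : E -> E),
    smooth_on (cod i) X -> smooth_on (cod i) Y -> smooth_on (cod i) Z ->
    forall x, cod i x ->
      cubic_form g N i X Y Z x = cubic_form g N i Y X Z x /\
      cubic_form g N i X Y Z x = cubic_form g N i X Z Y x.

Definition dual_connection g N Nb : Prop :=
  forall i (X Y Z : E -> E),
    smooth_on (cod i) X -> smooth_on (cod i) Y -> smooth_on (cod i) Z ->
    forall x, cod i x ->
      'D_(X x) (fun y => g i y (Y y) (Z y) : R^o) x
      = g i x (nabla (N i) X Y x) (Z x) + g i x (Y x) (nabla (Nb i) X Z x).

Definition same_curvature N Nb : Prop :=
  forall i (X Y Z : E -> E),
    smooth_on (cod i) X -> smooth_on (cod i) Y -> smooth_on (cod i) Z ->
    forall x, cod i x -> curvature (N i) X Y Z x = curvature (Nb i) X Y Z x.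

Definition ricci_symmetric N : Prop :=
  forall i x, cod i x -> forall v w, ricci (N i) x v w = ricci (N i) x w v.

Definition ricci_nondegenerate N : Prop :=
  forall i x, cod i x ->
  forall v, (forall w, ricci (N i) x v w = 0) -> v = 0.

Definition projectively_flat N : Prop :=
  forall p : M, exists (i : chart M) (V : set E) (N' : E -> E -> E -> E)
      (omega : E -> E -> R),
    [/\ dom i p, open V, V `<=` cod i & V (coord i p)] /\
    [/\ is_christoffel V N', torsion_free_on V N', flat_on V N',
        is_one_form V omega
      & forall X Y, smooth_on V X -> smooth_on V Y -> forall x, V x ->
          nabla (N i) X Y x
          = nabla N' X Y x + omega x (X x) *: Y x + omega x (Y x) *: X x].

Definition open_interval (I : set R) : Prop :=
  [/\ open I, is_interval I & I !=set0].

(* [c] is twice differentiable at [t] and [c'' + Gamma(c', c') = 0], where [c]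
   is the expression of the curve in a chart; the time [t] is thus an affine
   parameter. Such a curve is automatically smooth. *)
Definition geodesic N (I : set R) (gamma : R -> M) : Prop :=
  (forall t, I t -> {for t, continuous gamma}) /\
  forall i t, I t -> dom i (gamma t) ->
    let c : R -> E := coord i \o gamma in
    [/\ \forall s \near t, derivable c s 1,
        derivable ('D_1 c) t 1
      & 'D_1 ('D_1 c) t + N i (c t) ('D_1 c t) ('D_1 c t) = 0].

Definition maximal_geodesic N (I : set R) (gamma : R -> M) : Prop :=
  [/\ open_interval I, geodesic N I gamma
    & forall (J : set R) (delta : R -> M),
        open_interval J -> I `<=` J -> geodesic N J delta ->
        (forall t, I t -> delta t = gamma t) -> J = I].

Definition complete_connection N : Prop :=
  forall I gamma, maximal_geodesic N I gamma -> I = setT.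

End Statistical.

(* Main.v *)
From HB Require Import structures.
From mathcomp Require Import all_boot all_order all_algebra.
From mathcomp Require Import all_classical all_reals all_analysis.
From mathcomp Require Import ring lra.
Require Import Defs.
Set Implicit Arguments.
Unset Strict Implicit.
Unset Printing Implicit Defensive.
Import Order.TTheory GRing.Theory Num.Theory.
Import numFieldNormedType.Exports.
Local Open Scope classical_set_scope.
Local Open Scope ring_scope.

(** Why the theorem is true.

    Let a torsion-free connection be, in a chart, the projective change of a
    flat connection by a 1-form. Its curvature is then
    R(X,Y)Z = (P(X,Y) - P(Y,X))Z + P(X,Z)Y - P(Y,Z)X for a bilinear form P
    ([schouten], [projective_curv]). If P is symmetric, h = - P satisfies the
    Codazzi equation, and curvature and Codazzi equations together say that
    the linear system
      D_u D_v F = D_(Gamma(u,v)) F - h(u,v) F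
    is integrable: the connection on a bundle of rank n + 1 that it defines on
    the jets (F, dF) is flat ([tractor_flat], [flat_tractor]). By [frobenius]
    it has, near each point, solutions F with values in R^(n+1) and invertible
    jet; in dimension at least two any two of them differ by a constant matrix
    ([solution_exists], [solution_unique]), and they do not depend on the
    chart ([solution_comp]). The sphere being simply connected, they fit
    together to a global map Phi : M -> R^(n+1) ([sphere_frame_section],
    [global_solution]). Simple connectedness is used in the form of
    continuation along rays in the two stereographic charts, whose
    intersection is connected.

    Completeness follows from Phi. Along a geodesic the equation for F becomes
    phi'' = - h(c',c') phi for the image curve phi, so that the wedge product
    of phi and phi' is constant ([wronskian_cst]). As the jet is invertible,
    this constant bounds the velocity in a chart ([velocity_bound]). A bound on
    the velocity gives a time for which the geodesic survives
    ([geodesic_flow_local]), uniformly on M by compactness, and a maximal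
    geodesic is therefore defined on the whole line ([complete_of_compact]).

    It remains to see that P is symmetric. In the first part, the
    antisymmetric part of the Ricci tensor is that of P up to a factor
    ([schouten_sym_of_ricci]). In the second part, differentiating the duality
    relation gives g(R(X,Y)Z,W) = - g(Z,R'(X,Y)W) for the curvature R' of the
    dual connection ([curvature_duality]); as R' = R, the curvature is skew for
    g, and this forces P to be a multiple of g at each point
    ([schouten_proportional]). The dual connection then satisfies the same
    curvature and Codazzi equations with the same h, because its difference
    from the given connection is totally symmetric with respect to g
    ([flat_tractor_of_conjugate_symmetric]). *)

(** * Norms and mean value inequalities *)

Section Norms.
Variable R : realType.

Lemma normr_coord_le p q (A : 'M[R]_(p, q)) i j : `|A i j| <= `|A|.
Proof.
rewrite [leRHS]/Num.Def.normr/= mx_normrE.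
exact: (le_bigmax _ (fun k : 'I_p * 'I_q => `|A k.1 k.2|) (i, j)).
Qed.

Lemma mx_norm_bound p q (A : 'M[R]_(p, q)) c :
  0 <= c -> (forall i j, `|A i j| <= c) -> `|A| <= c.
Proof.
move=> c0 Ac; rewrite [leLHS]/Num.Def.normr/= mx_normrE.
by apply: bigmax_le => // k _.
Qed.

Lemma normr_mulmx_le p q r (A : 'M[R]_(p, q)) (B : 'M[R]_(q, r)) :
  `|A *m B| <= q%:R * `|A| * `|B|.
Proof.
apply: mx_norm_bound => [|i j]; first by rewrite !mulr_ge0.
rewrite mxE (le_trans (ler_norm_sum _ _ _))//.
apply: (@le_trans _ _ (\sum_(k < q) `|A| * `|B|)).
  apply: ler_sum => k _; rewrite normrM.
  by apply: ler_pM => //; exact: normr_coord_le.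
by rewrite sumr_const card_ord -mulrA mulr_natl.
Qed.

End Norms.

Section BallConvexity.
Variables (R : realType) (V : normedModType R).
Implicit Types (C : set V).

Definition segment_convex C := forall x y (t : R), C x -> C y -> 0 <= t <= 1 ->
  C (t *: y + (1 - t) *: x).

Lemma normr_convex (x y : V) (t r : R) : `|x| < r -> `|y| < r -> 0 <= t <= 1 ->
  `|t *: y + (1 - t) *: x| < r.
Proof.
move=> xr yr /andP[t0 t1]; rewrite (le_lt_trans (ler_normD _ _))// !normrZ.
rewrite !ger0_norm ?subr_ge0//.
have [->|t0'] := eqVneq t 0; first by rewrite mul0r subr0 mul1r add0r.
have tp : 0 < t by rewrite lt_neqAle eq_sym t0'.
rewrite [ltRHS](_ : r = t * r + (1 - t) * r); last by ring.
by rewrite ltr_leD// ?ltr_pM2l// ler_wpM2l ?subr_ge0// ltW.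
Qed.

Lemma convex_comb_sub (x y a b : V) (t : R) :
  (t *: y + (1 - t) *: x) - (t *: b + (1 - t) *: a) =
  t *: (y - b) + (1 - t) *: (x - a).
Proof. by rewrite !scalerBr opprD addrACA. Qed.

Lemma ball_segment_convex (a : V) (r : R) : segment_convex (ball a r).
Proof.
move=> x y t; rewrite -!ball_normE /= => xr yr t01.
have {1}-> : a = t *: a + (1 - t) *: a by rewrite -scalerDl addrC subrK scale1r.
by rewrite convex_comb_sub; apply: normr_convex.
Qed.

End BallConvexity.

(** A property of the target space: the calculus below is needed for scalars
    and for matrices, and this inequality is all that it uses of them. *)
Definition mean_value_inequality (R : realType) (W : normedModType R) :=
  forall (f df : R -> W) (K : R) (a b : R), a <= b ->
    (forall t, a <= t <= b -> is_derive t 1 f (df t)) ->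
    (forall t, a <= t <= b -> `|df t| <= K) ->
    `|f b - f a| <= K * (b - a).

Section MeanValue.
Variable R : realType.

Lemma mean_value_real : mean_value_inequality R^o.
Proof.
move=> f df K a b ab fdf dfK.
have [c cab ->] : exists2 c, c \in `[a, b]%R & f b - f a = df c * (b - a).
  apply: MVT_segment => //.
    by move=> x /[!in_itv]/= /andP[ax xb]; apply: fdf; rewrite !ltW.
  apply: continuous_in_subspaceT => x; rewrite inE /= in_itv /= => xab.
  have [/derivable1_diffP/differentiable_continuous //] := fdf _ xab.
rewrite normrM (ger0_norm (_ : 0 <= b - a)) ?subr_ge0//.
by rewrite ler_wpM2r ?subr_ge0// dfK.
Qed.

(** The norm of a matrix is the largest entry, so the scalar inequality can be
    applied entrywise with the same constant. *)
Lemma mean_value_mx p q : mean_value_inequality 'M[R]_(p, q).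
Proof.
move=> f df K a b ab fdf dfK.
have K0 : 0 <= K by rewrite (le_trans _ (dfK a _)) ?lexx.
apply: mx_norm_bound => [|i j]; first by rewrite mulr_ge0 ?subr_ge0.
rewrite !mxE.
apply: (@mean_value_real (fun t => f t i j : R^o) (fun t => df t i j)) => //.
  move=> t tab; have [fd dfE] := fdf _ tab.
  apply: DeriveDef; first exact: (iffLR (derivable_mxP f t 1) fd i j).
  by rewrite -dfE derive_mx// mxE.
by move=> t /dfK; apply: le_trans; exact: normr_coord_le.
Qed.

End MeanValue.

(** * Maps of class C1 and symmetry of second derivatives *)

(** Linear map with prescribed values on the standard basis. *)
Definition row_comb (R : realType) (n : nat) (W : lmodType R)
  (d : 'I_n -> W) (v : 'rV[R]_n) : W := \sum_k v 0 k *: d k.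

Section RowComb.
Variables (R : realType) (n : nat) (W : lmodType R) (d : 'I_n -> W).

Fact row_comb_is_linear : linear (row_comb d).
Proof.
move=> a u v; rewrite /row_comb scaler_sumr -big_split /=.
by apply: eq_bigr => k _; rewrite !mxE scalerDl scalerA.
Qed.

HB.instance Definition _ := GRing.isLinear.Build R 'rV[R]_n W _ (row_comb d)
  row_comb_is_linear.

End RowComb.

Lemma linear_row_comb (R : realType) (n : nat) (W : lmodType R) (f : 'rV[R]_n -> W) v :
  linear f -> f v = row_comb (fun k => f (delta_mx 0 k)) v.
Proof.
move=> lf; have f0 : f 0 = 0.
  by have := lf (-1) 0 0; rewrite !scaleN1r !addNr.
have fZ a u : f (a *: u) = a *: f u by have := lf a u 0; rewrite f0 !addr0.
have fD : {morph f : u v / u + v} by move=> u u'; have := lf 1 u u'; rewrite !scale1r.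
rewrite {1}[v]row_sum_delta (big_morph _ fD f0) /row_comb.
by apply: eq_bigr => k _; rewrite fZ.
Qed.

Section Expansion.
Variables (R : realType).

Lemma zmod_telescope (V : zmodType) (a b c d : V) :
  a - (c + d) - (b - d) = a - b - c.
Proof. by rewrite opprB addrA opprD [a + _]addrA subrK addrAC. Qed.

Lemma zmod_telescope' (V : zmodType) (a b c d d' : V) : d = d' ->
  a - (c + d) - (b - d') = a - b - c.
Proof. by move=> <-; exact: zmod_telescope. Qed.

Lemma zmod_swap (V : zmodType) (a b c d : V) :
  a - b - (c - d) = a - c - (b - d).
Proof. by rewrite !opprB addrACA [RHS]addrACA [- b - c]addrC. Qed.

Lemma is_derive_exact (V W : normedModType R) (f : V -> W) (x v : V) (l : W) :
  (forall h : R, f (h *: v + x) = f x + h *: l) -> is_derive x v f l.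
Proof.
move=> fE.
have fl : h^-1 *: ((f \o shift x) (h *: v) - f x) @[h --> 0^'] --> l.
  apply: (@cvg_trans _ (cst l @ (0 : R)^')); last exact: cvg_cst.
  apply: near_eq_cvg; near=> h.
  rewrite /= fE addrC addKr scalerA mulVf ?scale1r//.
  by near: h; exact: nbhs_dnbhs_neq.
by apply: DeriveDef; [exact: cvgP fl|exact: cvg_lim fl].
Unshelve. all: by end_near. Qed.

Lemma row_comb_continuous n (W : normedModType R) (d : 'I_n -> W) :
  continuous (row_comb d).
Proof.
move=> x; rewrite /continuous_at /row_comb; apply: (@cvg_big _ _ _ _ _ _ _ (nbhs x)) => [|k _]; first exact: add_continuous.
by apply: cvgZr_tmp; exact: matrix_normedtype.coord_continuous.
Qed.

Lemma differentiable_expansion (V W : normedModType R) (f : V -> W)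
    (L : {linear V -> W}) x : continuous L ->
  (forall e, 0 < e -> \forall h \near 0, `|f (h + x) - (f x + L h)| <= e * `|h|) ->
  differentiable f x /\ forall v, 'd f x v = L v.
Proof.
move=> Lc fL.
have dxf : f \o shift x = cst (f x) + L +o_ 0 id by apply/eqaddoP.
have dE := diff_unique Lc dxf.
split; last by move=> v; rewrite dE.
by apply/diff_locallyP; rewrite dE.
Qed.

(** Moving from [x] to [h + x] through the points [prefix_row h k + x] changes
    one coordinate at a time. *)
Definition prefix_row n (h : 'rV[R]_n) (k : nat) : 'rV[R]_n :=
  \row_(i < n) if (i < k)%N then h 0 i else 0.

Lemma prefix_rowS n (h : 'rV[R]_n) (k : 'I_n) :
  prefix_row h k.+1 = h 0 k *: delta_mx 0 k + prefix_row h k.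
Proof.
apply/rowP => i; rewrite !mxE eqxx /= ltnS leq_eqVlt val_eqE.
have [->|ik] := eqVneq i k; first by rewrite ltnn mulr1 addr0.
by rewrite mulr0 add0r.
Qed.

Lemma prefix_row_seg n (h : 'rV[R]_n) (k : 'I_n) t : `|t| <= `|h 0 k| ->
  `|t *: delta_mx 0 k + prefix_row h k| <= `|h|.
Proof.
move=> th; apply: mx_norm_bound => // i j; rewrite !mxE (ord1 i) eqxx /=.
have [->|jk] := eqVneq j k.
  by rewrite ltnn mulr1 addr0 (le_trans th)// normr_coord_le.
by rewrite mulr0 add0r; case: ifP; rewrite ?normr0// normr_coord_le.
Qed.

Lemma is_derive_line (W V : normedModType R) (f : V -> W) (a v : V) (t : R) df :
  is_derive (t *: v + a) v f df -> is_derive t 1 (fun s : R => f (s *: v + a)) df.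
Proof.
move=> [fd dfE].
have E : (fun h : R => h^-1 *: (((fun s => f (s *: v + a)) \o shift t) (h *: (1:R)) -
   f (t *: v + a))) =
   (fun h => h^-1 *: ((f \o shift (t *: v + a)) (h *: v) - f (t *: v + a))).
  apply/funext => h /=; congr (_ *: (f _ - _)).
  by rewrite [h *: (1:R)]mulr1 scalerDl addrA.
apply: DeriveDef; first by rewrite /derivable E.
by rewrite /derive E.
Qed.

(** Mean value inequality along a segment of any orientation. *)
Lemma segment_increment (V W : normedModType R) (mvW : mean_value_inequality W)
    (f : V -> W) (df : V -> W) (a v : V) (s K : R) :
  (forall t, `|t| <= `|s| -> is_derive (t *: v + a) v f (df (t *: v + a))) ->
  (forall t, `|t| <= `|s| -> `|df (t *: v + a)| <= K) ->
  `|f (s *: v + a) - f a| <= K * `|s|.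
Proof.
move=> fd dfK; pose g t := f (t *: v + a).
have g0 : f a = g 0 by rewrite /g scale0r add0r.
rewrite g0 -/(g s); have [s0|s0] := leP 0 s.
  rewrite (ger0_norm s0) -[X in K * X]subr0.
  apply: (mvW g (fun t => df (t *: v + a))) => // t /andP[t0 ts].
    by apply/is_derive_line/fd; rewrite !ger0_norm.
  by apply: dfK; rewrite !ger0_norm.
rewrite (ltr0_norm s0) distrC -[X in K * X]sub0r; apply: (mvW g (fun t => df (t *: v + a))); first exact: ltW.
  move=> t /andP[t0 ts]; apply/is_derive_line/fd.
  by rewrite ler0_norm// ltr0_norm// lerN2.
by move=> t /andP[t0 ts]; apply: dfK; rewrite ler0_norm// ltr0_norm// lerN2.
Qed.

End Expansion.

Section C1.
Variables (R : realType) (n : nat) (W : normedModType R).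
Hypothesis mvW : mean_value_inequality W.
Local Notation e_ k := (delta_mx 0 k : 'rV[R]_n).
Implicit Types (U : set 'rV[R]_n) (f : 'rV[R]_n -> W).

(** The increment by [h] is split into steps along the coordinate axes. On
    each step the mean value inequality is applied to the difference of [f]
    and its linear part, whose derivative is small by continuity of the
    partial derivatives. *)
Lemma C1_differentiable U f x : open U -> U x ->
  (forall k y, U y -> derivable f y (e_ k)) ->
  (forall k, {for x, continuous ('D_(e_ k) f)}) ->
  differentiable f x /\ forall v, 'd f x v = row_comb (fun k => 'D_(e_ k) f x) v.
Proof.
move=> oU Ux fd fc.
apply: (@differentiable_expansion _ _ _ f (row_comb _)).
  exact: row_comb_continuous.
move=> e e0; have n0 : 0 < e / n.+1%:R by rewrite divr_gt0.
have : \forall y \near x, U y /\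
    forall k, `|'D_(e_ k) f y - 'D_(e_ k) f x| <= e / n.+1%:R.
  near=> y; split; first by near: y; exact: open_nbhs_nbhs.
  near: y; apply: filter_forall => k.
  have /cvgrPdist_le/(_ _ n0) := fc k.
  by apply: filterS => y; rewrite distrC.
move=> /nbhs_ballP[r /= r0 rU].
near=> h.
have hr : `|h| < r.
  by near: h; apply/nbhs_ballP; exists r => // h; rewrite -ball_normE /= sub0r normrN.
have inU z : `|z| <= `|h| -> U (z + x) /\
    forall k, `|'D_(e_ k) f (z + x) - 'D_(e_ k) f x| <= e / n.+1%:R.
  move=> zh; apply: rU; rewrite -ball_normE /= distrC addrK.
  exact: le_lt_trans hr.
have step (k : 'I_n) : `|f (prefix_row h k.+1 + x) - f (prefix_row h k + x) -
     h 0 k *: 'D_(e_ k) f x| <= e / n.+1%:R * `|h 0 k|.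
  pose g y := f y - (y 0 k *: 'D_(e_ k) f x).
  have := @segment_increment _ _ _ mvW g (fun y => 'D_(e_ k) f y - 'D_(e_ k) f x)
     (prefix_row h k + x) (e_ k) (h 0 k) (e / n.+1%:R).
  have -> : g (h 0 k *: e_ k + (prefix_row h k + x)) - g (prefix_row h k + x) =
      f (prefix_row h k.+1 + x) - f (prefix_row h k + x) - h 0 k *: 'D_(e_ k) f x.
    rewrite /g prefix_rowS addrA !mxE !eqxx /= mulr1 ltnn add0r scalerDl.
    by rewrite addr0 zmod_telescope.
  apply=> t th.
    rewrite addrA; have [Uy _] := inU _ (prefix_row_seg th).
    apply: is_deriveB; first exact/derivableP/fd.
    apply: is_derive_exact => c.
    by rewrite !mxE !eqxx /= mulr1 !scalerDl addrC.
  rewrite addrA; have [_] := inU _ (prefix_row_seg th); exact.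
pose phi m := f (prefix_row h m + x) -
   \sum_(k < n | (k < m)%N) h 0 k *: 'D_(e_ k) f x.
have telescope m : (m <= n)%N ->
    `|phi m - phi 0%N| <= m%:R * (e / n.+1%:R * `|h|).
  elim: m => [_|m IH mn]; first by rewrite subrr normr0 mul0r.
  rewrite -(subrKA (phi m)) (le_trans (ler_normD _ _))//.
  rewrite -natr1 mulrDl mul1r addrC lerD ?IH ?(ltnW mn)//.
  have -> : phi m.+1 - phi m = f (prefix_row h m.+1 + x) -
      f (prefix_row h m + x) - h 0 (Ordinal mn) *: 'D_(e_ (Ordinal mn)) f x.
    rewrite /phi (bigD1 (Ordinal mn))//= zmod_telescope'; last first.
    by apply: eq_bigl => k /=; rewrite -val_eqE /= ltnS ltn_neqAle andbC.
    by [].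
  apply: le_trans (step (Ordinal mn)) _.
  by rewrite ler_wpM2l ?normr_coord_le// ltW.
have -> : f (h + x) - (f x + row_comb (fun k => 'D_(e_ k) f x) h) =
    phi n - phi 0%N.
  rewrite /phi [X in _ = _ - (_ - X)]big_pred0// subr0.
  have -> : prefix_row h 0 = 0 by apply/rowP => i; rewrite !mxE.
  have -> : prefix_row h n = h by apply/rowP => i; rewrite !mxE ltn_ord.
  rewrite add0r /row_comb opprD addrA addrAC; congr (_ - _ - _).
  by apply: eq_bigl => k; rewrite ltn_ord.
apply: le_trans (telescope n (leqnn n)) _.
rewrite mulrA ler_wpM2r// mulrC -mulrA ler_piMr ?(ltW e0)//.
by rewrite mulrC ler_pdivrMr// mul1r ler_nat.
Unshelve. all: by end_near. Qed.

End C1.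

Section Schwarz.
Variables (R : realType) (V W : normedModType R).
Hypothesis mvW : mean_value_inequality W.

(** The mean value inequality is applied along [u] to the first difference in
    the direction [v], and then along [v] to the derivative of [f] along [u].
    Both steps have the same length, so that exchanging [u] and [v] does not
    change the second difference. *)
Lemma second_difference (f : V -> W) (U : set V) (x u v : V) (e : R) :
    open U -> U x -> 0 < e ->
    (forall y, U y -> derivable f y u) ->
    (forall y, U y -> derivable ('D_u f) y v) ->
    {for x, continuous ('D_v ('D_u f))} ->
  \forall s \near (0 : R)^'+,
    `|(f (s *: u + (s *: v + x)) - f (s *: v + x)) - (f (s *: u + x) - f x)
      - (s * s) *: 'D_v ('D_u f) x| <= e * (s * s).
Proof.
move=> oU Ux e0 fu fuv fc; set A : W := 'D_v ('D_u f) x.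
have : \forall y \near x, U y /\ `|'D_v ('D_u f) y - A| <= e.
  near=> y; split; first by near: y; exact: open_nbhs_nbhs.
  near: y; have /cvgrPdist_le/(_ _ e0) := fc.
  by apply: filterS => y; rewrite distrC.
move=> /nbhs_ballP[r /= r0 rU].
pose K := `|u| + `|v| + 1.
have K0 : 0 < K by rewrite /K ltr_wpDl// addr_ge0.
near=> s.
have s0 : 0 < s by near: s; exact: nbhs_right_gt.
have sr : s < r / K by near: s; apply: nbhs_right_lt; rewrite divr_gt0.
have inU a b : 0 <= a <= s -> 0 <= b <= s -> U (a *: u + (b *: v + x)) /\
    `|'D_v ('D_u f) (b *: v + (a *: u + x)) - A| <= e.
  move=> /andP[a0 as_] /andP[b0 bs].
  have B z : `|z| <= s * (`|u| + `|v|) -> ball x r (z + x).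
    move=> zs; rewrite -ball_normE /= distrC addrK (le_lt_trans zs)//.
    rewrite ltr_pdivlMr// in sr; rewrite (le_lt_trans _ sr)//.
    by rewrite ler_wpM2l ?(ltW s0)// /K lerDl.
  have bd : `|a *: u + b *: v| <= s * (`|u| + `|v|).
    rewrite (le_trans (ler_normD _ _))// !normrZ !ger0_norm// mulrDr.
    by rewrite lerD// ler_wpM2r.
  rewrite [X in 'D_v ('D_u f) X]addrCA addrA.
  exact: (rU _ (B _ bd)).
have s_in : 0 <= s <= s by rewrite (ltW s0) lexx.
have z_in : 0 <= (0 : R) <= s by rewrite (ltW s0) lexx.
pose phi a := f (a *: u + (s *: v + x)) - f (a *: u + x) - a *: (s *: A).
have -> : f (s *: u + (s *: v + x)) - f (s *: v + x) - (f (s *: u + x) - f x) -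
    (s * s) *: A = phi s - phi 0.
  rewrite /phi !scale0r !add0r subr0 scalerA [RHS]addrAC; congr (_ - _).
  exact: zmod_swap.
rewrite -[X in _ * (X * _)]subr0 [X in e * X]mulrC mulrA.
pose dphi a : W := 'D_u f (a *: u + (s *: v + x)) - 'D_u f (a *: u + x) - s *: A.
apply: (mvW (f := phi) (df := dphi) (K := e * s)); first exact: ltW.
  move=> a asb; apply: is_deriveB.
    apply: is_deriveB; apply: is_derive_line; apply/derivableP/fu.
      by have [] := inU a s asb s_in.
    by have [] := inU a 0 asb z_in; rewrite scale0r add0r.
  apply: is_derive_exact => h.
  by rewrite [h *: (1 : R)]mulr1 scalerDl addrC.
move=> a asb; pose psi b := 'D_u f (b *: v + (a *: u + x)) - b *: A.
have -> : dphi a = psi s - psi 0.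
  by rewrite /dphi /psi !scale0r add0r subr0 [RHS]addrAC addrCA.
rewrite -[X in _ * X]subr0.
pose dpsi b : W := 'D_v ('D_u f) (b *: v + (a *: u + x)) - A.
apply: (mvW (f := psi) (df := dpsi)); first exact: ltW.
  move=> b bs; apply: is_deriveB.
    apply: (is_derive_line (f := 'D_u f)); apply/derivableP/fuv.
    by rewrite addrCA; have [] := inU a b asb bs.
  apply: is_derive_exact => h.
  by rewrite [h *: (1 : R)]mulr1 scalerDl addrC.
by move=> b bs; have [] := inU a b asb bs.
Unshelve. all: by end_near. Qed.

(** Both mixed derivatives are the limit of the same second difference divided
    by the square of the step. *)
Lemma derive_swap (f : V -> W) (U : set V) (x u v : V) :
    open U -> U x ->
    (forall y, U y -> derivable f y u) -> (forall y, U y -> derivable f y v) ->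
    (forall y, U y -> derivable ('D_u f) y v) ->
    (forall y, U y -> derivable ('D_v f) y u) ->
    {for x, continuous ('D_v ('D_u f))} -> {for x, continuous ('D_u ('D_v f))} ->
  'D_u ('D_v f) x = 'D_v ('D_u f) x.
Proof.
move=> oU Ux fu fv fuv fvu cuv cvu.
apply/eqP; rewrite -subr_eq0 -normr_le0; apply/ler_addgt0Pr => e e0.
rewrite add0r; have e2 : 0 < e / 2 by rewrite divr_gt0.
have S1 := second_difference oU Ux e2 fu fuv cuv.
have S2 := second_difference oU Ux e2 fv fvu cvu.
have [s [[s0 H1] H2]] := filter_ex (filterI (filterI (nbhs_right_gt (0 : R)) S1) S2).
clear S1 S2.
have E : (f (s *: v + (s *: u + x)) - f (s *: u + x)) - (f (s *: v + x) - f x) =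
   (f (s *: u + (s *: v + x)) - f (s *: v + x)) - (f (s *: u + x) - f x).
  by rewrite addrCA; exact: zmod_swap.
rewrite E distrC in H2; have := lerD H1 H2.
rewrite -mulrDl -splitr => H; have := le_trans (ler_normD _ _) H.
rewrite addrC subrKA -scalerBr normrZ gtr0_norm ?mulr_gt0// mulrC.
by rewrite ler_pM2r// mulr_gt0.
Qed.

End Schwarz.

(** * Chain rule and maps of class Ck *)

Section ChainRule.
Variable R : realType.

Lemma is_derive_line0 (V W : normedModType R) (f : V -> W) (a v : V) df :
  is_derive (0 : R) 1 (fun s : R => f (s *: v + a)) df -> is_derive a v f df.
Proof.
move=> [fd dfE].
have E : (fun h : R => h^-1 *: (((fun s => f (s *: v + a)) \o shift (0 : R)) (h *: (1:R)) -
   f ((0 : R) *: v + a))) =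
   (fun h => h^-1 *: ((f \o shift a) (h *: v) - f a)).
  by apply/funext => h /=; rewrite [h *: (1:R)]mulr1 addr0 scale0r add0r.
apply: DeriveDef; first by rewrite /derivable -E.
by rewrite /derive -E.
Qed.

(** Chain rule; only the outer map has to be differentiable. *)
Lemma is_derive_chain (V W W' : normedModType R) (f : W -> W') (phi : V -> W)
    (x v : V) (w : W) :
  differentiable f (phi x) -> is_derive x v phi w ->
  is_derive x v (f \o phi) ('d f (phi x) w).
Proof.
move=> fd dphi; pose g (s : R) := phi (s *: v + x).
have g0 : g 0 = phi x by rewrite /g scale0r add0r.
have [gd gE] : is_derive (0 : R) 1 g w.
  by apply: is_derive_line; rewrite scale0r add0r.
apply: is_derive_line0; rewrite -/g.
have gdiff : differentiable g 0 by exact/derivable1_diffP.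
have fgdiff : differentiable (f \o g) 0.
  by apply: differentiable_comp => //; rewrite g0.
apply: DeriveDef; first exact/derivable1_diffP.
have -> : (fun s : R => (f \o phi) (s *: v + x)) = f \o g by [].
rewrite deriveE// diff_comp//; last by rewrite g0.
by rewrite /comp -(deriveE _ gdiff) gE g0.
Qed.

End ChainRule.

Section Ck.
Variables (R : realType).
Local Notation e_ k := (delta_mx 0 k).

Section Generic.
Variables (n : nat) (W : normedModType R).
Implicit Types (U V : set 'rV[R]_n) (f g : 'rV[R]_n -> W).

Lemma CkW k U f : Ck k.+1 U f -> Ck k U f.
Proof.
elim: k U f => [|k IH] U f; first by case.
move=> [fc fd]; split=> // v; have [dv Cv] := fd v; split=> //.
exact: IH.
Qed.

Lemma Ck_le k l U f : (k <= l)%N -> Ck l U f -> Ck k U f.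
Proof.
move/subnKC <-; elim: (l - k)%N => [|m IH]; first by rewrite addn0.
by rewrite addnS => /CkW.
Qed.

Lemma Ck_continuous k U f x : Ck k U f -> U x -> {for x, continuous f}.
Proof. by case: k => [|k] [fc _]; exact: fc. Qed.

Lemma Ck_derivable k U f x v : Ck k.+1 U f -> U x -> derivable f x v.
Proof. by move=> [_ /(_ v)[dv _]] Ux; exact: dv. Qed.

Lemma Ck_derive k U f v : Ck k.+1 U f -> Ck k U ('D_v f).
Proof. by move=> [_ /(_ v)[]]. Qed.


Lemma Ck_sub k U V f : V `<=` U -> Ck k U f -> Ck k V f.
Proof.
elim: k f => [|k IH] f VU [fc fd]; split=> //; first by move=> x /VU/fc.
  by move=> x /VU/fc.
by move=> v; have [dv /(IH _ VU) Cv] := fd v; split=> // x /VU/dv.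
Qed.

Lemma Ck_eq k U f g : open U -> (forall x, U x -> f x = g x) ->
  Ck k U f -> Ck k U g.
Proof.
move=> oU; have near_eq f' g' : (forall x, U x -> f' x = g' x) ->
    forall x, U x -> \forall y \near x, f' y = g' y.
  by move=> fg x Ux; apply: filterS (open_nbhs_nbhs (conj oU Ux)) => y /fg.
have cont f' g' : (forall x, U x -> f' x = g' x) ->
  (forall x, U x -> {for x, continuous f'}) ->
    forall x, U x -> {for x, continuous g'}.
  move=> fg fc x Ux; have := fc x Ux; rewrite /prop_for /continuous_at -fg//.
  have Nfg := near_eq _ _ fg _ Ux.
  move=> fx; apply: (@cvg_trans _ (f' @ x)) => //.
  move=> A fA; have {}fA : nbhs x (f' @^-1` A) by [].
  have : nbhs x (g' @^-1` A) by apply: filterS2 Nfg fA => y /= ->.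
  by [].
elim: k f g => [|k IH] f g fg [fc fd]; split => //; first exact: (cont f g).
  exact: (cont f g).
move=> v; have [dv Cv] := fd v; split.
  by move=> x Ux; apply: (near_eq_derivable (near_eq _ _ fg _ Ux)); exact: dv.
by apply: IH Cv => x Ux; apply: near_eq_derive; exact: near_eq.
Qed.

Lemma CkS_intro k U f : open U ->
  (forall x, U x -> {for x, continuous f}) ->
  (forall v, exists2 df, forall x, U x -> is_derive x v f (df x) & Ck k U df) ->
  Ck k.+1 U f.
Proof.
move=> oU fc fd; split=> // v; have [df fdf Cdf] := fd v; split.
  by move=> x /fdf[].
by apply: Ck_eq Cdf => // x /fdf[].
Qed.

Lemma Ck_cst k U (c : W) : open U -> Ck k U (fun=> c).
Proof.
move=> oU; elim: k c => [|k IH] c.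
  by split=> [x _|//]; exact: cst_continuous.
apply: CkS_intro => //; first by move=> x _; exact: cst_continuous.
by move=> v; exists (fun=> 0) => // x _; exact: is_derive_cst.
Qed.

Lemma Ck_add k U f g : open U -> Ck k U f -> Ck k U g ->
  Ck k U (fun x => f x + g x).
Proof.
move=> oU; elim: k f g => [|k IH] f g Cf Cg.
  split=> [x Ux|//]; exact: (cvgD (Ck_continuous Cf Ux) (Ck_continuous Cg Ux)).
apply: CkS_intro => //.
  by move=> x Ux; exact: (cvgD (Ck_continuous Cf Ux) (Ck_continuous Cg Ux)).
move=> v; exists (fun x => 'D_v f x + 'D_v g x).
  move=> x Ux; apply: is_deriveD; apply/derivableP.
    exact: (Ck_derivable Cf Ux).
  exact: (Ck_derivable Cg Ux).
by apply: IH; exact: Ck_derive.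
Qed.

Lemma Ck_scale k U (c : R) f : open U -> Ck k U f -> Ck k U (fun x => c *: f x).
Proof.
move=> oU; elim: k f => [|k IH] f Cf.
  by split=> [x Ux|//]; exact: (cvgZ (cvg_cst c) (Ck_continuous Cf Ux)).
apply: CkS_intro => //.
  by move=> x Ux; exact: (cvgZ (cvg_cst c) (Ck_continuous Cf Ux)).
move=> v; exists (fun x => c *: 'D_v f x).
  by move=> x Ux; apply: is_deriveZ; apply/derivableP; exact: (Ck_derivable Cf Ux).
by apply: IH; exact: Ck_derive.
Qed.

Lemma Ck_sum k U (I : Type) (r : seq I) (P : pred I) (F : I -> 'rV[R]_n -> W) :
  open U -> (forall i, P i -> Ck k U (F i)) ->
  Ck k U (fun x => \sum_(i <- r | P i) F i x).
Proof.
move=> oU CF; elim: r => [|i r IH].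
  by apply: (Ck_eq oU _ (Ck_cst k 0 oU)) => x _; rewrite big_nil.
case Pi : (P i); last by apply: (Ck_eq oU _ IH) => x _; rewrite big_cons Pi.
apply: (Ck_eq oU _ (Ck_add oU (CF i Pi) IH)) => x _.
by rewrite big_cons Pi.
Qed.

Hypothesis mvW : mean_value_inequality W.

Lemma Ck1_diff U f x : open U -> Ck 1 U f -> U x ->
  differentiable f x /\
  forall v, 'd f x v = row_comb (fun k => 'D_(e_ k) f x) v.
Proof.
move=> oU Cf Ux; apply: (C1_differentiable mvW oU Ux).
  by move=> k y Uy; exact: (Ck_derivable Cf Uy).
by move=> k; exact: (Ck_continuous (k := 0) (Ck_derive _ Cf)).
Qed.

Lemma Ck1_differentiable k U f x : open U -> Ck k.+1 U f -> U x ->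
  differentiable f x.
Proof. by move=> oU /(@Ck_le 1 k.+1 _ _ isT) Cf Ux; have [] := Ck1_diff oU Cf Ux. Qed.

Lemma derive_row_comb k U f x v : open U -> Ck k.+1 U f -> U x ->
  'D_v f x = row_comb (fun i => 'D_(e_ i) f x) v.
Proof.
move=> oU /(@Ck_le 1 k.+1 _ _ isT) Cf Ux; have [df dfE] := Ck1_diff oU Cf Ux.
by rewrite deriveE.
Qed.

Lemma derive_linear k U f x a u v : open U -> Ck k.+1 U f -> U x ->
  'D_(a *: u + v) f x = a *: 'D_u f x + 'D_v f x.
Proof. by move=> oU Cf Ux; rewrite !(derive_row_comb _ oU Cf Ux) linearP. Qed.

Lemma Ck_derive_swap k U f x u v : open U -> Ck k.+2 U f -> U x ->
  'D_u ('D_v f) x = 'D_v ('D_u f) x.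
Proof.
move=> oU /(@Ck_le 2 k.+2 _ _ isT) Cf Ux.
apply: (derive_swap mvW oU Ux).
- by move=> y; exact: (Ck_derivable Cf).
- by move=> y; exact: (Ck_derivable Cf).
- by move=> y; exact: (Ck_derivable (Ck_derive _ Cf)).
- by move=> y; exact: (Ck_derivable (Ck_derive _ Cf)).
- by have := Ck_continuous (k := 0) (Ck_derive _ (Ck_derive _ Cf)) Ux; exact.
- by have := Ck_continuous (k := 0) (Ck_derive _ (Ck_derive _ Cf)) Ux; exact.
Qed.

End Generic.

Section Scalar.
Variables (n : nat).
Implicit Types (U V : set 'rV[R]_n) (f g : 'rV[R]_n -> R^o).

Lemma Ck_mul k U f g : open U -> Ck k U f -> Ck k U g ->
  Ck k U (fun x => f x * g x : R^o).
Proof.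
move=> oU; elim: k f g => [|k IH] f g Cf Cg.
  by split=> [x Ux|//]; exact: (cvgM (Ck_continuous Cf Ux) (Ck_continuous Cg Ux)).
apply: CkS_intro => //.
  by move=> x Ux; exact: (cvgM (Ck_continuous Cf Ux) (Ck_continuous Cg Ux)).
move=> v; exists (fun x => f x * 'D_v g x + g x * 'D_v f x).
  move=> x Ux; apply: is_deriveM; apply/derivableP.
    exact: (Ck_derivable Cf Ux).
  exact: (Ck_derivable Cg Ux).
by apply: Ck_add => //; apply: IH; (exact: Ck_derive || exact: CkW).
Qed.

Lemma Ck_opp k U f : open U -> Ck k U f -> Ck k U (fun x => - f x : R^o).
Proof.
move=> oU Cf; apply: (Ck_eq oU _ (Ck_scale (-1) oU Cf)) => x _.
by rewrite scaleN1r.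
Qed.

Lemma Ck_inv k U f : open U -> (forall x, U x -> f x != 0) -> Ck k U f ->
  Ck k U (fun x => (f x)^-1 : R^o).
Proof.
move=> oU f0; elim: k => [|k IH] Cf.
  by split=> [x Ux|//]; exact: (cvgV (f0 _ Ux) (Ck_continuous Cf Ux)).
apply: CkS_intro => //.
  by move=> x Ux; exact: (cvgV (f0 _ Ux) (Ck_continuous Cf Ux)).
have {}IH := IH (CkW Cf).
move=> v; exists (fun x => - ((f x)^-1 * (f x)^-1 * 'D_v f x)).
  move=> x Ux; have fd := @Ck_derivable _ _ _ _ _ _ v Cf Ux.
  apply: DeriveDef; first by apply: derivableV => //; exact: f0.
  by rewrite deriveV ?f0// -exprVn expr2 scaleNr.
apply: Ck_opp => //; apply: Ck_mul => //; last exact: Ck_derive.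
exact: Ck_mul.
Qed.

Lemma Ck_coord k U (i : 'I_n) : open U -> Ck k U (fun x => x 0 i : R^o).
Proof.
move=> oU; case: k => [|k].
  by split=> [x _|//]; exact: matrix_normedtype.coord_continuous.
apply: CkS_intro => //.
  by move=> x _; exact: matrix_normedtype.coord_continuous.
move=> v; exists (fun=> v 0 i); last exact: Ck_cst.
by move=> x Ux; apply: is_derive_exact => h; rewrite !mxE addrC.
Qed.

End Scalar.

Section Matrix.
Variables (n p q : nat).
Implicit Types (U : set 'rV[R]_n) (f : 'rV[R]_n -> 'M[R]_(p, q)).

Lemma continuous_mxP (T : topologicalType) (f : T -> 'M[R]_(p, q)) (x : T) :
  {for x, continuous f} <-> forall i j, {for x, continuous (fun y => f y i j : R^o)}.
Proof.
split=> [fc i j|fc].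
  apply: (@continuous_comp _ _ _ f (fun A : 'M[R]_(p, q) => A i j : R^o)) => //.
  exact: matrix_normedtype.coord_continuous.
apply/cvgrPdist_le => e e0; near=> y.
apply: mx_norm_bound => [|i j]; first exact: ltW.
rewrite !mxE; move: i j; near: y.
apply: filter_forall => i; apply: filter_forall => j.
by have /cvgrPdist_le/(_ _ e0) := fc i j.
Unshelve. all: by end_near. Qed.

Lemma is_derive_mxP (V : normedModType R) (f : V -> 'M[R]_(p, q)) (x v : V) (A : 'M[R]_(p, q)) :
  is_derive x v f A <-> forall i j, is_derive x v (fun y => f y i j : R^o) (A i j).
Proof.
split=> [[fd <-] i j|fd].
  apply: DeriveDef; first exact: (iffLR (derivable_mxP f x v) fd i j).
  by rewrite derive_mx// mxE.
have fd' : derivable f x v by apply/derivable_mxP => i j; have [] := fd i j.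
apply: DeriveDef => //; rewrite derive_mx//; apply/matrixP => i j; rewrite mxE.
by have [] := fd i j.
Qed.

Lemma Ck_mxP k U f : open U ->
  Ck k U f <-> forall i j, Ck k U (fun x => f x i j : R^o).
Proof.
move=> oU; elim: k f => [|k IH] f; split.
- by move=> [fc _] i j; split=> // x /fc; move/continuous_mxP.
- by move=> fc; split=> [x Ux|//]; apply/continuous_mxP => i j; have [+ _] := fc i j; exact.
- move=> Cf i j; apply: CkS_intro => //.
    by move=> x Ux; have /continuous_mxP := Ck_continuous Cf Ux.
  move=> v; exists (fun x => 'D_v f x i j).
    move=> x Ux; move: i j; apply/is_derive_mxP/derivableP.
    exact: (Ck_derivable Cf Ux).
  by move: i j; apply/IH; exact: Ck_derive.
- move=> Cf; apply: CkS_intro => //.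
    by move=> x Ux; apply/continuous_mxP => i j; have := Ck_continuous (Cf i j) Ux.
  move=> v; exists (fun x => \matrix_(i, j) 'D_v (fun x => f x i j : R^o) x).
    move=> x Ux; apply/is_derive_mxP => i j; rewrite mxE.
    apply/derivableP; exact: (Ck_derivable (Cf i j) Ux).
  apply/IH => i j; apply: (Ck_eq oU _ (Ck_derive v (Cf i j))) => x Ux.
  by rewrite mxE.
Qed.

End Matrix.

(** The derivatives of a composite are sums of products of derivatives of the
    two maps, hence induction on [k]. *)
Lemma Ck_comp n m k (U : set 'rV[R]_n) (V : set 'rV[R]_m)
    (f : 'rV[R]_m -> R^o) (phi : 'rV[R]_n -> 'rV[R]_m) : open U -> open V ->
  (forall x, U x -> V (phi x)) -> Ck k V f -> Ck k U phi -> Ck k U (f \o phi).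
Proof.
move=> oU oV UV; elim: k f => [|k IH] f Cf Cphi.
  split=> [x Ux|//]; apply: continuous_comp.
    exact: (Ck_continuous Cphi Ux).
  exact: (Ck_continuous Cf (UV _ Ux)).
apply: CkS_intro => //.
  move=> x Ux; apply: continuous_comp.
    exact: (Ck_continuous Cphi Ux).
  exact: (Ck_continuous Cf (UV _ Ux)).
move=> v.
exists (fun x => \sum_(j < m) 'D_v phi x 0 j * ('D_(e_ j) f \o phi) x).
  move=> x Ux.
  have dphi := derivableP (@Ck_derivable _ _ _ _ _ _ v Cphi Ux).
  have df := Ck1_differentiable (@mean_value_real R) oV Cf (UV _ Ux).
  have := is_derive_chain df dphi.
  rewrite -deriveE// (derive_row_comb (@mean_value_real R) _ oV Cf (UV _ Ux)).
  by [].
apply: Ck_sum => // j _; apply: Ck_mul => //.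
  by have /Ck_mxP := Ck_derive v Cphi; exact.
by apply: IH; [exact: Ck_derive|exact: CkW].
Qed.

End Ck.

(** * Ordinary differential equations *)

Section Antiderivative.
Variable R : realType.

Lemma continuous_antiderivative (f : R -> R) (T : R) : 0 < T -> continuous f ->
  exists F : R -> R^o, forall t : R, `|t| <= T -> is_derive t 1 F (f t).
Proof.
move=> T0 fc; pose mu := @lebesgue_measure R.
(* the interval of integration starts before [- T], so that all times under
   consideration are interior points *)
exists (fun y => (\int[mu]_(t in [set` `[- T - 1, y]]) (f t))%R : R^o) => t tT.
have /andP[t1 t2] : - T <= t <= T by rewrite -ler_norml.
have [|||| Fd FE] := @continuous_FTC1_closed R f (- T - 1) t (T + 1).
- by rewrite (le_lt_trans t2)// ltrDl.
- apply: continuous_compact_integrable; first exact: segment_compact.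
  by apply: continuous_subspaceT; exact: fc.
- by rewrite (lt_le_trans _ t1)// ltrBlDr ltrDl.
- exact: fc.
by apply: (DeriveDef Fd); rewrite -derive1E FE.
Qed.

Lemma continuous_antiderivative_mx p q (f : R -> 'M[R]_(p, q)) (T : R) :
  0 < T -> continuous f ->
  exists F : R -> 'M[R]_(p, q), forall t : R, `|t| <= T -> is_derive t 1 F (f t).
Proof.
move=> T0 fc.
have fijc i j : continuous (fun t => f t i j : R).
  by move=> t; have /continuous_mxP := fc t; exact.
pose F i j := projT1 (cid (continuous_antiderivative T0 (fijc i j))).
exists (fun t => \matrix_(i, j) F i j t) => t tT.
apply/is_derive_mxP => i j; have := projT2 (cid (continuous_antiderivative T0 (fijc i j))) t tT.
rewrite -/(F i j) => H.
by rewrite (_ : (fun y => (\matrix_(i, j) F i j y) i j) = F i j)//; apply/funext => y; rewrite mxE.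
Qed.

End Antiderivative.

Section FixedPoint.
Variables (R : realType) (W : normedModType R).
Hypothesis completeW : forall u : nat -> W,
  (forall e : R, 0 < e -> exists k, forall m, (k <= m)%N -> `|u m - u k| < e) ->
  cvgn u.
Implicit Types y z : R -> W.

(** Banach fixed point theorem: the distances of successive iterates decay
    geometrically. Continuous curves on the whole line have no finite uniform
    distance in general, hence the last hypothesis on the first iterate. *)
Lemma halving_operator_fixpoint (Op : (R -> W) -> R -> W) y1 (C : R) :
  (forall y, continuous y -> continuous (Op y)) ->
  (forall y z K, continuous y -> continuous z ->
    (forall s, `|y s - z s| <= K) -> forall t, `|Op y t - Op z t| <= K / 2) ->
  continuous y1 -> (forall t, `|Op y1 t - y1 t| <= C) ->
  exists2 y, continuous y & forall t, Op y t = y t.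
Proof.
move=> Opc Oph y1c y1C.
have C0 : 0 <= C by rewrite (le_trans _ (y1C 0)).
pose u k := iter k Op y1.
have uc k : continuous (u k) by elim: k => [//|k IH]; exact: Opc.
have step k t : `|u k.+1 t - u k t| <= C / 2 ^+ k.
  elim: k t => [|k IH] t; first by rewrite expr0 divr1; exact: y1C.
  by rewrite exprSr invfM mulrA; apply: (Oph (u k.+1) (u k)).
(* sum of the bounds for the steps from the [k]-th one on *)
pose tail k : R := 2 * C / 2 ^+ k.
have tailS k : tail k = tail k.+1 + C / 2 ^+ k.
  by rewrite /tail exprS; field; rewrite expf_neq0.
have tail0 k : 0 <= tail k by rewrite /tail divr_ge0 ?mulr_ge0// exprn_ge0.
have dist k m t : `|u (k + m)%N t - u k t| <= tail k - tail (k + m)%N.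
  elim: m => [|m IH]; first by rewrite addn0 !subrr normr0.
  rewrite addnS -(subrKA (u (k + m)%N t)) (le_trans (ler_normD _ _))//.
  have := lerD (step (k + m)%N t) IH.
  by rewrite (tailS (k + m)%N); lra.
have distle k m t : (k <= m)%N -> `|u m t - u k t| <= tail k.
  by move=> /subnKC <-; rewrite (le_trans (dist _ _ _))// lerBlDr lerDl.
have tail_small e : 0 < e -> exists k, tail k < e.
  move=> e0; have : geometric (2 * C) 2^-1 @ \oo --> (0 : R).
    by apply: cvg_geometric; rewrite gtr0_norm ?invr_gt0// invf_lt1// ltr1n.
  move=> /cvgrPdist_lt/(_ _ e0)[N _ /(_ N)/=]; rewrite leqnn => /(_ isT) H.
  exists N; move: H; rewrite sub0r normrN ger0_norm.
    by rewrite /tail exprVn.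
  by rewrite mulr_ge0 ?mulr_ge0// exprn_ge0// invr_ge0.
have ucvg t : cvg (u n t @[n --> \oo]).
  apply: completeW => e e0; have [k ke] := tail_small _ e0.
  by exists k => m km; exact: le_lt_trans (distle _ _ _ km) ke.
pose y t := lim (u n t @[n --> \oo]).
have ylim k t : `|y t - u k t| <= tail k.
  apply/ler_addgt0Pr => e e0.
  have /cvgrPdist_le/(_ _ e0)[N _ HN] : u n t @[n --> \oo] --> y t by exact: ucvg.
  have Nm := HN (maxn N k) (leq_maxl _ _).
  rewrite -(subrKA (u (maxn N k) t)) (le_trans (ler_normD _ _))// addrC lerD//.
  exact/distle/leq_maxr.
have yc : continuous y.
  move=> t; apply/cvgrPdist_le => e e0.
  have e3 : 0 < e / 3 by rewrite divr_gt0.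
  have [k ke] := tail_small _ e3.
  have /cvgrPdist_le/(_ _ e3) := uc k t.
  apply: filterS => s us.
  have -> : y t - y s = (y t - u k t) + (u k t - u k s) - (y s - u k s).
    by rewrite addrA subrK opprB addrA subrK.
  rewrite (le_trans (ler_normB _ _))// (le_trans (lerD (ler_normD _ _) (lexx _)))//.
  have := ylim k t; have := ylim k s; lra.
exists y => // t; apply/eqP; rewrite -subr_eq0 -normr_le0.
apply/ler_addgt0Pr => e e0; rewrite add0r.
have [k ke] := tail_small _ e0.
rewrite -(subrKA (u k.+1 t)) (le_trans (ler_normD _ _))//.
have A : `|Op y t - u k.+1 t| <= tail k / 2.
  by apply: (Oph y (u k)) => // s.
have B := ylim k.+1 t; rewrite distrC in B.
have D : tail k.+1 = tail k / 2 by rewrite /tail exprS; field; rewrite expf_neq0.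
lra.
Qed.

End FixedPoint.

Section Gronwall.
Variables (R : realType) (W : normedModType R).
Hypothesis mvW : mean_value_inequality W.

(** At a time where [d] is largest, the mean value inequality bounds it by
    half of itself plus [e * eta], the interval being so short that [L * eta
    <= 1 / 2]. *)
Lemma short_gronwall (d dd : R -> W) (t0 eta L e : R) :
  0 <= eta -> 0 <= L -> 0 <= e -> L * eta <= 1 / 2 -> d t0 = 0 ->
  (forall s : R, `|s - t0| <= eta -> is_derive s 1 d (dd s)) ->
  (forall s, `|s - t0| <= eta -> `|dd s| <= L * `|d s| + e) ->
  forall s, `|s - t0| <= eta -> `|d s| <= 2 * e * eta.
Proof.
move=> eta0 L0 e0 Leta d0 dd1 ddL s st.
have itvE x : x \in `[t0 - eta, t0 + eta]%R = (`|x - t0| <= eta).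
  by rewrite in_itv /= ler_distl.
have [||c] := @EVT_max R (fun x => `|d x|) (t0 - eta) (t0 + eta).
- by rewrite lerD2l (le_trans _ eta0)// oppr_le0.
- apply: continuous_in_subspaceT => x; rewrite inE /= itvE => xt.
  have [/derivable1_diffP/differentiable_continuous dc _] := dd1 _ xt.
  exact: (cvg_norm dc).
rewrite itvE => ct cmax.
have bound x : `|x - t0| <= eta -> `|dd x| <= L * `|d c| + e.
  move=> xt; rewrite (le_trans (ddL _ xt))// lerD2r ler_wpM2l// cmax//.
  by rewrite itvE.
have dc_le : `|d c| <= (L * `|d c| + e) * eta.
  have := @segment_increment R _ _ mvW d dd t0 1 (c - t0) (L * `|d c| + e).
  have E t : t *: (1 : R) + t0 - t0 = t by rewrite addrK [t *: 1]mulr1.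
  rewrite [_ *: 1]mulr1 subrK d0 subr0 => H.
  apply: le_trans (H _ _) _.
  - by move=> t tc; apply: dd1; rewrite E (le_trans tc).
  - by move=> t tc; apply: bound; rewrite E (le_trans tc).
  - by rewrite ler_wpM2l// addr_ge0// mulr_ge0.
have := cmax s; rewrite itvE => /(_ st) dsc.
have nd : 0 <= `|d c| by [].
have : L * `|d c| * eta <= `|d c| / 2 by nra.
nra.
Qed.

End Gronwall.

Section Picard.
Variables (R : realType) (p q : nat).
Local Notation W := 'M[R]_(p, q).

Lemma mx_cauchy_cvg (u : nat -> W) :
  (forall e : R, 0 < e -> exists k, forall m, (k <= m)%N -> `|u m - u k| < e) ->
  cvgn u.
Proof.
move=> uP; apply: cauchy_cvg; apply/cauchy_exP => e e0; have [k ke] := uP e e0.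
by exists (u k), k => // m /= km; rewrite -ball_normE /= distrC ke.
Qed.

(** Truncating the time lets integral operators on a bounded interval act on
    curves defined on the whole line. *)
Definition clamp (T t : R) : R := if t < - T then - T else if T < t then T else t.

Lemma clamp_norm T t : 0 <= T -> `|clamp T t| <= T.
Proof.
move=> T0; rewrite /clamp ler_norml; case: ltP => [|h1]; first lra.
case: ltP => [|h2]; first lra.
by rewrite h1 h2.
Qed.

Lemma clamp_id T t : `|t| <= T -> clamp T t = t.
Proof.
by rewrite ler_norml /clamp => /andP[h1 h2]; rewrite !ltNge h1 h2.
Qed.

Lemma clamp_dist T s t : 0 <= T -> `|clamp T s - clamp T t| <= `|s - t|.
Proof.
move=> T0; rewrite ler_normr !ler_norml /clamp.
case: (ltP s (- T)) => h1; case: (ltP t (- T)) => h2;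
  case: (ltP T s) => h3; case: (ltP T t) => h4; lra.
Qed.

Lemma clamp_continuous T : 0 <= T -> continuous (clamp T).
Proof.
move=> T0 t; apply/cvgrPdist_le => e e0.
have /cvgrPdist_le/(_ e e0) := @cvg_id _ (nbhs t).
by apply: filterS => s; exact: le_trans (clamp_dist _ _ T0).
Qed.

(** The integral operator halves uniform distances because [L * T <= 1 / 2]. *)
Theorem picard (Phi : R -> W -> W) (L T : R) (y0 : W) :
  0 < T -> L * T <= 1 / 2 ->
  (forall y, continuous y -> continuous (fun t => Phi t (y t))) ->
  (forall t y z, `|Phi t y - Phi t z| <= L * `|y - z|) ->
  exists y : R -> W, [/\ continuous y, y 0 = y0 &
    forall t : R, `|t| < T -> is_derive t 1 y (Phi t (y t))].
Proof.
move=> T0 LT Phic PhiL; have T0' := ltW T0.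
(* antiderivatives are chosen for all curves at once; for discontinuous ones
   any value will do *)
have antiP f : exists F : R -> W, continuous f ->
    forall t : R, `|t| <= T -> is_derive t 1 F (f t).
  have [fc|] := pselect (continuous f); last by exists (fun=> 0).
  by have [F HF] := continuous_antiderivative_mx T0 fc; exists F.
pose anti f := projT1 (cid (antiP f)).
have antiE f : continuous f -> forall t : R, `|t| <= T -> is_derive t 1 (anti f) (f t).
  by move=> fc; exact: (projT2 (cid (antiP f)) fc).
have incr f (F : R -> W) K t : (forall s : R, `|s| <= T -> is_derive s 1 F (f s)) ->
    (forall s, `|s| <= T -> `|f s| <= K) -> `|t| <= T -> `|F t - F 0| <= K * T.
  move=> dF fK tT; have K0 : 0 <= K by rewrite (le_trans _ (fK 0 _)) ?normr0.
  have := @segment_increment R _ _ (@mean_value_mx R p q) F f 0 1 t K.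
  rewrite [_ *: 1]mulr1 addr0 => H; apply: le_trans (H _ _) _.
  - by move=> s st; rewrite [_ *: 1]mulr1 addr0; apply: dF; exact: le_trans tT.
  - by move=> s st; rewrite [_ *: 1]mulr1 addr0; apply: fK; exact: le_trans tT.
  - exact: ler_wpM2l.
pose A y := anti (fun t => Phi t (y t)).
pose Op y t := y0 + (A y (clamp T t) - A y 0).
have AE y : continuous y -> forall t : R, `|t| <= T -> is_derive t 1 (A y) (Phi t (y t)).
  by move=> yc; apply: antiE; exact: Phic.
have Opc y : continuous y -> continuous (Op y).
  move=> yc t; apply: cvgD; first exact: cvg_cst.
  apply: cvgB; last exact: cvg_cst.
  apply: continuous_comp; first exact: clamp_continuous.
  have [/derivable1_diffP/differentiable_continuous + _] := AE y yc _ (clamp_norm t T0').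
  exact.
have Oph y z K : continuous y -> continuous z ->
    (forall s, `|y s - z s| <= K) -> forall t, `|Op y t - Op z t| <= K / 2.
  move=> yc zc yzK t.
  have K0 : 0 <= K by rewrite (le_trans _ (yzK 0)).
  have -> : Op y t - Op z t = (A y \- A z) (clamp T t) - (A y \- A z) 0.
    by rewrite /Op /= opprD addrACA subrr add0r zmod_swap.
  have [L0|L0] := leP 0 L; last first.
    have yz s : y s = z s.
      apply/eqP; rewrite -subr_eq0 -normr_le0; have := PhiL 0 (y s) (z s).
      have : 0 <= `|Phi 0 (y s) - Phi 0 (z s)| by []. nra.
    have -> : y = z by apply/funext.
    by rewrite /= !subrr normr0 divr_ge0.
  apply: le_trans (@incr (fun s => Phi s (y s) - Phi s (z s)) _ (L * K) _ _ _ _) _.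
  - by move=> s sT; apply: is_deriveB; exact: AE.
  - by move=> s sT; rewrite (le_trans (PhiL _ _ _))// ler_wpM2l.
  - exact: clamp_norm.
  - nra.
have y0c : continuous (cst y0 : R -> W) by move=> t; exact: cvg_cst.
have [C HC] : exists C, forall t, `|Op (cst y0) t - y0| <= C.
  have [||c _ cmax] := @EVT_max R (fun x => `|Op (cst y0) x - y0|) (- T) T.
  - lra.
  - apply: continuous_subspaceT => x.
    apply: (@cvg_norm _ _ _ _ _ (fun x => Op (cst y0) x - y0)).
    by apply: cvgB; [exact: (Opc _ y0c)|exact: cvg_cst].
  exists `|Op (cst y0) c - y0| => t.
  have := cmax (clamp T t); rewrite in_itv /= -ler_norml clamp_norm// => /(_ isT).
  by rewrite /Op (clamp_id (clamp_norm t T0')).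
have [y yc yE] := halving_operator_fixpoint mx_cauchy_cvg Opc Oph y0c HC.
exists y; split=> //.
  by rewrite -yE /Op clamp_id ?normr0// subrr addr0.
move=> t tT.
have := AE y yc t (ltW tT) => dA.
have H : is_derive t 1 (fun t => y0 + (A y t - A y 0)) (Phi t (y t)).
  have : is_derive t 1 (fun t => y0 + (A y t - A y 0)) (0 + (Phi t (y t) - 0)).
    apply: is_deriveD; apply: is_deriveB.
  by rewrite add0r subr0.
apply: near_eq_is_derive H.
near=> s; rewrite -[RHS]yE /Op clamp_id//; apply: ltW; near: s.
have : open [set s : R | `|s| < T].
  apply: (@open_comp _ _ (fun s : R => `|s|) [set x | x < T]); last exact: open_lt.
  by move=> x _; exact: norm_continuous.
by move=> oT; exact: open_nbhs_nbhs.
Unshelve. all: by end_near. Qed.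

End Picard.

Section LocalBounds.
Variables (R : realType) (n : nat) (W : normedModType R).
Hypothesis mvW : mean_value_inequality W.
Local Notation e_ k := (delta_mx 0 k).

Lemma near_bounded (V : topologicalType) (I : finType) (f : I -> V -> W) (x : V) :
  (forall i, {for x, continuous (f i)}) ->
  exists2 C, 0 <= C & \forall y \near x, forall i, `|f i y| <= C.
Proof.
move=> fc; exists (\sum_i (`|f i x| + 1)).
  by apply: sumr_ge0 => i _; rewrite addr_ge0.
apply: filter_forall => i.
have /cvgrPdist_le/(_ _ ltr01) := fc i; apply: filterS => y fy.
rewrite (bigD1 i)//=; apply: (@le_trans _ _ (`|f i x| + 1)); last first.
  by rewrite lerDl sumr_ge0// => j _; rewrite addr_ge0.
rewrite -[X in `|X|](subrK (f i x)) addrC (le_trans (ler_normD _ _))//.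
by rewrite lerD2l distrC.
Qed.

Lemma norm_row_comb_le (d : 'I_n -> W) (v : 'rV[R]_n) (C : R) :
  (forall i, `|d i| <= C) -> `|row_comb d v| <= n%:R * C * `|v|.
Proof.
move=> dC; rewrite (le_trans (ler_norm_sum _ _ _))//.
apply: (@le_trans _ _ (\sum_(k < n) C * `|v|)).
  apply: ler_sum => k _; rewrite normrZ mulrC ler_pM//.
  exact: normr_coord_le.
by rewrite sumr_const card_ord -mulrA mulr_natl.
Qed.

Lemma ball_segment (x y h : 'rV[R]_n) (r t : R) : ball x r y -> ball x r (h + y) ->
  0 <= t <= 1 -> ball x r (t *: h + y).
Proof.
move=> yr hyr t01; have -> : t *: h + y = t *: (h + y) + (1 - t) *: y.
  by rewrite scalerDr scalerBl scale1r -addrA [t *: y + _]addrC subrK.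
exact: ball_segment_convex yr hyr t01.
Qed.

(** One constant serves for all base points and increments in a ball. The
    estimates follow from the mean value inequality, applied twice for the
    last one. *)
Lemma local_taylor (U : set 'rV[R]_n) (f : 'rV[R]_n -> W) (x : 'rV[R]_n) :
  open U -> U x -> Ck 2 U f ->
  exists2 C, 0 <= C & \forall r \near (0 : R)^'+, ball x r `<=` U /\
    forall y h, ball x r y -> ball x r (h + y) ->
    [/\ `|f y| <= C, `|f (h + y) - f y| <= C * `|h| &
        `|f (h + y) - f y - 'D_h f y| <= C * `|h| ^+ 2].
Proof.
move=> oU Ux Cf.
have [C0 C00 B0] : exists2 C, 0 <= C & \forall y \near x, forall i : 'I_1, `|f y| <= C.
  by apply: near_bounded => _; exact: (Ck_continuous Cf Ux).
have [C1 C10 B1] : exists2 C, 0 <= C & \forall y \near x, forall i : 'I_n,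
    `|'D_(e_ i) f y| <= C.
  by apply: near_bounded => i; exact: (Ck_continuous (Ck_derive _ Cf) Ux).
have [C2 C20 B2] : exists2 C, 0 <= C & \forall y \near x, forall i : 'I_n * 'I_n,
    `|'D_(e_ i.2) ('D_(e_ i.1) f) y| <= C.
  apply: near_bounded => i.
  exact: (Ck_continuous (Ck_derive _ (Ck_derive _ Cf)) Ux).
have [r0 /= r00 Hr0] : exists2 r, 0 < r & ball x r `<=` [set y | [/\ U y,
   `|f y| <= C0, forall i : 'I_n, `|'D_(e_ i) f y| <= C1 & forall i j : 'I_n,
    `|'D_(e_ j) ('D_(e_ i) f) y| <= C2]].
  apply/nbhs_ballP; near=> y; split.
  - by near: y; exact: open_nbhs_nbhs.
  - have : forall i : 'I_1, `|f y| <= C0 by near: y.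
    by move/(_ ord0).
  - by near: y.
  - have : forall i : 'I_n * 'I_n, `|'D_(e_ i.2) ('D_(e_ i.1) f) y| <= C2 by near: y.
    by move=> H i j; exact: (H (i, j)).
have n0 : 0 <= n%:R :> R by [].
have D1 z h : ball x r0 z -> `|'D_h f z| <= n%:R * C1 * `|h|.
  move=> /Hr0[Uz _ H _]; rewrite (derive_row_comb mvW _ oU Cf Uz).
  exact: norm_row_comb_le.
have D2 z h : ball x r0 z -> `|'D_h ('D_h f) z| <= n%:R * (n%:R * C2 * `|h|) * `|h|.
  move=> /Hr0[Uz _ _ H]; rewrite (derive_row_comb mvW _ oU (Ck_derive h Cf) Uz).
  apply: norm_row_comb_le => i; rewrite (Ck_derive_swap mvW _ _ oU Cf Uz).
  rewrite (derive_row_comb mvW _ oU (Ck_derive (e_ i) Cf) Uz).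
  by apply: norm_row_comb_le => j; exact: H.
pose C := C0 + n%:R * C1 + n%:R * (n%:R * C2).
have C_0 : C0 <= C by rewrite /C -addrA lerDl addr_ge0// !mulr_ge0.
have C_1 : n%:R * C1 <= C.
  by rewrite /C addrAC lerDr addr_ge0// !mulr_ge0.
have C_2 : n%:R * (n%:R * C2) <= C by rewrite /C lerDr addr_ge0// mulr_ge0.
exists C; first exact: le_trans C_0.
near=> r.
have rr0 : r <= r0 by near: r; apply: nbhs_right_le.
have sub z : ball x r z -> ball x r0 z by apply: le_ball.
split=> [y /sub/Hr0[]//|y h xy xhy].
have seg t : 0 <= t <= 1 -> ball x r0 (t *: h + y).
  by move=> t01; apply/sub/ball_segment.
have fE : f (h + y) - f y = f (1 *: h + y) - f (0 *: h + y).
  by rewrite scale1r scale0r add0r.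
split.
- by have [_ + _ _] := Hr0 _ (sub _ xy); move/le_trans; exact.
- rewrite fE -[X in _ <= X]mulr1 -[X in _ * X](subr0 1).
  apply: (mvW (f := fun t => f (t *: h + y)) (df := fun t => 'D_h f (t *: h + y))) => // t t01.
    apply: is_derive_line; apply/derivableP; have [Uz _ _ _] := Hr0 _ (seg _ t01).
    exact: (Ck_derivable Cf Uz).
  by rewrite (le_trans (D1 _ _ (seg _ t01)))// ler_wpM2r.
- pose g (t : R) := f (t *: h + y) - t *: 'D_h f y.
  have -> : f (h + y) - f y - 'D_h f y = g 1 - g 0.
    by rewrite /g !scale1r !scale0r add0r subr0 addrAC.
  rewrite -[X in _ <= X]mulr1 -[X in _ * X](subr0 1).
  apply: (mvW (f := g) (df := fun t => 'D_h f (t *: h + y) - 'D_h f y)) => // t t01.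
    apply: is_deriveB.
      apply: is_derive_line; apply/derivableP; have [Uz _ _ _] := Hr0 _ (seg _ t01).
      exact: (Ck_derivable Cf Uz).
    by apply: is_derive_exact => s; rewrite [s *: 1]mulr1 scalerDl addrC.
  have -> : 'D_h f y = 'D_h f (0 *: h + y) by rewrite scale0r add0r.
  apply: (@le_trans _ _ (n%:R * (n%:R * C2 * `|h|) * `|h| * (t - 0))).
    have /andP[t0 t1] := t01.
    apply: (mvW (f := fun t => 'D_h f (t *: h + y))
      (df := fun t => 'D_h ('D_h f) (t *: h + y))) => // s /andP[s0 st].
      apply: (is_derive_line (f := 'D_h f)); apply/derivableP.
      have [|Uz _ _ _] := Hr0 _ (seg s _); first by rewrite s0 (le_trans st).
      exact: (Ck_derivable (Ck_derive _ Cf) Uz).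
    by apply/D2/seg; rewrite s0 (le_trans st).
  have /andP[t0 t1] := t01; rewrite subr0.
  apply: (@le_trans _ _ (n%:R * (n%:R * C2 * `|h|) * `|h|)).
    by rewrite ler_piMr// !mulr_ge0.
  rewrite [leLHS](_ : _ = n%:R * (n%:R * C2) * `|h| ^+ 2); last by ring.
  by rewrite ler_wpM2r.
Unshelve. all: by end_near. Qed.

End LocalBounds.

Section MatrixDerive.
Variables (R : realType) (V : normedModType R).

Lemma is_derive_mulmx p q r (f : V -> 'M[R]_(p, q)) (g : V -> 'M[R]_(q, r)) x v df dg :
  is_derive x v f df -> is_derive x v g dg ->
  is_derive x v (fun y => f y *m g y) (df *m g x + f x *m dg).
Proof.
move=> /is_derive_mxP fd /is_derive_mxP gd; apply/is_derive_mxP => i j.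
have H k : is_derive x v (fun y => f y i k * g y k j : R^o)
    (f x i k * dg k j + g x k j * df i k) by exact: is_deriveM.
have := is_derive_sum H.
have -> : \sum_(k < q) (fun y => f y i k * g y k j : R^o) =
    (fun y => (f y *m g y) i j).
  by apply/funext => y; rewrite fct_sumE mxE.
move=> K; apply: is_derive_eq K _; rewrite !mxE -big_split /=.
by apply: eq_bigr => k _; rewrite addrC; congr (_ + _); rewrite mulrC.
Qed.

End MatrixDerive.

(** * Flat linear connections *)

Section Frobenius.
Variables (R : realType) (n m : nat).
Local Notation e_ k := (delta_mx 0 k).
Local Notation E := 'rV[R]_n.
Local Notation Mat := 'M[R]_m.
Variables (U : set E) (Om : E -> E -> Mat) (x0 : E).
Hypotheses (oU : open U) (Ux0 : U x0).
Hypothesis OmL : forall x, U x -> linear (Om x).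
Hypothesis OmC : forall v, Ck 2 U (fun x => Om x v).
Hypothesis flat : forall x v w, U x ->
  'D_w (fun y => Om y v) x + Om x v *m Om x w =
  'D_v (fun y => Om y w) x + Om x w *m Om x v.

Lemma Om_row_comb x v : U x -> Om x v = row_comb (fun k => Om x (e_ k)) v.
Proof. by move=> Ux; exact: linear_row_comb (OmL Ux). Qed.

Lemma Om_bounds : exists2 C, 0 <= C & \forall r \near (0 : R)^'+, ball x0 r `<=` U /\
  forall y h v, ball x0 r y -> ball x0 r (h + y) ->
  [/\ `|Om y v| <= C * `|v|, `|Om (h + y) v - Om y v| <= C * `|h| * `|v| &
   `|Om (h + y) v - Om y v - 'D_h (fun z => Om z v) y| <= C * `|h| ^+ 2 * `|v|].
Proof.
have H k := local_taylor (@mean_value_mx R m m) oU Ux0 (OmC (e_ k)).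
pose C k := s2val (cid2 (H k)).
have C0 k : 0 <= C k by exact: (s2valP (cid2 (H k))).
have HC k := s2valP' (cid2 (H k)); rewrite -/(C _) in HC.
have Ck_le k : C k <= \sum_j C j.
  by rewrite (bigD1 k)//= lerDl sumr_ge0.
pose S := \sum_j C j; have S0 : 0 <= S by apply: sumr_ge0.
exists (n%:R * S); first by rewrite mulr_ge0.
have {}HC : \forall r \near (0 : R)^'+, forall k, ball x0 r `<=` U /\
    forall y h, ball x0 r y -> ball x0 r (h + y) ->
    [/\ `|Om y (e_ k)| <= C k, `|Om (h + y) (e_ k) - Om y (e_ k)| <= C k * `|h| &
        `|Om (h + y) (e_ k) - Om y (e_ k) - 'D_h (fun z => Om z (e_ k)) y|
          <= C k * `|h| ^+ 2].
  by apply: filter_forall => k; exact: HC.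
have HU : \forall r \near (0 : R)^'+, ball x0 r `<=` U.
  have /nbhs_ballP[r /= r0 rU] : nbhs x0 U by exact: open_nbhs_nbhs.
  near=> s; apply: subset_trans rU; apply: le_ball.
  by near: s; exact: nbhs_right_le.
apply: filterS (filterI HC HU) => r [{}HC rU].
split=> // y h v yr hyr; have Uy := rU _ yr; have Uhy := rU _ hyr.
have {}HC k := (HC k).2 y h yr hyr.
have rcB (d1 d2 : 'I_n -> Mat) : row_comb d1 v - row_comb d2 v =
    row_comb (fun k => d1 k - d2 k) v.
  by rewrite /row_comb -sumrB; apply: eq_bigr => k _; rewrite scalerBr.
split.
- rewrite Om_row_comb//; apply: norm_row_comb_le => k.
  by have [/le_trans + _ _] := HC k; apply.
- rewrite !Om_row_comb// rcB -(mulrA n%:R); apply: norm_row_comb_le => k.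
  have [_ /le_trans + _] := HC k; apply.
  by rewrite ler_wpM2r.
- have -> : 'D_h (fun z => Om z v) y =
      row_comb (fun k => 'D_h (fun z => Om z (e_ k)) y) v.
    have -> : 'D_h (fun z => Om z v) y =
       'D_h (fun z => row_comb (fun k => Om z (e_ k)) v) y.
      apply: near_eq_derive.
      by apply: filterS (open_nbhs_nbhs (conj oU Uy)) => z; exact: Om_row_comb.
    have [_ <-] // : is_derive y h (fun z => row_comb (fun k => Om z (e_ k)) v)
      (row_comb (fun k => 'D_h (fun z => Om z (e_ k)) y) v).
    have K k : is_derive y h (fun z => v 0 k *: Om z (e_ k))
        (v 0 k *: 'D_h (fun z => Om z (e_ k)) y).
      by apply: is_deriveZ; apply/derivableP; exact: (Ck_derivable (OmC (e_ k)) Uy).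
    have := is_derive_sum K; rewrite (_ : \sum_(k < n) _ =
       (fun z => row_comb (fun k => Om z (e_ k)) v))//.
    by apply/funext => z; rewrite fct_sumE.
  rewrite !Om_row_comb// !rcB -(mulrA n%:R); apply: norm_row_comb_le => k.
  have [_ _ /le_trans] := HC k; apply.
  by rewrite ler_wpM2r.
Unshelve. all: by end_near. Qed.

Lemma norm_mx1_le p : `|1%:M : 'M[R]_p| <= 1.
Proof.
apply: mx_norm_bound => // i j; rewrite mxE.
by case: (i == j); rewrite ?normr1 ?normr0.
Qed.

(** The linear equation is solved along each ray from [x0], and [J x] is the
    value at time 1 of the solution along the ray through [x]. The variation
    of these solutions with the ray has a first-order prediction whose error
    satisfies, by flatness, a linear equation with a source of second order;
    Gronwall then shows that [J] has the expected derivative. *)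
Theorem frobenius : exists2 r : R, 0 < r & ball x0 r `<=` U /\
  exists2 J : E -> Mat, J x0 = 1%:M & forall x, ball x0 r x ->
    differentiable J x /\ forall v, is_derive x v J (Om x v *m J x).
Proof.
have [C C0 HC] := Om_bounds.
have [r [rp [rU HB]]] : exists r : R, 0 < r /\ (ball x0 r `<=` U /\
  forall y h v, ball x0 r y -> ball x0 r (h + y) ->
  [/\ `|Om y v| <= C * `|v|, `|Om (h + y) v - Om y v| <= C * `|h| * `|v| &
   `|Om (h + y) v - Om y v - 'D_h (fun z => Om z v) y| <= C * `|h| ^+ 2 * `|v|]).
  have [s [s0 Hs]] := filter_ex (filterI (nbhs_right_gt (0 : R)) HC).
  by exists s.
pose c := m%:R * C + 1.
have mC0 : 0 <= m%:R * C by rewrite mulr_ge0.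
have c0 : 0 < c by rewrite ltr_wpDl.
(* with this radius, [Om] along a ray is so small that the unit time interval
   is short in the sense of [picard] and [short_gronwall] *)
pose r1 := Num.min (r / 4) (4^-1 / c).
have r10 : 0 < r1 by rewrite lt_min !divr_gt0// invr_gt0.
have r1r : r1 <= r / 4 by rewrite ge_min lexx.
have r1c : c * r1 <= 4^-1 by rewrite mulrC -ler_pdivlMr// ge_min lexx orbT.
have inB w t : `|w| < r1 -> `|t| <= 2 -> ball x0 r (t *: w + x0).
  move=> wr t2; rewrite -ball_normE /= distrC addrK normrZ.
  have w0 : 0 <= `|w| by [].
  apply: (@le_lt_trans _ _ (2 * `|w|)); first by rewrite ler_wpM2r.
  lra.
have Ombd w t : `|w| < r1 -> `|t| <= 2 -> m%:R * `|Om (t *: w + x0) w| <= 4^-1.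
  move=> wr t2; apply: le_trans r1c.
  have [H _ _] := HB _ 0 w (inB _ _ wr t2) (eq_ind _ _ (inB _ _ wr t2) _ (esym (add0r _))).
  rewrite (le_trans (ler_wpM2l _ H))// mulrA.
  apply: ler_pM => //; first by rewrite /c lerDl.
  exact: ltW.
have solP w : exists y : R -> Mat, `|w| < r1 -> y 0 = 1%:M /\
    forall t : R, `|t| < 2 -> is_derive t 1 y (Om (t *: w + x0) w *m y t).
  have [wr|] := ltP `|w| r1; last by exists (fun=> 0).
  have t2 (t : R) : `|clamp 2 t| <= 2 by rewrite clamp_norm.
  have [||||y [yc y0 yd]] := @picard R m m (fun t J => Om (clamp 2 t *: w + x0) w *m J) 4^-1 2 1%:M.
  - by [].
  - lra.
  - move=> y yc t.
    apply/continuous_mxP => i j.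
    have E : (fun s => (Om (clamp 2 s *: w + x0) w *m y s) i j) =
       (fun s => \sum_k Om (clamp 2 s *: w + x0) w i k * y s k j).
      by apply/funext => s; rewrite mxE.
    rewrite E; apply: (@cvg_big _ _ _ _ _ _ _ (nbhs t)) => [|k _].
      exact: add_continuous.
    apply: cvgM; last by have /continuous_mxP := yc t; exact.
    have Oc := Ck_continuous (OmC w) (rU _ (inB _ _ wr (t2 t))).
    have cc : {for t, continuous (fun s => clamp 2 s *: w + x0)}.
      apply: cvgD; last exact: cvg_cst.
      by apply: cvgZr_tmp; apply: clamp_continuous.
    have := @continuous_comp _ _ _ (fun s => clamp 2 s *: w + x0) (fun x => Om x w) t cc Oc.
    by move=> /continuous_mxP; exact.
  - move=> t y z; rewrite -mulmxBr (le_trans (normr_mulmx_le _ _))//.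
    by rewrite ler_wpM2r// Ombd.
  exists y => _; split=> // t tt; have := yd t tt.
  by rewrite (clamp_id (ltW tt)).
pose sol w := projT1 (cid (solP w)).
have sol0 w : `|w| < r1 -> sol w 0 = 1%:M.
  by move=> wr; have [] := projT2 (cid (solP w)) wr.
have sold w (t : R) : `|w| < r1 -> `|t| < 2 ->
    is_derive t 1 (sol w) (Om (t *: w + x0) w *m sol w t).
  by move=> wr; have [_] := projT2 (cid (solP w)) wr; exact.
have le12 (t : R) : `|t - 0| <= 1 -> `|t| < 2.
  by rewrite subr0 => /le_lt_trans; apply; rewrite ltr1n.
have solb w (t : R) : `|w| < r1 -> `|t - 0| <= 1 -> `|sol w t| <= 2.
  move=> wr; have := @short_gronwall R _ (@mean_value_mx R m m)
    (fun t => sol w t - 1%:M) (fun t => Om (t *: w + x0) w *m sol w t) 0 1 4^-1 4^-1.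
  move=> H t1; have := H ler01 _ _ _ _ _ _ t t1 => {}H.
  have K : `|sol w t - 1%:M| <= 2 / 4 * 1.
    apply: H => //; first by lra.
    - by rewrite sol0// subrr.
    - move=> s s1; rewrite -[X in is_derive _ _ _ X]subr0; apply: is_deriveB.
      exact: sold (le12 _ s1).
    - move=> s s1; rewrite (le_trans (normr_mulmx_le _ _))//.
      apply: (@le_trans _ _ (4^-1 * `|sol w s|)).
        by rewrite ler_wpM2r// Ombd// ltW// le12.
      rewrite -[X in `|X|](subrK 1%:M) -[X in _ <= _ + X]mulr1 -mulrDr ler_wpM2l//.
      by rewrite (le_trans (ler_normD _ _))// lerD2l norm_mx1_le.
  rewrite -[X in `|X|](subrK 1%:M) (le_trans (ler_normD _ _))//.
  have := norm_mx1_le m; lra.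
pose J x := sol (x - x0) 1.
pose K := m%:R * (C * r1 + C + (C * r1 + C) * m%:R * C) * 2.
have K0 : 0 <= K.
  by rewrite /K; apply: mulr_ge0 => //; rewrite mulr_ge0// !addr_ge0// ?mulr_ge0// ?addr_ge0// ?mulr_ge0// ltW.
(* [d t] is the error of the first-order prediction at time [t] for the ray
   through [h + w], given the solution on the ray through [w] *)
have main w h : `|w| < r1 -> `|h + w| < r1 ->
   `|sol (h + w) 1 - sol w 1 - Om (w + x0) h *m sol w 1| <= 2 * (K * `|h| ^+ 2) * 1.
  move=> wr hwr.
  pose b t := Om (t *: w + x0) h.
  pose d t := sol (h + w) t - sol w t - t *: (b t *m sol w t).
  pose a t := Om (t *: w + x0) w.
  pose a' t := Om (t *: (h + w) + x0) (h + w).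
  pose db t := 'D_w (fun z => Om z h) (t *: w + x0).
  pose dd t := a' t *m sol (h + w) t - a t *m sol w t -
    (b t *m sol w t + t *: (db t *m sol w t + b t *m (a t *m sol w t))).
  have -> : sol (h + w) 1 - sol w 1 - Om (w + x0) h *m sol w 1 = d 1.
    by rewrite /d /b !scale1r.
  apply: (short_gronwall (@mean_value_mx R m m) (dd := dd) (t0 := 0) (L := 4^-1)) => //.
  - by rewrite mulr_ge0// exprn_ge0.
  - lra.
  - by rewrite /d !sol0// subrr scale0r subrr.
  - move=> s s1; have s2 := le12 _ s1.
    apply: is_deriveB; first by apply: is_deriveB; exact: sold.
    have Us : U (s *: w + x0) by apply/rU/inB => //; exact: ltW.
    have db_ : is_derive s 1 b (db s).
      apply: (is_derive_line (f := fun z => Om z h)); apply/derivableP.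
      exact: (Ck_derivable (OmC h) Us).
    have := is_derive_mulmx db_ (sold w s wr s2) => P.
    apply/is_derive_mxP => i j.
    have /is_derive_mxP/(_ i j) Pij := P.
    have id1 : is_derive s 1 (fun s : R => s : R^o) 1 by exact: is_derive_id.
    have := is_deriveM id1 Pij.
    rewrite (_ : (fun x => x) * _ = (fun y => (y *: (b y *m sol w y)) i j)); last first.
      by apply/funext => y; rewrite mxE.
    move=> Q; apply: is_derive_eq Q _.
    rewrite [RHS]mxE [X in _ = _ + X]mxE addrC; congr (_ + _).
    exact: mulr1.
  - move=> s s1; have s2 := le12 _ s1.
    have sb := inB _ _ wr (ltW s2); have Us := rU _ sb.
    have sb' := inB _ _ hwr (ltW s2).
    have yE : s *: (h + w) + x0 = s *: h + (s *: w + x0) by rewrite scalerDr addrA.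
    have Us' := rU _ sb'.
    rewrite yE in sb' Us'.
    pose Dh := 'D_h (fun z => Om z w) (s *: w + x0).
    pose Rr := a' s - a s - b s - s *: Dh + s *: ((a' s - a s) *m b s).
    have flats : Dh + a s *m b s = db s + b s *m a s.
      by rewrite /Dh /a /b /db; exact: flat.
    have ddE : dd s = a' s *m d s + Rr *m sol w s.
      have bE : db s *m sol w s + b s *m (a s *m sol w s) =
          Dh *m sol w s + a s *m b s *m sol w s.
        by rewrite mulmxA -!mulmxDl flats.
      rewrite /dd bE /d /Rr !mulmxDl !mulmxBr ?mulmxDl !mulNmx -!scalemxAl -scalemxAr.
      rewrite !mulmxA mulmxBl.
      by apply/matrixP => i j; rewrite !mxE; ring.
    rewrite ddE (le_trans (ler_normD _ _))// lerD//.
      rewrite (le_trans (normr_mulmx_le _ _))// ler_wpM2r//.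
      by rewrite /a' Ombd// ltW.
    rewrite (le_trans (normr_mulmx_le _ _))//.
    rewrite subr0 in s1.
    have w0 : 0 <= `|w| by []. have h0 : 0 <= `|h| by [].
    have sh : `|s *: h| <= `|h| by rewrite normrZ ler_piMl.
    have [bb _ _] := HB _ _ h sb sb'.
    have [_ Ow1 Ow2] := HB _ _ w sb sb'.
    have [_ Oh1 _] := HB _ _ h sb sb'.
    have Dhs : 'D_(s *: h) (fun z => Om z w) (s *: w + x0) = s *: Dh.
      have mvm := @mean_value_mx R m m.
      by rewrite /Dh !(derive_row_comb mvm _ oU (OmC w) Us) linearZ.
    have a'E : a' s = Om (s *: h + (s *: w + x0)) h + Om (s *: h + (s *: w + x0)) w.
      rewrite /a' yE; have := OmL Us' 1 h w; rewrite !scale1r; exact.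
    have ash : C * `|s *: h| <= C * `|h| by rewrite ler_wpM2l.
    have Aa : `|a' s - a s| <= (C * r1 + C) * `|h|.
      rewrite a'E -addrA (le_trans (ler_normD _ _))// [leLHS]addrC mulrDl lerD//.
        apply: (le_trans Ow1); rewrite mulrAC ler_pM//; first by rewrite mulr_ge0.
        by rewrite ler_wpM2l// ltW.
      have [] := HB _ 0 h sb'; first by rewrite add0r.
      by [].
    have Rb : `|Rr| <= (C * r1 + C + (C * r1 + C) * m%:R * C) * `|h| ^+ 2.
      have -> : Rr = (Om (s *: h + (s *: w + x0)) w - a s - s *: Dh)
           + (Om (s *: h + (s *: w + x0)) h - b s) + s *: ((a' s - a s) *m b s).
        by rewrite /Rr a'E; apply/matrixP => i j; rewrite !mxE; ring.
      rewrite (le_trans (ler_normD _ _))// [leRHS]mulrDl lerD//.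
        rewrite (le_trans (ler_normD _ _))// [leRHS]mulrDl lerD//.
          rewrite -Dhs (le_trans Ow2)// mulrAC ler_pM// ?mulr_ge0//.
            by rewrite ler_wpM2l// ltW.
          by rewrite ler_pXn2r ?nnegrE.
        by rewrite (le_trans Oh1)// expr2 mulrA ler_wpM2r.
      rewrite normrZ (le_trans (ler_piMl _ s1))//.
      rewrite (le_trans (normr_mulmx_le _ _))//.
      rewrite [leRHS](_ : _ = m%:R * ((C * r1 + C) * `|h|) * (C * `|h|)); last by ring.
      by rewrite ler_pM// ?mulr_ge0// ler_wpM2l.
    have -> : K * `|h| ^+ 2 =
        m%:R * ((C * r1 + C + (C * r1 + C) * m%:R * C) * `|h| ^+ 2) * 2.
      by rewrite /K; ring.
    by rewrite ler_pM// ?mulr_ge0// ?ler_wpM2l// solb// subr0.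
  - by rewrite subr0 normr1.
exists r1 => //; split.
  apply: subset_trans rU; apply: le_ball; lra.
exists J.
  rewrite /J subrr.
  have := @short_gronwall R _ (@mean_value_mx R m m)
    (fun t => sol 0 t - 1%:M) (fun t => Om (t *: 0 + x0) 0 *m sol 0 t) 0 1 4^-1 0.
  have z0 : `|0 : E| < r1 by rewrite normr0.
  have Om0 : Om x0 0 = 0 by rewrite Om_row_comb// linear0.
  move=> H; apply/eqP; rewrite -subr_eq0 -normr_le0.
  have := H ler01 _ _ _ _ _ _ 1; rewrite mulr0 mul0r; apply => //.
  - lra.
  - by rewrite sol0// subrr.
  - move=> s s1; rewrite -[X in is_derive _ _ _ X]subr0; apply: is_deriveB.
    exact: sold (le12 _ s1).
  - by move=> s _; rewrite scaler0 add0r Om0 mul0mx normr0 addr0 mulr_ge0.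
  - by rewrite subr0 normr1.
move=> x; rewrite -ball_normE /= distrC => xr.
have Ux : U x.
  by apply: rU; rewrite -ball_normE /= distrC; apply: lt_le_trans xr _; lra.
pose L : E -> Mat := row_comb (fun k => Om x (e_ k) *m J x).
have LE v : L v = Om x v *m J x.
  rewrite (Om_row_comb _ Ux) /L /row_comb mulmx_suml.
  by apply: eq_bigr => k _; rewrite scalemxAl.
have [Jd JE] : differentiable J x /\ forall v, 'd J x v = L v.
  apply: (differentiable_expansion (L := row_comb (fun k => Om x (e_ k) *m J x))).
    exact: row_comb_continuous.
  move=> e e0.
  near=> h.
  have hr : `|h + (x - x0)| < r1.
    rewrite (le_lt_trans (ler_normD _ _))// -ltrBrDr; near: h.
    apply/nbhs_ballP; exists (r1 - `|x - x0|); rewrite /= ?subr_gt0// => h.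
    by rewrite -ball_normE /= sub0r normrN.
  have he : 2 * K * `|h| <= e.
    rewrite mulrC; apply: (@le_trans _ _ (`|h| * (2 * K + 1))).
      by rewrite ler_wpM2l// lerDl.
    rewrite -ler_pdivlMr; last by rewrite ltr_wpDl// mulr_ge0.
    near: h; apply/nbhs_ballP; exists (e / (2 * K + 1)).
      by rewrite /= divr_gt0// ltr_wpDl// mulr_ge0.
    by move=> h; rewrite -ball_normE /= sub0r normrN => /ltW.
  have := main _ _ xr hr.
  rewrite subrK -/(J x) addrA -/(J (h + x)) mulr1.
  move=> bound; suff : `|J (h + x) - (J x + L h)| <= e * `|h| by [].
  rewrite LE; move: bound; rewrite opprD addrA => /le_trans; apply.
  rewrite [leLHS](_ : _ = 2 * K * `|h| * `|h|); last by rewrite expr2 !mulrA.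
  exact: ler_wpM2r.
split=> // v; apply: DeriveDef; first exact: diff_derivable.
by rewrite deriveE// JE LE.
Unshelve. all: by end_near. Qed.

End Frobenius.

(** * The tractor connection *)

Section Bilinear.
Variables (R : realType) (n : nat) (W : lmodType R).
Local Notation E := 'rV[R]_n.

Definition bilin (B : E -> E -> W) : Prop :=
  (forall w, linear (B^~ w)) /\ (forall u, linear (B u)).

Variable B : E -> E -> W.
Hypothesis bB : bilin B.

Lemma bilinDl u v w : B (u + v) w = B u w + B v w.
Proof. by have := bB.1 w 1 u v; rewrite !scale1r. Qed.

Lemma bilinDr u v w : B u (v + w) = B u v + B u w.
Proof. by have := bB.2 u 1 v w; rewrite !scale1r. Qed.

Lemma bilin0l w : B 0 w = 0.
Proof.
have /eqP := bilinDl 0 0 w.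
by rewrite addr0 -subr_eq0 opprD addrA subrr sub0r oppr_eq0 => /eqP.
Qed.

Lemma bilin0r w : B w 0 = 0.
Proof.
have /eqP := bilinDr w 0 0.
by rewrite addr0 -subr_eq0 opprD addrA subrr sub0r oppr_eq0 => /eqP.
Qed.

Lemma bilinZl a u w : B (a *: u) w = a *: B u w.
Proof. by have := bB.1 w a u 0; rewrite bilin0l !addr0. Qed.

Lemma bilinZr a u w : B u (a *: w) = a *: B u w.
Proof. by have := bB.2 u a w 0; rewrite bilin0r !addr0. Qed.

Lemma bilin_row_combl u w : B u w = row_comb (fun k => B (delta_mx 0 k) w) u.
Proof. exact: (linear_row_comb (f := B^~ w) u (bB.1 w)). Qed.

Lemma bilin_row_combr u w : B u w = row_comb (fun k => B u (delta_mx 0 k)) w.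
Proof. exact: (linear_row_comb w (bB.2 u)). Qed.

End Bilinear.

Section Tractor.
Variables (R : realType) (n : nat).
Local Notation E := 'rV[R]_n.
Local Notation e_ k := (delta_mx 0 k : E).
Implicit Types (Gam : E -> E -> E -> E) (V W : set E) (h : E -> E -> E -> R^o).

(** On constant vector fields the Lie brackets vanish, and a tensor is
    determined by its values on them. *)
Definition curv Gam (x u v w : E) : E :=
  'D_u (fun y => Gam y v w) x + Gam x u (Gam x v w)
  - ('D_v (fun y => Gam y u w) x + Gam x v (Gam x u w)).

Lemma curvature_cst V Gam x u v w : is_christoffel V Gam -> V x ->
  curvature Gam (cst u) (cst v) (cst w) x = curv Gam x u v w.
Proof.
move=> [bG _] Vx; have [G1 G2] := bG x Vx.
have bGx : bilin (Gam x) by split.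
have E a b : (fun y : E => 'D_a (cst b : E -> E) y + Gam y a b) = (fun y => Gam y a b).
  by apply/funext => y; rewrite derive_cst add0r.
rewrite /curvature /nabla /lie_bracket /= !E !derive_cst !add0r oppr0.
by rewrite (bilin0l bGx) subr0 /curv.
Qed.

Lemma smooth_cst (m : nat) (Y : normedModType R) (V : set 'rV[R]_m) (c : Y) :
  open V -> smooth_on V (cst c).
Proof. by move=> oV k; exact: Ck_cst. Qed.

Lemma torsion_free_sym V Gam x u v : open V -> torsion_free_on V Gam -> V x ->
  Gam x u v = Gam x v u.
Proof.
move=> oV tf Vx; have := tf _ _ (smooth_cst u oV) (smooth_cst v oV) x Vx.
rewrite /torsion /nabla /lie_bracket !derive_cst !add0r !oppr0 addr0 /=.
by move/eqP; rewrite subr_eq0 => /eqP.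
Qed.

(** The linear system satisfied by the jet of a solution of Hess F = - h F;
    its parallel frames are these jets. *)
Definition tractor_mx (G : E -> E -> E) (q : E -> E -> R^o) (v : E) : 'M[R]_(1 + n) :=
  block_mx (0 : 'M[R]_1) v (- (\col_k q v (e_ k))) (\matrix_k G v (e_ k)).

Definition jet (F : E -> 'rV[R]_(1 + n)) (x : E) : 'M[R]_(1 + n) :=
  col_mx (F x) (\matrix_k 'D_(e_ k) F x).

Definition hessian_eq Gam W h (F : E -> 'rV[R]_(1 + n)) : Prop :=
  forall x u v, W x ->
    'D_u ('D_v F) x = 'D_(Gam x u v) F x - h x u v *: F x.

(** A local centroaffine immersion that induces the connection: the second
    derivative of [F] along a geodesic is proportional to the position [F].
    The factor [h] is left existential because the equation and nondegeneracy
    determine it. *)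
Definition solution Gam W (F : E -> 'rV[R]_(1 + n)) : Prop :=
  [/\ open W, smooth_on W F, forall x, W x -> jet F x \in unitmx
    & exists h, hessian_eq Gam W h F].

Lemma matrix_rows_mul m (d : 'I_n -> 'rV[R]_m) (v : E) :
  v *m (\matrix_k d k) = row_comb d v.
Proof.
rewrite mulmx_sum_row /row_comb; apply: eq_bigr => k _; congr (_ *: _).
by apply/rowP => j; rewrite !mxE.
Qed.

Lemma jet_derive W h Gam (F : E -> 'rV[R]_(1 + n)) x v : open W -> Ck 2 W F ->
  W x -> hessian_eq Gam W h F ->
  is_derive x v (jet F) (tractor_mx (Gam x) (h x) v *m jet F x).
Proof.
move=> oW CF Wx hF; have mv := @mean_value_mx R 1 (1 + n).
have dF : is_derive x v F (v *m (\matrix_k 'D_(e_ k) F x)).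
  rewrite matrix_rows_mul -(derive_row_comb mv v oW CF Wx).
  exact/derivableP/(Ck_derivable CF Wx).
have ddF k : is_derive x v ('D_(e_ k) F)
    (- h x v (e_ k) *: F x + Gam x v (e_ k) *m (\matrix_k 'D_(e_ k) F x)).
  rewrite matrix_rows_mul -(derive_row_comb mv _ oW CF Wx) addrC scaleNr -hF//.
  exact/derivableP/(Ck_derivable (Ck_derive _ CF) Wx).
rewrite /tractor_mx /jet mul_block_col mul0mx add0r.
apply/is_derive_mxP => i j; rewrite [X in is_derive _ _ _ X]mxE.
have E : (fun y => (col_mx (F y) (\matrix_k 'D_(e_ k) F y)) i j) =
    match fintype.split i with inl a => fun y => F y a j
                     | inr k => fun y => 'D_(e_ k) F y 0 j end.
  by apply/funext => y; rewrite mxE; case: fintype.split => // k; rewrite mxE.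
rewrite E; case: (fintype.split i) => [a|k].
  by have /is_derive_mxP/(_ a j) := dF.
have /is_derive_mxP/(_ 0 j) := ddF k => H; apply: is_derive_eq H _.
rewrite !mxE big_ord1 !mxE; congr (_ + _).
by apply: eq_bigr => l _; rewrite !mxE.
Qed.

Lemma unitmx_row_ker p (A : 'M[R]_p) :
  A \in unitmx <-> forall r : 'rV_p, r *m A = 0 -> r = 0.
Proof.
split=> [uA r rA|kA]; first by rewrite -(mulmxK uA r) rA mul0mx.
by rewrite -row_free_unit; exact: inj_row_free.
Qed.

Lemma jet_row (F : E -> 'rV[R]_(1 + n)) x (c : 'rV[R]_1) (u : E) :
  row_mx c u *m jet F x = c 0 0 *: F x + row_comb (fun k => 'D_(e_ k) F x) u.
Proof.
rewrite /jet mul_row_col matrix_rows_mul; congr (_ + _).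
by rewrite [c]mx11_scalar mul_scalar_mx mxE eqxx mulr1n.
Qed.

(** A form of nondegeneracy that does not mention a basis. *)
Lemma jet_unitP W (F : E -> 'rV[R]_(1 + n)) x : open W -> Ck 1 W F -> W x ->
  jet F x \in unitmx <->
  forall (c : R) u, c *: F x + 'D_u F x = 0 -> c = 0 /\ u = 0.
Proof.
move=> oW CF Wx; have mv := @mean_value_mx R 1 (1 + n).
rewrite unitmx_row_ker; split=> [H c u cu|H r].
  have := H (row_mx c%:M u); rewrite jet_row -(derive_row_comb mv _ oW CF Wx).
  rewrite mxE eqxx mulr1n => /(_ cu) /eqP.
  rewrite -(row_mx0 R 1 1 n) => /eqP /eq_row_mx[/matrixP/(_ 0 0)].
  by rewrite !mxE eqxx mulr1n.
rewrite -[r]hsubmxK jet_row -(derive_row_comb mv _ oW CF Wx) => /H[c0 u0].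
by rewrite u0 [lsubmx r]mx11_scalar c0 raddf0 row_mx0.
Qed.

(** Integrability of the tractor connection: the curvature of [Gam] is that of
    a projectively flat connection with normalised Ricci tensor [h], and [h]
    satisfies the Codazzi equation. *)
Record flat_tractor V Gam h : Prop := FlatTractor {
  ft_open : open V;
  ft_bilin : forall x, V x -> bilin (Gam x);
  ft_smooth : forall u v, smooth_on V (fun x => Gam x u v);
  ft_sym : forall x u v, V x -> Gam x u v = Gam x v u;
  ft_hbilin : forall x, V x -> bilin (h x);
  ft_hsmooth : forall u v, smooth_on V (fun x => h x u v);
  ft_hsym : forall x u v, V x -> h x u v = h x v u;
  ft_curv : forall x u v w, V x -> curv Gam x u v w = h x v w *: u - h x u w *: v;
  ft_codazzi : forall x u v w, V x ->
    'D_u (fun y => h y v w) x + h x u (Gam x v w) =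
    'D_v (fun y => h y u w) x + h x v (Gam x u w) }.

Lemma Ck_mulmx m p q r k (U : set 'rV[R]_m) (f : 'rV[R]_m -> 'M[R]_(p, q))
    (g : 'rV[R]_m -> 'M[R]_(q, r)) : open U -> Ck k U f -> Ck k U g ->
  Ck k U (fun x => f x *m g x).
Proof.
move=> oU /(Ck_mxP _ _ oU) Cf /(Ck_mxP _ _ oU) Cg; apply/Ck_mxP => // i j.
apply: (Ck_eq oU (f := fun x => \sum_l f x i l * g x l j)) => [x _|].
  by rewrite mxE.
by apply: Ck_sum => // l _; exact: Ck_mul.
Qed.

Lemma block_mx_add_eq p q r t (a1 b1 c1 d1 : 'M[R]_(p, q)) (a2 b2 c2 d2 : 'M[R]_(p, r))
    (a3 b3 c3 d3 : 'M[R]_(t, q)) (a4 b4 c4 d4 : 'M[R]_(t, r)) :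
  a1 + b1 = c1 + d1 -> a2 + b2 = c2 + d2 -> a3 + b3 = c3 + d3 -> a4 + b4 = c4 + d4 ->
  block_mx a1 a2 a3 a4 + block_mx b1 b2 b3 b4 =
  block_mx c1 c2 c3 c4 + block_mx d1 d2 d3 d4.
Proof. by rewrite !add_block_mx => -> -> -> ->. Qed.

Section Existence.
Variables (V : set E) (Gam : E -> E -> E -> E) (h : E -> E -> E -> R^o).
Hypothesis ft : flat_tractor V Gam h.
Let oV := ft_open ft.
Let Om x v := tractor_mx (Gam x) (h x) v.

Lemma tractor_mx_entry x v (i j : 'I_(1 + n)) :
  Om x v i j = match fintype.split i, fintype.split j with
    | inl _, inl _ => 0
    | inl _, inr l => v 0 l
    | inr k, inl _ => - h x v (e_ k)
    | inr k, inr l => Gam x v (e_ k) 0 l end.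
Proof.
rewrite /Om /tractor_mx mxE; case: (fintype.split i) => a; rewrite mxE; case: (fintype.split j) => b;
  rewrite ?mxE//.
by rewrite (ord1 a).
Qed.

Lemma tractor_mx_linear x : V x -> linear (Om x).
Proof.
move=> Vx a u v; apply/matrixP => i j.
rewrite [RHS]mxE [X in _ = X + _]mxE !tractor_mx_entry.
case: (fintype.split i) => k; case: (fintype.split j) => l; rewrite ?mxE ?mulr0 ?addr0//.
- by rewrite (bilinDl (ft_hbilin ft Vx)) (bilinZl (ft_hbilin ft Vx)) opprD -mulrN.
- by rewrite (bilinDl (ft_bilin ft Vx)) (bilinZl (ft_bilin ft Vx)) !mxE.
Qed.

Lemma tractor_mx_Ck k v : Ck k V (fun x => Om x v).
Proof.
apply/Ck_mxP => // i j.
have E : (fun x => Om x v i j : R^o) = match fintype.split i, fintype.split j return E -> R^o with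
    | inl _, inl _ => fun=> 0
    | inl _, inr l => fun=> v 0 l
    | inr k, inl _ => fun x => - h x v (e_ k)
    | inr k, inr l => fun x => Gam x v (e_ k) 0 l end.
  by apply/funext => x; rewrite tractor_mx_entry; case: fintype.split => ?; case: fintype.split.
rewrite E; case: (fintype.split i) => a; case: (fintype.split j) => b; try exact: Ck_cst.
  by apply: Ck_opp => //; exact: (ft_hsmooth ft v (e_ a) k).
by have /Ck_mxP := ft_smooth ft v (e_ a) k; exact.
Qed.

Lemma tractor_mx_derive x v w : V x -> 'D_w (fun y => Om y v) x =
  block_mx 0 0 (- (\col_k 'D_w (fun y => h y v (e_ k)) x))
    (\matrix_k 'D_w (fun y => Gam y v (e_ k)) x).
Proof.
move=> Vx.
have [_ <-] // : is_derive x w (fun y => Om y v)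
  (block_mx 0 0 (- (\col_k 'D_w (fun y => h y v (e_ k)) x))
    (\matrix_k 'D_w (fun y => Gam y v (e_ k)) x)).
apply/is_derive_mxP => i j.
have E : (fun x => Om x v i j : R^o) = match fintype.split i, fintype.split j return E -> R^o with
    | inl _, inl _ => fun=> 0
    | inl _, inr l => fun=> v 0 l
    | inr k, inl _ => fun x => - h x v (e_ k)
    | inr k, inr l => fun x => Gam x v (e_ k) 0 l end.
  by apply/funext => y; rewrite tractor_mx_entry; case: fintype.split => ?; case: fintype.split.
rewrite E mxE; case: (fintype.split i) => a; rewrite mxE; case: (fintype.split j) => b; rewrite !mxE;
  try exact: is_derive_cst.
  by apply: is_deriveN; apply/derivableP; exact: (Ck_derivable (ft_hsmooth ft v (e_ a) 1) Vx).
have : is_derive x w (fun y => Gam y v (e_ a)) ('D_w (fun y => Gam y v (e_ a)) x).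
  by apply/derivableP; exact: (Ck_derivable (ft_smooth ft v (e_ a) 1) Vx).
by move=> /is_derive_mxP; exact.
Qed.

(** The four blocks of the flatness equation are the symmetry of [h], the
    symmetry of [Gam], the Codazzi equation and the curvature equation. *)
Lemma tractor_flat x v w : V x ->
  'D_w (fun y => Om y v) x + Om x v *m Om x w =
  'D_v (fun y => Om y w) x + Om x w *m Om x v.
Proof.
move=> Vx; rewrite !tractor_mx_derive// /Om /tractor_mx !mulmx_block !mul0mx !add0r.
have bG := ft_bilin ft Vx; have bh := ft_hbilin ft Vx.
have rowG (u u' : E) : u *m (\matrix_k Gam x u' (e_ k)) = Gam x u' u.
  rewrite [RHS](bilin_row_combr bG) mulmx_sum_row /row_comb.
  by apply: eq_bigr => k _; congr (_ *: _); apply/rowP => j; rewrite !mxE.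
have rowh (u u' : E) : u *m (\col_k h x u' (e_ k)) = (h x u' u)%:M.
  rewrite (bilin_row_combr bh) [LHS]mx11_scalar; congr (_%:M).
  by rewrite mxE; apply: eq_bigr => k _; rewrite mxE.
apply: block_mx_add_eq; rewrite ?mulmx0 ?add0r.
- by rewrite !mulmxN !rowh (ft_hsym ft _ _ Vx).
- by rewrite !rowG (ft_sym ft _ _ Vx).
- apply/matrixP => k j; rewrite (ord1 j) {j} !mxE.
  have S (u u' : E) : \sum_j (\matrix_k0 Gam x u (e_ k0)) k j * (- (\col_k0 h x u' (e_ k0))) j 0
       = - h x u' (Gam x u (e_ k)).
    rewrite (bilin_row_combr bh _ (Gam x u (e_ k))) /row_comb -sumrN.
    by apply: eq_bigr => l _; rewrite !mxE mulrN.
  rewrite !S -!opprD; congr (- _); exact: (ft_codazzi ft).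
- apply/row_matrixP => k; rewrite !linearD /= !row_mul.
  have GE u : row k (\matrix_k0 Gam x u (e_ k0)) = Gam x u (e_ k).
    by apply/rowP => j; rewrite !mxE.
  rewrite !GE !rowG.
  have dE u u' : row k (\matrix_k0 'D_u (fun y => Gam y u' (e_ k0)) x) =
      'D_u (fun y => Gam y u' (e_ k)) x by apply/rowP => j; rewrite !mxE.
  rewrite !dE.
  have hE u u' : row k (- (\col_k0 h x u (e_ k0))) *m u' = - h x u (e_ k) *: u'.
    apply/rowP => j; rewrite !mxE big_ord1 !mxE; congr (_ * _).
  rewrite !hE.
  have := ft_curv ft w v (e_ k) Vx; rewrite /curv => /eqP.
  rewrite subr_eq => /eqP C.
  rewrite addrCA C !scaleNr.
  by apply/rowP => j; rewrite !mxE; ring.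
Qed.

Lemma unitmx_near1 p (A : 'M[R]_p) : p%:R * `|A - 1%:M| <= 2^-1 -> A \in unitmx.
Proof.
move=> A1; apply/unitmx_row_ker => r rA.
have rE : r = - (r *m (A - 1%:M)).
  by rewrite mulmxBr rA mulmx1 sub0r opprK.
have : `|r| <= 2^-1 * `|r|.
  rewrite {1}rE normrN (le_trans (normr_mulmx_le _ _))// mulrAC.
  by rewrite ler_wpM2r.
have r0 : 0 <= `|r| by [].
by move=> H; apply/eqP; rewrite -normr_le0; lra.
Qed.

(** The first row of a fundamental matrix is a solution: the first row of the
    connection matrix says that the other rows are its partial derivatives. *)
Theorem solution_exists x0 : V x0 ->
  exists F W, [/\ W x0, W `<=` V & solution Gam W F].
Proof.
move=> Vx0.
have [r r0 [rV [J J0 Jd]]] := @frobenius R n (1 + n) V Om x0 oV Vx0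
  tractor_mx_linear (tractor_mx_Ck 2) (fun x v w Vx => tractor_flat v w Vx).
have Jc x : ball x0 r x -> {for x, continuous J}.
  by move=> /Jd[/differentiable_continuous].
have oB : open (ball x0 r) by exact: ball_open.
have CJ k : Ck k (ball x0 r) J.
  elim: k => [|k IH]; first by split.
  apply: CkS_intro => // v; exists (fun x => Om x v *m J x).
    by move=> x /Jd[_]; exact.
  by apply: Ck_mulmx => //; apply: Ck_sub (tractor_mx_Ck k v).
pose F x : 'rV[R]_(1 + n) := usubmx (J x).
have CF k : Ck k (ball x0 r) F.
  apply/Ck_mxP => // i j; have /Ck_mxP := CJ k => /(_ oB (lshift n i) j).
  by apply: Ck_eq => // x _; rewrite mxE.
have dF x v : ball x0 r x -> 'D_v F x = v *m dsubmx (J x).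
  move=> /Jd[_ /(_ v) /is_derive_mxP dJ].
  have [_ //] : is_derive x v F (v *m dsubmx (J x)).
  apply/is_derive_mxP => i j; have := dJ (lshift n i) j.
  rewrite (_ : (fun y => J y (lshift n i) j) = (fun y => F y i j)); last first.
    by apply/funext => y; rewrite mxE.
  move=> H; apply: is_derive_eq H _.
  rewrite -{1}[J x]vsubmxK /Om /tractor_mx mul_block_col mul0mx add0r col_mxEu.
  by rewrite !mxE; apply: eq_bigr => l _; rewrite (ord1 i).
have jetF x : ball x0 r x -> jet F x = J x.
  move=> xr; rewrite /jet -[RHS]vsubmxK; congr col_mx.
  apply/row_matrixP => k; rewrite rowK dF//.
  by rewrite -rowE.
have : \forall x \near x0, ball x0 r x /\ (1 + n)%:R * `|J x - 1%:M| <= 2^-1.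
  near=> x; split; first by near: x; exact: nbhsx_ballx.
  rewrite mulrC -ler_pdivlMr ?ltr0n//.
  near: x.
  have e0 : 0 < (2^-1 / (1 + n)%:R : R) by rewrite divr_gt0// ltr0n.
  have := Jc _ (ballxx x0 r0); rewrite /prop_for /continuous_at J0.
  by move=> /cvgrPdist_le/(_ _ e0); apply: filterS => y; rewrite distrC.
move=> /nbhs_ballP[s /= s0 sW].
have sr : ball x0 s `<=` ball x0 r by move=> x /sW[].
exists F, (ball x0 s); split.
- exact: ballxx.
- exact: subset_trans rV.
split.
- exact: ball_open.
- by move=> k; exact: Ck_sub (CF k).
- by move=> x xs; rewrite jetF; [apply: unitmx_near1; have [] := sW _ xs|exact: sr].
exists h => x u v /sr xr.
have Vx := rV _ xr.
have -> : 'D_u ('D_v F) x = 'D_u (fun y => v *m dsubmx (J y)) x.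
  apply: near_eq_derive; apply: filterS (open_nbhs_nbhs (conj oB xr)) => y.
  exact: dF.
have dJ : is_derive x u (fun y => dsubmx (J y)) (dsubmx (Om x u *m J x)).
  have [_ /(_ u) /is_derive_mxP H] := Jd x xr.
  apply/is_derive_mxP => i j; have := H (rshift 1 i) j.
  rewrite (_ : (fun y => J y (rshift 1 i) j) = (fun y => dsubmx (J y) i j)); last first.
    by apply/funext => y; rewrite mxE.
  by move=> K; apply: is_derive_eq K _; rewrite [RHS]mxE.
have [_ ->] := is_derive_mulmx (is_derive_cst v x u) dJ.
rewrite mul0mx add0r dF// -{1}[J x]vsubmxK /Om /tractor_mx mul_block_col col_mxKd.
have bG := ft_bilin ft Vx; have bh := ft_hbilin ft Vx.
rewrite mulmxDr addrC !mulmxA; congr (_ *m _ + _).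
  rewrite [RHS](bilin_row_combr bG) mulmx_sum_row /row_comb.
  by apply: eq_bigr => k _; congr (_ *: _); apply/rowP => j; rewrite !mxE.
rewrite -scaleNr -mul_scalar_mx; congr (_ *m _).
rewrite mulmxN raddfN; congr (- _).
rewrite (bilin_row_combr bh) [LHS]mx11_scalar; congr (_%:M).
by rewrite mxE; apply: eq_bigr => k _; rewrite mxE.
Unshelve. all: by end_near. Qed.

End Existence.

End Tractor.

(** * Solutions of the Hessian equation *)

Section Grad.
Variables (R : realType) (n m : nat).
Local Notation E := 'rV[R]_n.
Local Notation e_ k := (delta_mx 0 k : E).
Local Notation T := 'rV[R]_m.
Implicit Types (W : set E) (F : E -> T).
Let mvT := @mean_value_mx R 1 m.

Definition grad F x : 'M[R]_(n, m) := \matrix_k 'D_(e_ k) F x.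

Lemma derive_grad k W F x v : open W -> Ck k.+1 W F -> W x ->
  'D_v F x = v *m grad F x.
Proof. by move=> oW CF Wx; rewrite matrix_rows_mul -(derive_row_comb mvT _ oW CF Wx). Qed.

Lemma grad_Ck k W F : open W -> Ck k.+1 W F -> Ck k W (grad F).
Proof.
move=> oW CF; apply/(Ck_mxP _ _ oW) => i j.
have /(Ck_mxP _ _ oW) := Ck_derive (e_ i) CF => /(_ 0 j).
by apply: (Ck_eq oW) => x _; rewrite mxE.
Qed.

Lemma is_derive_grad k W F x u : open W -> Ck k.+2 W F -> W x ->
  is_derive x u (grad F) (\matrix_k 'D_u ('D_(e_ k) F) x).
Proof.
move=> oW CF Wx; apply/is_derive_mxP => i j; rewrite mxE.
have : is_derive x u ('D_(e_ i) F) ('D_u ('D_(e_ i) F) x).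
  exact/derivableP/(Ck_derivable (Ck_derive _ CF) Wx).
move=> /is_derive_mxP/(_ 0 j); congr (is_derive _ _ _ _).
by apply/funext => y; rewrite mxE.
Qed.

Lemma mul_derive_grad k W F x u w : open W -> Ck k.+2 W F -> W x ->
  w *m (\matrix_k 'D_u ('D_(e_ k) F) x) = 'D_u ('D_w F) x.
Proof.
move=> oW CF Wx; rewrite matrix_rows_mul (Ck_derive_swap mvT _ _ oW CF Wx).
rewrite (derive_row_comb mvT _ oW (Ck_derive u CF) Wx); apply: eq_bigr => j _.
by rewrite (Ck_derive_swap mvT _ _ oW CF Wx).
Qed.

(** When [v] is the velocity of [c], this is the second derivative of [F]
    along the curve. *)
Lemma is_derive_grad_curve W F (c v : R -> E) (a : E) (t : R) : open W -> Ck 2 W F ->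
  W (c t) -> is_derive t 1 c (v t) -> is_derive t 1 v a ->
  is_derive t 1 (fun s => v s *m grad F (c s))
    (a *m grad F (c t) + 'D_(v t) ('D_(v t) F) (c t)).
Proof.
move=> oW CF Wc dc dv.
have Cg := grad_Ck oW CF.
have dg : is_derive t 1 (grad F \o c) (\matrix_k 'D_(v t) ('D_(e_ k) F) (c t)).
  have dgF := Ck1_differentiable (@mean_value_mx R n m) oW Cg Wc.
  have := is_derive_chain dgF dc.
  rewrite -(deriveE _ dgF) => H; apply: is_derive_eq H _.
  by have [_ ->] := is_derive_grad (v t) oW CF Wc.
have := is_derive_mulmx dv dg.
by rewrite (mul_derive_grad (v t) (v t) oW CF Wc).
Qed.

Lemma is_derive_curve W F (c : R -> E) (v : E) (t : R) : open W -> Ck 1 W F ->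
  W (c t) -> is_derive t 1 c v -> is_derive t 1 (F \o c) (v *m grad F (c t)).
Proof.
move=> oW CF Wc dc; have dF := Ck1_differentiable mvT oW CF Wc.
have := is_derive_chain dF dc.
by rewrite -(deriveE _ dF) (derive_grad _ oW CF Wc).
Qed.

End Grad.

Section Solutions.
Variables (R : realType) (n : nat).
Local Notation E := 'rV[R]_n.
Local Notation e_ k := (delta_mx 0 k : E).
Local Notation T := 'rV[R]_(1 + n).
Implicit Types (Gam : E -> E -> E -> E) (V W : set E) (h : E -> E -> E -> R^o).
Implicit Types (F G : E -> T).
Let mvT := @mean_value_mx R 1 (1 + n).

Lemma jet_unit_neq0 W F x : open W -> Ck 1 W F -> W x ->
  jet F x \in unitmx -> F x != 0.
Proof.
move=> oW CF Wx /(jet_unitP oW CF Wx) H; apply/eqP => F0.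
have [|/eqP] := H 1 0; first by rewrite F0 scaler0 derive0 addr0.
by rewrite oner_eq0.
Qed.

Lemma open_nbhsP (A : set E) : (forall x, A x -> nbhs x A) -> open A.
Proof. by move=> AA; rewrite openE => x /AA. Qed.

(** Solve the equation for [h] in a coordinate where [F] does not vanish. *)
Lemma hessian_smooth Gam W h F x0 : solution Gam W F -> hessian_eq Gam W h F ->
  (forall u v, smooth_on W (fun x => Gam x u v)) -> W x0 ->
  exists W', [/\ open W', W' x0, W' `<=` W
    & forall u v, smooth_on W' (fun x => h x u v)].
Proof.
move=> [oW CF uF _] hF CG Wx0.
have := jet_unit_neq0 oW (CF 1) Wx0 (uF _ Wx0).
move=> /rV0Pn[j Fj].
have Cj k : Ck k W (fun x => F x 0 j : R^o).
  by have /Ck_mxP := CF k; exact.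
pose W' := W `&` [set x | F x 0 j != 0].
have oW' : open W'.
  apply: open_nbhsP => x [Wx Fx]; apply: filterI.
    exact: open_nbhs_nbhs.
  have := Ck_continuous (Cj 0) Wx; move=> /(_ [set y | y != 0]); apply.
  by apply: open_nbhs_nbhs; split => //; exact: open_neq.
have sW : W' `<=` W by move=> x [].
exists W'; split=> // u v k.
pose q x := ((Gam x u v *m grad F x) 0 j - 'D_u ('D_v F) x 0 j) * (F x 0 j)^-1 : R^o.
apply: (Ck_eq oW' (f := q)).
  move=> x [Wx Fx]; have := hF x u v Wx.
  rewrite (derive_grad _ oW (CF 1) Wx) => H.
  rewrite /q H [X in _ - X]mxE [X in _ - (_ + X)]mxE [X in _ - (_ + - X)]mxE.
  by rewrite opprD opprK addrA subrr add0r mulfK.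
apply: Ck_mul => //; last first.
  by apply: Ck_inv => //; [move=> x []|exact: Ck_sub (Cj k)].
apply: Ck_add => //.
  apply: (Ck_sub sW); have : Ck k W (fun x => Gam x u v *m grad F x).
    by apply: Ck_mulmx => //; [exact: CG|exact: grad_Ck oW (CF k.+1)].
  by move=> /Ck_mxP; exact.
apply: Ck_opp => //; apply: (Ck_sub sW).
by have /Ck_mxP := Ck_derive u (Ck_derive v (CF k.+2)); exact.
Qed.

Lemma third_derivative_algebra (p q f d : T) (s t k : R) :
  p + (q - s *: f) - (t *: f + k *: d) = p + q - (s + t) *: f - k *: d.
Proof. by apply/rowP => j; rewrite !mxE; ring. Qed.

Lemma curvature_algebra (A B C D u v : E) (M : 'M[R]_(n, 1 + n)) (f : T) (c1 c2 k1 k2 : R) :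
  (A + B) *m M - c1 *: f - k1 *: (u *m M) = (C + D) *m M - c2 *: f - k2 *: (v *m M) ->
  (c2 - c1) *: f + (A + B - (C + D) - (k1 *: u - k2 *: v)) *m M = 0.
Proof.
rewrite !mulmxBl -!scalemxAl.
move: ((A + B) *m M) ((C + D) *m M) (u *m M) (v *m M) => p q r t /eqP.
rewrite -subr_eq0 => /eqP <-.
by apply/rowP => j; rewrite !mxE; ring.
Qed.

(** Differentiate Hess F = - h F once more and exchange the two outer
    derivatives; nondegeneracy of the jet allows comparing coefficients. *)
Lemma hessian_curv Gam W h F x u v w : solution Gam W F -> hessian_eq Gam W h F ->
  (forall u v, smooth_on W (fun x => Gam x u v)) ->
  (forall u v, smooth_on W (fun x => h x u v)) -> W x ->
  curv Gam x u v w = h x v w *: u - h x u w *: v.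
Proof.
move=> [oW CF uF _] hF CG Ch Wx.
have third a b : exists c : R, 'D_a ('D_b ('D_w F)) x =
    'D_('D_a (fun y => Gam y b w) x + Gam x a (Gam x b w)) F x - c *: F x
    - h x b w *: 'D_a F x.
  have -> : 'D_a ('D_b ('D_w F)) x =
      'D_a (fun y => Gam y b w *m grad F y - h y b w *: F y) x.
    apply: near_eq_derive; apply: filterS (open_nbhs_nbhs (conj oW Wx)) => y Wy.
    by rewrite hF// (derive_grad _ oW (CF 1) Wy).
  have d1 : is_derive x a (fun y => Gam y b w) ('D_a (fun y => Gam y b w) x).
    exact/derivableP/(Ck_derivable (CG b w 1) Wx).
  have d2 := is_derive_mulmx d1 (is_derive_grad a oW (CF 2) Wx).
  rewrite (mul_derive_grad a (Gam x b w) oW (CF 2) Wx) in d2.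
  have d3 : is_derive x a (fun y => h y b w *: F y)
      ('D_a (fun y => h y b w) x *: F x + h x b w *: 'D_a F x).
    apply/is_derive_mxP => i j.
    have dh : is_derive x a (fun y => h y b w) ('D_a (fun y => h y b w) x).
      exact/derivableP/(Ck_derivable (Ch b w 1) Wx).
    have /is_derive_mxP/(_ i j) dF : is_derive x a F ('D_a F x).
      exact/derivableP/(Ck_derivable (CF 1) Wx).
    have := is_deriveM dh dF => K.
    rewrite (_ : (fun y => (h y b w *: F y) i j) = (fun y => h y b w) * (fun y => F y i j)).
      apply: is_derive_eq K _.
      by rewrite !mxE addrC; congr (_ + _); exact: mulrC.
    by apply/funext => y; rewrite mxE.
  have [_ ->] := is_deriveB d2 d3.
  exists (h x a (Gam x b w) + 'D_a (fun y => h y b w) x).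
  rewrite -(derive_grad _ oW (CF 1) Wx) (hF _ _ _ Wx).
  rewrite (derive_grad ('D_a _ x + _) oW (CF 1) Wx) mulmxDl.
  by rewrite -!(derive_grad _ oW (CF 1) Wx); exact: third_derivative_algebra.
have [c1 E1] := third u v; have [c2 E2] := third v u.
have S : 'D_u ('D_v ('D_w F)) x = 'D_v ('D_u ('D_w F)) x.
  exact: (Ck_derive_swap mvT _ _ oW (Ck_derive w (CF 3)) Wx).
have {}S := etrans (esym E1) (etrans S E2).
rewrite !(derive_grad _ oW (CF 1) Wx) in S.
have /(jet_unitP oW (CF 1) Wx) U := uF x Wx.
have [] := U (c2 - c1) (curv Gam x u v w - (h x v w *: u - h x u w *: v)).
  by rewrite (derive_grad _ oW (CF 1) Wx); exact: curvature_algebra S.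
by move=> _ /eqP; rewrite subr_eq0 => /eqP.
Qed.

Lemma hessian_sub Gam V W h F : V `<=` W -> hessian_eq Gam W h F -> hessian_eq Gam V h F.
Proof. by move=> VW hF x u v /VW; exact: hF. Qed.

Lemma solution_sub Gam V W F : open V -> V `<=` W -> solution Gam W F -> solution Gam V F.
Proof.
move=> oV VW [oW CF uF [h hF]]; split=> //.
- by move=> k; exact: Ck_sub (CF k).
- by move=> x /VW; exact: uF.
- by exists h; exact: hessian_sub hF.
Qed.

(** In dimension at least two the curvature formula determines [h]: apply it
    to linearly independent vectors. *)
Lemma hessian_unique Gam V h0 W h F : (2 <= n)%N -> flat_tractor V Gam h0 ->
  W `<=` V -> solution Gam W F -> hessian_eq Gam W h F ->
  forall x u v, W x -> h x u v = h0 x u v.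
Proof.
move=> n2 ft WV sF hF x u v Wx.
have CG a b : smooth_on W (fun x => Gam x a b).
  by move=> k; exact: Ck_sub (ft_smooth ft a b k).
have [W' [oW' W'x W'W Ch]] := hessian_smooth sF hF CG Wx.
have [oW CF uF _] := sF.
have C a b c := hessian_curv a b c (solution_sub oW' W'W sF) (hessian_sub W'W hF)
   (fun a b k => Ck_sub W'W (CG a b k)) Ch W'x.
have Vx := WV _ Wx.
have C0 a b c := ft_curv ft a b c Vx.
have bh0 := ft_hbilin ft Vx.
have key (a : 'I_n) (b : E) : (h x u v - h0 x u v) * b 0 a = (h x b v - h0 x b v) * u 0 a.
  have := C u b v; rewrite C0 => /rowP/(_ a); rewrite !mxE => H.
  lra.
have [u0|/rV0Pn[k uk]] := eqVneq u 0.
  rewrite u0 (bilin0l bh0).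
  have := hF x 0 v Wx; rewrite derive0 (bilin0l (ft_bilin ft Vx)) derive0 sub0r.
  move=> /esym/eqP; rewrite oppr_eq0 scaler_eq0.
  by rewrite (negPf (jet_unit_neq0 oW (CF 1) Wx (uF _ Wx))) orbF => /eqP.
have [l lk] : exists l : 'I_n, l != k.
  have [k0|k0] := eqVneq (k : nat) 0%N.
    by exists (Ordinal n2); rewrite -val_eqE /= k0.
  by exists (Ordinal (ltnW n2)); rewrite -val_eqE /= eq_sym.
have := key k (e_ l); rewrite mxE eqxx /= eq_sym (negPf lk) mulr0 => /esym/eqP.
rewrite mulf_eq0 (negPf uk) orbF => /eqP hl.
have := key l (e_ l); rewrite hl mul0r mxE !eqxx mulr1 => /eqP.
by rewrite subr_eq0 => /eqP.
Qed.

Lemma is_derive_mulmxr (Y : normedModType R) p q r (f : Y -> 'M[R]_(p, q)) (A : 'M[R]_(q, r)) x v df :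
  is_derive x v f df -> is_derive x v (fun y => f y *m A) (df *m A).
Proof.
move=> fd; have H := is_derive_mulmx fd (is_derive_cst A x v).
by apply: is_derive_eq H _; rewrite mulmx0 addr0.
Qed.

Lemma jet_mulmx W F (A : 'M[R]_(1 + n)) x : open W -> Ck 1 W F -> W x ->
  jet (fun y => F y *m A) x = jet F x *m A.
Proof.
move=> oW CF Wx; rewrite /jet mul_col_mx; congr col_mx.
apply/row_matrixP => k; rewrite rowK row_mul rowK.
have dF : is_derive x (e_ k) F ('D_(e_ k) F x).
  exact/derivableP/(Ck_derivable CF Wx).
by have [_ ->] := is_derive_mulmxr A dF.
Qed.

Lemma solution_mulmx Gam W F (A : 'M[R]_(1 + n)) : A \in unitmx ->
  solution Gam W F -> solution Gam W (fun y => F y *m A).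
Proof.
move=> uA [oW CF uF [h hF]]; split.
- exact: oW.
- by move=> k; apply: Ck_mulmx; [exact: oW|exact: CF|exact: Ck_cst].
- by move=> x Wx; rewrite (jet_mulmx _ oW (CF 1) Wx) unitmx_mul uF.
have dA k G x v : Ck k.+1 W G -> W x -> 'D_v (fun y => G y *m A) x = 'D_v G x *m A.
  move=> CG Wx; have dG : is_derive x v G ('D_v G x).
    exact/derivableP/(Ck_derivable CG Wx).
  by have [_ ->] := is_derive_mulmxr A dG.
exists h => x u v Wx.
have -> : 'D_u ('D_v (fun y => F y *m A)) x = 'D_u (fun y => 'D_v F y *m A) x.
  apply: near_eq_derive; apply: filterS (open_nbhs_nbhs (conj oW Wx)) => y Wy.
  exact: (dA 0).
rewrite (dA 0%N ('D_v F) x u (Ck_derive v (CF 2)) Wx) hF//.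
by rewrite (dA 0%N F _ _ (CF 1) Wx) mulmxBl -scalemxAl.
Qed.

Lemma solution_eq Gam W F G : (forall x, W x -> F x = G x) -> solution Gam W F ->
  solution Gam W G.
Proof.
move=> FG [oW CF uF [h hF]].
have nFG x : W x -> \forall y \near x, F y = G y.
  by move=> Wx; apply: filterS (open_nbhs_nbhs (conj oW Wx)) => y /FG.
have dFG x v : W x -> 'D_v F x = 'D_v G x.
  by move=> Wx; apply: near_eq_derive; exact: nFG.
split.
- exact: oW.
- by move=> k; apply: Ck_eq (CF k); [exact: oW|exact: FG].
- move=> x Wx; suff -> : jet G x = jet F x by exact: uF.
  rewrite /jet (FG _ Wx); congr col_mx.
  by apply/row_matrixP => k; rewrite !rowK (dFG _ _ Wx).
exists h => x u v Wx; rewrite -(FG _ Wx) -(dFG _ _ Wx) -(hF _ _ _ Wx).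
apply: esym; apply: near_eq_derive.
by apply: filterS (open_nbhs_nbhs (conj oW Wx)) => y Wy; exact: dFG.
Qed.

(** The jets of the two solutions are parallel frames of the same connection. *)
Theorem solution_unique Gam V h0 W F G x0 : (2 <= n)%N -> flat_tractor V Gam h0 ->
  W `<=` V -> solution Gam W F -> solution Gam W G -> W x0 ->
  exists A : 'M[R]_(1 + n), \forall x \near x0, G x = F x *m A.
Proof.
move=> n2 ft WV sF sG Wx0; have [oW CF uF [hF' hF]] := sF.
have [_ CG uG [hG' hG]] := sG.
have {}hF : hessian_eq Gam W h0 F.
  by move=> x u v Wx; rewrite hF// (hessian_unique n2 ft WV sF hF).
have {}hG : hessian_eq Gam W h0 G.
  by move=> x u v Wx; rewrite hG// (hessian_unique n2 ft WV sG hG).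
pose A := invmx (jet F x0) *m jet G x0; exists A.
pose D x := jet G x - jet F x *m A.
pose Om x v := tractor_mx (Gam x) (h0 x) v.
have dD x v : W x -> is_derive x v D (Om x v *m D x).
  move=> Wx; rewrite /D mulmxBr; apply: is_deriveB.
    exact: jet_derive oW (CG 2) Wx hG.
  have H := jet_derive v oW (CF 2) Wx hF.
  by rewrite mulmxA; exact: is_derive_mulmxr.
have D0 : D x0 = 0.
  by rewrite /D /A mulmxA mulmxV ?mul1mx ?subrr// uF.
have [C C0 HC] : exists2 C, 0 <= C & \forall y \near x0, forall k : 'I_n, `|Om y (e_ k)| <= C.
  apply: near_bounded => k.
  exact: (Ck_continuous (tractor_mx_Ck ft 0 (e_ k)) (WV _ Wx0)).
have /nbhs_ballP[r /= r0 Hr] : nbhs x0 (W `&` [set y | forall k, `|Om y (e_ k)| <= C]).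
  by apply: filterI => //; exact: open_nbhs_nbhs.
pose c := (1 + n)%:R * (n%:R * C) + 1.
have mC0 : 0 <= (1 + n)%:R * (n%:R * C) by rewrite !mulr_ge0.
have c0 : 0 < c by rewrite ltr_wpDl.
near=> x.
suff : D x = 0.
  move=> /eqP; rewrite subr_eq0 => /eqP; rewrite /jet mul_col_mx.
  by move=> /eq_col_mx[].
have wr : `|x - x0| < r.
  near: x; apply/nbhs_ballP; exists r => // y.
  by rewrite -ball_normE /= distrC.
have wc : c * `|x - x0| <= 2^-1.
  rewrite mulrC -ler_pdivlMr//.
  near: x; apply/nbhs_ballP; exists (2^-1 / c); first by rewrite /= divr_gt0// invr_gt0.
  by move=> y; rewrite -ball_normE /= distrC => /ltW.
move: wr wc; set w := x - x0 => wr wc.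
have w0 : 0 <= `|w| by [].
have inW (t : R) : `|t - 0| <= 1 -> ball x0 r (t *: w + x0).
  rewrite subr0 => t1; rewrite -ball_normE /= distrC addrK normrZ.
  by rewrite (le_lt_trans _ wr)// ler_piMl.
have := @short_gronwall R _ (@mean_value_mx R (1 + n) (1 + n)) (fun t => D (t *: w + x0))
  (fun t => Om (t *: w + x0) w *m D (t *: w + x0)) 0 1 2^-1 0.
move=> H; apply/eqP; rewrite -normr_le0.
have -> : x = 1 *: w + x0 by rewrite scale1r subrK.
have half0 : 0 <= 2^-1 :> R by rewrite invr_ge0.
have half1 : 2^-1 * 1 <= 1 / 2 :> R by rewrite mulr1 mul1r.
have Dw0 : D (0 *: w + x0) = 0 by rewrite scale0r add0r.
have Dd (s : R) : `|s - 0| <= 1 -> is_derive s 1 (fun t : R => D (t *: w + x0))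
    (Om (s *: w + x0) w *m D (s *: w + x0)).
  move=> s1; apply: is_derive_line; apply: dD.
  by have [] := Hr _ (inW _ s1).
have Db (s : R) : `|s - 0| <= 1 -> `|Om (s *: w + x0) w *m D (s *: w + x0)| <=
    2^-1 * `|D (s *: w + x0)| + 0.
  move=> s1; rewrite addr0; apply: le_trans (normr_mulmx_le _ _) _.
  apply: ler_wpM2r; first exact: normr_ge0.
  have [Wy HCy] := Hr _ (inW _ s1); have Vy := WV _ Wy.
  have OmE := @Om_row_comb R n (1 + n) V Om (@tractor_mx_linear _ _ _ _ _ ft) _ w Vy.
  rewrite OmE; apply: le_trans wc.
  apply: (@le_trans _ _ ((1 + n)%:R * (n%:R * C * `|w|))).
    by rewrite ler_wpM2l//; apply: norm_row_comb_le.
  by rewrite mulrA ler_wpM2r// /c lerDl.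
have one1 : `|1 - 0 : R| <= 1 by rewrite subr0 normr1.
have := H ler01 half0 (lexx 0) half1 Dw0 Dd Db 1 one1.
by rewrite mulr0 mul0r.
Unshelve. all: by end_near. Qed.

(** Equality of the germs passes to the jets, and these are invertible. *)
Lemma solution_mulmx_eq Gam W F (A B : 'M[R]_(1 + n)) x0 : solution Gam W F -> W x0 ->
  (\forall x \near x0, F x *m A = F x *m B) -> A = B.
Proof.
move=> [oW CF uF _] Wx0 FAB.
have CA (M : 'M[R]_(1 + n)) : Ck 1 W (fun y => F y *m M).
  by apply: Ck_mulmx => //; exact: Ck_cst.
have J : jet F x0 *m A = jet F x0 *m B.
  rewrite -!(jet_mulmx _ oW (CF 1) Wx0) /jet (nbhs_singleton FAB); congr col_mx.
  apply/row_matrixP => k; rewrite !rowK.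
  exact: near_eq_derive.
have := congr1 (mulmx (invmx (jet F x0))) J.
by rewrite !mulmxA !mulVmx ?uF// !mul1mx.
Qed.

(** The inhomogeneous term in the transformation law of Christoffel symbols
    absorbs the second derivatives of the change of coordinates. *)
Theorem solution_comp Gam Gam' (O W' : set E) F (t : E -> E) :
  open O -> smooth_on O t ->
  (forall x u, O x -> 'D_u t x = 0 -> u = 0) ->
  (forall x u v, O x ->
     'D_(Gam x u v) t x = 'D_u ('D_v t) x + Gam' (t x) ('D_u t x) ('D_v t x)) ->
  (forall x, O x -> W' (t x)) -> solution Gam' W' F -> solution Gam O (F \o t).
Proof.
move=> oO Ct tinj tGam OW' [oW' CF uF [h hF]].
have dFt x v : O x -> 'D_v (F \o t) x = 'D_v t x *m grad F (t x).
  move=> Ox; have dt := derivableP (Ck_derivable (v := v) (Ct 1) Ox).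
  have dF := Ck1_differentiable mvT oW' (CF 1) (OW' _ Ox).
  have [_ ->] := is_derive_chain dF dt.
  by rewrite -deriveE// (derive_grad _ oW' (CF 1) (OW' _ Ox)).
have CFt k : Ck k O (F \o t).
  apply/Ck_mxP => // i j.
  apply: (@Ck_comp R n n k O W' (fun y => F y i j : R^o) t) => //.
  by have /Ck_mxP := CF k; exact.
split.
- exact: oO.
- exact: CFt.
- move=> x Ox; apply/(jet_unitP oO (CFt 1) Ox) => c u.
  rewrite dFt// -(derive_grad _ oW' (CF 1) (OW' _ Ox)).
  have /(jet_unitP oW' (CF 1) (OW' _ Ox)) H := uF _ (OW' _ Ox).
  by move=> /H[-> Du]; split; [by []|exact: (tinj _ _ Ox Du)].
exists (fun x u v => h (t x) ('D_u t x) ('D_v t x)) => x u v Ox.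
have Wt := OW' _ Ox.
have -> : 'D_u ('D_v (F \o t)) x = 'D_u (fun y => 'D_v t y *m (grad F \o t) y) x.
  apply: near_eq_derive; apply: filterS (open_nbhs_nbhs (conj oO Ox)) => y Oy.
  exact: dFt.
have ddt : is_derive x u ('D_v t) ('D_u ('D_v t) x).
  exact/derivableP/(Ck_derivable (Ck_derive v (Ct 2)) Ox).
have Cg k := grad_Ck oW' (CF k.+1).
have dgt : is_derive x u (grad F \o t) (\matrix_k 'D_('D_u t x) ('D_(e_ k) F) (t x)).
  have dt := derivableP (Ck_derivable (v := u) (Ct 1) Ox).
  have dg := Ck1_differentiable (@mean_value_mx R n (1 + n)) oW' (Cg 1) Wt.
  have := is_derive_chain dg dt.
  rewrite -deriveE// => K; apply: is_derive_eq K _.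
  by have [_ ->] := is_derive_grad ('D_u t x) oW' (CF 2) Wt.
have [_ ->] := is_derive_mulmx ddt dgt.
rewrite (mul_derive_grad ('D_u t x) ('D_v t x) oW' (CF 2) Wt) hF// dFt// tGam// mulmxDl /=.
by rewrite -!(derive_grad _ oW' (CF 1) Wt) addrA.
Qed.

End Solutions.

(** * Global sections of locally constant systems of frames *)

(** Germs of nondegenerate vector-valued functions, any two of which differ by
    a constant invertible matrix: a locally constant sheaf of frames. *)
Record frame_system (R : realType) (m : nat) (X : topologicalType)
    (S : (X -> 'rV[R]_m) -> X -> Prop) : Prop := FrameSystem {
  fs_open : forall F x, S F x -> \forall y \near x, S F y;
  fs_germ : forall F G x, (\forall y \near x, F y = G y) -> S F x -> S G x;
  fs_exists : forall x, exists F, S F x;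
  fs_unique : forall F G x, S F x -> S G x ->
    exists A : 'M[R]_m, \forall y \near x, G y = F y *m A;
  fs_mul : forall F (A : 'M[R]_m) x, A \in unitmx -> S F x ->
    S (fun y => F y *m A) x;
  fs_cancel : forall F (A B : 'M[R]_m) x, S F x ->
    (\forall y \near x, F y *m A = F y *m B) -> A = B }.

Section FrameSystem.
Variables (R : realType) (m : nat) (X : topologicalType).
Variable S : (X -> 'rV[R]_m) -> X -> Prop.
Hypothesis fS : frame_system S.

Lemma frame_unit F G (A : 'M[R]_m) x : S F x -> S G x ->
  (\forall y \near x, G y = F y *m A) -> A \in unitmx.
Proof.
move=> SF SG FG; have [B GF] := fs_unique fS SG SF.
have : A *m B = 1%:M.
  apply: (fs_cancel fS SF); near=> y; rewrite mulmx1 mulmxA.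
  by rewrite -(near FG y)// -(near GF y).
by case/mulmx1_unit.
Unshelve. all: by end_near. Qed.

(** The transition matrix is locally constant; by [fs_cancel] it is well
    defined at each point, so that its level sets are open and disjoint. *)
Lemma frame_connected (C : set X) F G x0 : connected C -> C x0 ->
  (forall x, C x -> S F x /\ S G x) ->
  exists A : 'M[R]_m, forall x, C x -> \forall y \near x, G y = F y *m A.
Proof.
move=> cC Cx0 SFG; have [SF0 SG0] := SFG _ Cx0.
have [A GA] := fs_unique fS SF0 SG0.
pose P (x : X) : Prop := \forall y \near x, G y = F y *m A.
pose Q (x : X) : Prop := S F x /\ exists2 B, B != A & \forall y \near x, G y = F y *m B.
have oP : open P by rewrite openE => x; exact: nbhs_interior.
have oQ : open Q.
  rewrite openE => x [SF [B BA GB]]; have := fs_open fS SF.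
  move/nbhs_interior: GB => GB SFy; apply: filterS2 GB SFy => y GBy SFy.
  by split=> //; exists B.
have PQ x : C x -> P x <-> ~ Q x.
  move=> Cx; have [SF SG] := SFG _ Cx; split=> [Px [_ [B BA GB]]|nQ].
    move/eqP: BA; apply; apply: (fs_cancel fS SF).
    by apply: filterS2 Px GB => y -> ->.
  have [B GB] := fs_unique fS SF SG.
  have [BA|BA] := eqVneq B A; first by rewrite /P -BA.
  by exfalso; apply: nQ; split=> //; exists B.
exists A => x Cx.
have E : C `&` P = C.
  apply: cC.
  - by exists x0.
  - by exists P.
  - exists (~` Q); first exact: open_closedC.
    by apply/seteqP; split=> y [Cy] /(PQ _ Cy).
by move: Cx; rewrite -E => -[].
Qed.

End FrameSystem.

Section Pullback.
Variables (R : realType) (m : nat) (X Y : topologicalType) (pi : Y -> X).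
Variable S : (X -> 'rV[R]_m) -> X -> Prop.
Hypothesis fS : frame_system S.
Hypothesis pic : continuous pi.
Hypothesis pio : forall y (B : set Y), nbhs y B -> nbhs (pi y) (pi @` B).

(** Used when [pi] is an open embedding of a vector space. *)
Definition pullback (Phi : Y -> 'rV[R]_m) y :=
  exists2 F, S F (pi y) & \forall z \near y, Phi z = F (pi z).

Lemma near_pi y (P : X -> Prop) : (\forall x \near pi y, P x) ->
  \forall z \near y, P (pi z).
Proof. by move=> nP; exact: (pic nP). Qed.

Lemma near_pi_inv y (P : X -> Prop) : (\forall z \near y, P (pi z)) ->
  \forall x \near pi y, P x.
Proof. by move=> /pio; apply: filterS => x [z Pz <-]. Qed.

Lemma frame_pullback : frame_system pullback.
Proof.
split.
- move=> Phi y [F SF PF]; have := near_pi (fs_open fS SF).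
  move/nbhs_interior: PF => PF; apply: filterS2 PF => z PF SFz.
  by exists F.
- move=> Phi Psi y PP [F SF PF]; exists F => //.
  by apply: filterS2 PP PF => z ->.
- move=> y; have [F SF] := fs_exists fS (pi y); exists (F \o pi); exists F => //.
  by apply: nearW.
- move=> Phi Psi y [F SF PF] [G SG PG]; have [A GA] := fs_unique fS SF SG.
  exists A; apply: filterS3 PF PG (near_pi GA) => z -> ->.
  by [].
- move=> Phi A y uA [F SF PF]; exists (fun x => F x *m A); first exact: fs_mul.
  by apply: filterS PF => z ->.
- move=> Phi A B y [F SF PF] AB; apply: (fs_cancel fS SF).
  by apply: near_pi_inv; apply: filterS2 PF AB => z ->.
Qed.

End Pullback.

Section Convexity.
Variables (R : realType) (V : normedModType R).
Implicit Types (C : set V).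

Lemma segment_connected_set (x y : V) :
  connected [set t *: y + (1 - t) *: x | t in `[0, 1]%classic : set R].
Proof.
apply: connected_continuous_connected; first exact: segment_connected.
apply: continuous_subspaceT => t; apply: cvgD.
  by apply: cvgZr_tmp; exact: cvg_id.
apply: cvgZr_tmp; apply: cvgB; first exact: cvg_cst.
exact: cvg_id.
Qed.

Lemma joined_connected C x0 : C x0 ->
  (forall y, C y -> exists D, [/\ connected D, D `<=` C, D x0 & D y]) -> connected C.
Proof.
move=> Cx0 CD.
have -> : C = \bigcup_(D in [set D | [/\ connected D, D `<=` C & D x0]]) D.
  apply/seteqP; split=> [y /CD[D [cD DC Dx Dy]]|y [D [cD DC Dx] /DC]//].
  by exists D.
apply: bigcup_connected; last by move=> D [].
by exists x0 => D [].
Qed.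

Lemma segment_convex_joined C x y : segment_convex C -> C x -> C y ->
  exists D, [/\ connected D, D `<=` C, D x & D y].
Proof.
move=> cvC Cx Cy; exists [set t *: y + (1 - t) *: x | t in `[0, 1]%classic : set R].
split.
- exact: segment_connected_set.
- by move=> z [t /=]; rewrite in_itv /= => t01 <-; exact: cvC.
- by exists 0; rewrite /= ?in_itv /= ?lexx ?ler01// scale0r subr0 scale1r add0r.
- by exists 1; rewrite /= ?in_itv /= ?lexx ?ler01// subrr scale0r scale1r addr0.
Qed.

Lemma segment_convex_connected C : segment_convex C -> connected C.
Proof.
move=> cvC; have [->|/set0P[x0 Cx0]] := eqVneq C set0; first exact: connected0.
by apply: (joined_connected Cx0) => y Cy; exact: segment_convex_joined.
Qed.

Lemma segment_convexI C D : segment_convex C -> segment_convex D ->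
  segment_convex (C `&` D).
Proof. by move=> cC cD x y t [Cx Dx] [Cy Dy] t01; split; [exact: cC|exact: cD]. Qed.

(** Neighbourhood of the segment from the origin to [s *: v]. *)
Definition tube (v : V) (s e : R) : set V :=
  [set x | exists2 t, 0 <= t <= s & `|x - t *: v| < e].

Lemma tube_convex v s e : segment_convex (tube v s e).
Proof.
move=> x y t [a a0s xa] [b b0s yb] t01.
exists (t * b + (1 - t) * a).
  by move: a0s b0s t01 => /andP[? ?] /andP[? ?] /andP[? ?]; apply/andP; split; nra.
rewrite [(t * b + _) *: v]scalerDl -!scalerA convex_comb_sub.
exact: normr_convex.
Qed.

Lemma tube_open v s e : open (tube v s e).
Proof.
rewrite openE => x [t t0s xt]; apply/nbhs_ballP.
exists (e - `|x - t *: v|); first by rewrite /= subr_gt0.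
move=> y; rewrite -ball_normE /= => xy; exists t => //.
rewrite -(subrKA x) (le_lt_trans (ler_normD _ _))// -ltrBrDr.
by rewrite distrC.
Qed.

End Convexity.

Section Radial.
Variables (R : realType) (m n : nat).
Local Notation E := 'rV[R]_n.
Variable S : (E -> 'rV[R]_m) -> E -> Prop.
Hypothesis fS : frame_system S.

Lemma near_if (A : set E) (F G : E -> 'rV[R]_m) x : open A -> A x ->
  \forall y \near x, F y = (if `[< A y >] then F y else G y).
Proof.
move=> oA Ax; apply: filterS (open_nbhs_nbhs (conj oA Ax)) => y Ay.
by case: asboolP.
Qed.

(** Continuation along the ray: the lengths up to which it is possible have a
    supremum, and a section around the point at that distance continues any
    section that comes close enough, so that the supremum is 1 and is
    attained. *)
Lemma radial_continuation (F0 : E -> 'rV[R]_m) (v : E) : S F0 0 ->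
  exists e Phi, [/\ 0 < e, forall x, tube v 1 e x -> S Phi x &
    \forall y \near (0 : E), Phi y = F0 y].
Proof.
move=> SF0.
pose P s := exists e Phi, [/\ 0 < e, forall x, tube v s e x -> S Phi x &
    \forall y \near (0 : E), Phi y = F0 y].
have P0 : P 0.
  have /nbhs_ballP[e /= e0 He] := fs_open fS SF0.
  exists e, F0; split=> [//|x [t t0 xt]|]; last by apply: filterE.
  apply: He; rewrite -ball_normE /= sub0r normrN.
  have t00 : t = 0 by apply/eqP; rewrite eq_le andbC.
  by move: xt; rewrite t00 scale0r subr0.
pose A := [set s : R | 0 <= s <= 1 /\ P s].
have A0 : A 0 by split=> //; rewrite lexx ler01.
have A1 s : A s -> s <= 1 by move=> [/andP[]].
have hsA : has_sup A by split; [exists 0|exists 1 => s /A1].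
pose b := sup A.
have b0 : 0 <= b by apply: sup_upper_bound.
have b1 : b <= 1 by apply: ge_sup; [exists 0|exact: A1].
have [G SG] := fs_exists fS (b *: v).
have /nbhs_ballP[r /= r0 Hr] := fs_open fS SG.
pose d := r / (2 * (`|v| + 1)).
have v1 : 0 < `|v| + 1 by rewrite ltr_wpDl.
have d0 : 0 < d by rewrite /d divr_gt0// mulr_gt0.
have dv : d * `|v| <= r / 2.
  rewrite /d invfM mulrA -mulrA ler_piMr//; first by rewrite divr_ge0// ltW.
  by rewrite mulrC ler_pdivrMr// mul1r lerDl.
have [s1 [/andP[s10 s11] [e [Phi [e0 SPhi PhiF0]]]] s1b] := sup_adherent d0 hsA.
have s1b' : s1 <= b.
  by apply: sup_upper_bound => //; split; [rewrite s10|exists e, Phi].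
have step s2 : s1 <= s2 -> `|s2 - b| <= d -> P s2.
  move=> s12 s2b.
  have near_b t : s1 <= t <= s2 -> `|t *: v - b *: v| <= r / 2.
    move=> /andP[t1 t2]; rewrite -scalerBl normrZ; apply: le_trans dv.
    rewrite ler_wpM2r//; move: s2b; rewrite !ler_distl => /andP[h1 h2].
    rewrite -/b in s1b; lra.
  have r2 : r / 2 < r by rewrite ltr_pdivrMr// ltr_pMr// ltr1n.
  have bs1 : ball (b *: v) r (s1 *: v).
    by rewrite -ball_normE /= distrC (le_lt_trans (near_b _ _))// lexx s12.
  have ts1 : tube v s1 e (s1 *: v).
    by exists s1; [rewrite s10 lexx|rewrite subrr normr0].
  have [B HB] := @frame_connected _ _ _ _ fS (tube v s1 e `&` ball (b *: v) r) G Phi (s1 *: v)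
    (segment_convex_connected (segment_convexI (@tube_convex _ _ v s1 e)
       (@ball_segment_convex _ _ (b *: v) r))) (conj ts1 bs1)
    (fun x tx => conj (Hr _ tx.2) (SPhi _ tx.1)).
  have uB : B \in unitmx.
    apply: (frame_unit fS (Hr _ bs1) (SPhi _ ts1)).
    exact: (HB _ (conj ts1 bs1)).
  pose Psi y := if `[< tube v s1 e y >] then Phi y else G y *m B.
  have Psi_tube x : tube v s1 e x -> \forall y \near x, Phi y = Psi y.
    by move=> tx; apply: near_if => //; exact: tube_open.
  have Psi_ball x : ball (b *: v) r x -> \forall y \near x, G y *m B = Psi y.
    move=> bx; have : nbhs x (ball (b *: v) r).
      by apply: open_nbhs_nbhs; split=> //; exact: ball_open.
    apply: filterS => y by_; rewrite /Psi; case: asboolP => // ty.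
    by rewrite (nbhs_singleton (HB _ (conj ty by_))).
  exists (Num.min e (r / 2)), Psi; split.
  - by rewrite lt_min e0 divr_gt0.
  - move=> x [t /andP[t0 ts2] xt].
    have [ts|ts] := leP t s1.
      have tx : tube v s1 e x.
        by exists t; [rewrite t0|rewrite (lt_le_trans xt)// ge_min lexx].
      by apply: (fs_germ fS (Psi_tube _ tx)); exact: SPhi.
    have bx : ball (b *: v) r x.
      rewrite -ball_normE /= distrC -(subrKA (t *: v)).
      rewrite (le_lt_trans (ler_normD _ _))// [ltRHS](splitr r).
      rewrite ltr_leD//; first by rewrite (lt_le_trans xt)// ge_min lexx orbT.
      by apply: near_b; rewrite (ltW ts).
    apply: (fs_germ fS (Psi_ball _ bx)); apply: fs_mul => //.
    exact: Hr.
  - have t0 : tube v s1 e 0.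
      by exists 0; [rewrite lexx|rewrite scale0r subrr normr0].
    by apply: filterS2 (Psi_tube _ t0) PhiF0 => y <-.
have b_eq1 : b = 1.
  apply/eqP; rewrite eq_le b1 /= leNgt; apply/negP => b_lt1.
  pose s2 := Num.min 1 (b + d).
  have bs2 : b < s2 by rewrite lt_min b_lt1 ltrDl.
  have s2d : s2 <= b + d by rewrite ge_min lexx orbT.
  have : A s2.
    split; first by rewrite (le_trans b0 (ltW bs2)) ge_min lexx.
    apply: step; first exact: le_trans (ltW bs2).
    by rewrite ger0_norm ?subr_ge0 ?(ltW bs2)// lerBlDl.
  by move=> /(sup_upper_bound hsA); rewrite leNgt bs2.
have /step : s1 <= 1 by [].
by rewrite -b_eq1 subrr normr0; apply; exact: ltW.
Qed.

(** The continuations along two neighbouring rays agree where their tubes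
    meet: the intersection of the tubes is convex, and the two continuations
    coincide near the origin. *)
Theorem frame_section : exists Phi, forall x, S Phi x.
Proof.
have [F0 SF0] := fs_exists fS 0.
pose HP v := radial_continuation v SF0.
pose e v := projT1 (cid (HP v)).
pose Phi v := projT1 (cid (projT2 (cid (HP v)))).
have H v : [/\ 0 < e v, forall x, tube v 1 (e v) x -> S (Phi v) x &
    \forall y \near (0 : E), Phi v y = F0 y] by exact: (projT2 (cid (projT2 (cid (HP v))))).
exists (fun x => Phi x x) => x.
have tube1 v : tube v 1 (e v) v.
  have [e0 _ _] := H v.
  by exists 1; [rewrite ler01 lexx|rewrite scale1r subrr normr0].
have tube0 v : tube v 1 (e v) 0.
  have [e0 _ _] := H v.
  by exists 0; [rewrite ler01 lexx|rewrite scale0r subrr normr0].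
have [e0 SPhi Phi0] := H x.
apply: (fs_germ fS _ (SPhi _ (tube1 x))).
have : nbhs x (tube x 1 (e x)) by apply: open_nbhs_nbhs; split=> //; exact: tube_open.
apply: filterS => y ty.
have [_ SPhiy Phiy0] := H y.
have [B HB] := @frame_connected _ _ _ _ fS (tube x 1 (e x) `&` tube y 1 (e y))
  (Phi x) (Phi y) 0 (segment_convex_connected (segment_convexI
     (@tube_convex _ _ x 1 (e x)) (@tube_convex _ _ y 1 (e y))))
  (conj (tube0 x) (tube0 y)) (fun z tz => conj (SPhi _ tz.1) (SPhiy _ tz.2)).
have B1 : B = 1%:M.
  apply: (fs_cancel fS SF0).
  have HB0 := HB _ (conj (tube0 x) (tube0 y)).
  by apply: filterS3 HB0 Phi0 Phiy0 => z H1 H2 H3; rewrite mulmx1 -{1}H2 -H1 H3.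
by have := nbhs_singleton (HB _ (conj ty (tube1 y))); rewrite B1 mulmx1.
Qed.

End Radial.

(** * The sphere *)

Section Glue.
Variables (R : realType) (m : nat) (X : topologicalType).
Variable S : (X -> 'rV[R]_m) -> X -> Prop.
Hypothesis fS : frame_system S.

(** The transition matrix is constant on the connected intersection, and
    multiplying one section by it makes the two agree. *)
Lemma frame_glue (U1 U2 : set X) F1 F2 x0 : open U1 -> open U2 ->
  (forall x, U1 x \/ U2 x) -> connected (U1 `&` U2) -> (U1 `&` U2) x0 ->
  (forall x, U1 x -> S F1 x) -> (forall x, U2 x -> S F2 x) ->
  exists F, forall x, S F x.
Proof.
move=> o1 o2 cov c12 x0U S1 S2.
have [A HA] := frame_connected fS c12 x0U (fun x Ux => conj (S1 _ Ux.1) (S2 _ Ux.2)).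
have uA := frame_unit fS (S1 _ x0U.1) (S2 _ x0U.2) (HA _ x0U).
exists (fun x => if `[< U1 x >] then F1 x *m A else F2 x) => x.
have [Ux|Ux] := cov x.
  apply: (fs_germ fS _ (fs_mul fS uA (S1 _ Ux))).
  by apply: filterS (open_nbhs_nbhs (conj o1 Ux)) => y Uy; case: asboolP.
apply: (fs_germ fS _ (S2 _ Ux)).
apply: filterS (open_nbhs_nbhs (conj o2 Ux)) => y Uy; case: asboolP => // U1y.
exact: (nbhs_singleton (HA _ (conj U1y Uy))).
Qed.

Lemma frame_section_image n (pi : 'rV[R]_n -> X) (sg : X -> 'rV[R]_n) :
  continuous pi -> (forall y (B : set 'rV[R]_n), nbhs y B -> nbhs (pi y) (pi @` B)) ->
  (forall y, sg (pi y) = y) -> exists F, forall y, S F (pi y).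
Proof.
move=> pic pio sgK.
have [Phi SPhi] := frame_section (frame_pullback fS pic pio).
exists (Phi \o sg) => y; have [F SF PF] := SPhi y.
apply: (fs_germ fS _ SF); apply: (near_pi_inv pio).
by apply: filterS PF => z Pz; rewrite /= sgK Pz.
Qed.

End Glue.

Section Stereographic.
Variables (R : realType) (n : nat).
Local Notation E := 'rV[R]_n.

Definition sqnorm (x : E) : R := \sum_(k < n) x 0 k ^+ 2.

(** Inverse stereographic projection; the sign [s] selects the pole that is
    left out. *)
Definition stereo (s : R) (x : E) : 'rV[R]_n.+1 :=
  \row_k oapp (fun j => 2 / (sqnorm x + 1) * x 0 j)
    (s * (sqnorm x - 1) / (sqnorm x + 1)) (unlift ord0 k).

Definition stereo_inv (s : R) (y : 'rV[R]_n.+1) : E :=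
  \row_j (y 0 (lift ord0 j) / (1 - s * y 0 ord0)).

Lemma sqnorm_ge0 x : 0 <= sqnorm x.
Proof. by apply: sumr_ge0 => k _; exact: sqr_ge0. Qed.

Lemma sqnorm1_neq0 x : sqnorm x + 1 != 0.
Proof. by rewrite gt_eqF// ltr_wpDl// sqnorm_ge0. Qed.

Lemma sqnorm_eq0 x : (sqnorm x == 0) = (x == 0).
Proof.
apply/eqP/eqP => [x0|->]; last first.
  by rewrite /sqnorm big1// => k _; rewrite mxE expr0n.
apply/rowP => k; rewrite mxE; apply/eqP; rewrite -sqrf_eq0.
have := psumr_eq0P (fun i _ => sqr_ge0 (x 0 i)) x0 => /(_ k isT) ->.
by [].
Qed.

Lemma stereo0 s x : stereo s x 0 ord0 = s * (sqnorm x - 1) / (sqnorm x + 1).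
Proof. by rewrite mxE unlift_none. Qed.

Lemma stereoS s x j : stereo s x 0 (lift ord0 j) = 2 / (sqnorm x + 1) * x 0 j.
Proof. by rewrite mxE liftK. Qed.

Lemma stereo_sphere s x : s ^+ 2 = 1 -> sphere (stereo s x).
Proof.
move=> s1; rewrite /sphere /= big_ord_recl stereo0.
under eq_bigr do rewrite stereoS exprMn.
rewrite -mulr_sumr -/(sqnorm x) !exprMn s1 mul1r.
have q1 := sqnorm1_neq0 x; field.
by [].
Qed.

Lemma stereo_pole s x : s ^+ 2 = 1 -> s * stereo s x 0 ord0 != 1.
Proof.
move=> s1; rewrite stereo0 !mulrA -expr2 s1 mul1r.
have q1 := sqnorm1_neq0 x; rewrite -subr_eq0.
have -> : (sqnorm x - 1) / (sqnorm x + 1) - 1 = - 2 / (sqnorm x + 1).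
  by field.
by rewrite mulf_neq0 ?invr_eq0// oppr_eq0.
Qed.

Lemma stereoK s x : s ^+ 2 = 1 -> stereo_inv s (stereo s x) = x.
Proof.
move=> s1; apply/rowP => j; rewrite mxE stereoS stereo0.
have q1 := sqnorm1_neq0 x.
have -> : s * (s * (sqnorm x - 1) / (sqnorm x + 1)) = (sqnorm x - 1) / (sqnorm x + 1).
  by rewrite !mulrA -expr2 s1 mul1r.
have -> : 1 - (sqnorm x - 1) / (sqnorm x + 1) = 2 / (sqnorm x + 1) by field.
by field; rewrite q1.
Qed.

Lemma stereo_invK s y : s ^+ 2 = 1 -> sphere y -> s * y 0 ord0 != 1 ->
  stereo s (stereo_inv s y) = y.
Proof.
move=> s1; rewrite /sphere /= big_ord_recl => Sy ys.
have d0 : 1 - s * y 0 ord0 != 0 by rewrite subr_eq0 eq_sym.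
have qE : sqnorm (stereo_inv s y) = (1 + s * y 0 ord0) / (1 - s * y 0 ord0).
  rewrite /sqnorm; under eq_bigr do rewrite mxE exprMn.
  rewrite -mulr_suml.
  have -> : \sum_(i < n) y 0 (lift ord0 i) ^+ 2 = 1 - s ^+ 2 * y 0 ord0 ^+ 2.
    by rewrite s1 mul1r -Sy addrC addKr.
  by field.
have qE1 : sqnorm (stereo_inv s y) + 1 = 2 / (1 - s * y 0 ord0) by rewrite qE; field.
apply/rowP => k; case: (unliftP ord0 k) => [j|] ->.
  by rewrite stereoS mxE qE1; field.
rewrite stereo0 qE1 qE.
have -> : s * ((1 + s * y 0 ord0) / (1 - s * y 0 ord0) - 1) / (2 / (1 - s * y 0 ord0)) =
   s ^+ 2 * y 0 ord0 by field.
by rewrite s1 mul1r.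
Qed.

Lemma sqnorm_Ck k : Ck k setT (sqnorm : E -> R^o).
Proof.
apply: Ck_sum => [|i _]; first exact: openT.
by apply: Ck_mul; [exact: openT|exact/Ck_coord/openT|exact/Ck_coord/openT].
Qed.

Lemma stereo_continuous s : continuous (stereo s).
Proof.
suff C : Ck 0 setT (stereo s) by move=> x; exact: (Ck_continuous C).
have oT := @openT E.
apply/(Ck_mxP _ _ oT) => i k; rewrite (ord1 i) {i}.
have q1 : Ck 0 setT (fun x : E => sqnorm x + 1 : R^o).
  by apply: Ck_add; [|exact: sqnorm_Ck|exact: Ck_cst].
have q1V : Ck 0 setT (fun x : E => (sqnorm x + 1)^-1 : R^o).
  by apply: Ck_inv => // x _; exact: sqnorm1_neq0.
case: (unliftP ord0 k) => [j|] ->.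
  apply: (Ck_eq oT (f := fun y => 2 * (sqnorm y + 1)^-1 * y 0 j)).
    by move=> y _; rewrite stereoS.
  apply: Ck_mul => //; last exact: Ck_coord.
  by apply: Ck_mul => //; exact: Ck_cst.
apply: (Ck_eq oT (f := fun y => s * (sqnorm y - 1) * (sqnorm y + 1)^-1)).
  by move=> y _; rewrite stereo0.
apply: Ck_mul => //; apply: Ck_mul => //; first exact: Ck_cst.
by apply: Ck_add => //; [exact: sqnorm_Ck|exact: Ck_cst].
Qed.

Lemma stereo_inv_continuous (s : R) (y : 'rV[R]_n.+1) : s * y 0 ord0 != 1 ->
  {for y, continuous (stereo_inv s)}.
Proof.
move=> ys; have oT := @openT 'rV[R]_n.+1.
have d : Ck 0 setT (fun z : 'rV[R]_n.+1 => 1 - s * z 0 ord0 : R^o).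
  apply: Ck_add => //; first exact: Ck_cst.
  by apply: Ck_opp => //; apply: Ck_mul => //; [exact: Ck_cst|exact: Ck_coord].
pose D := [set z : 'rV[R]_n.+1 | 1 - s * z 0 ord0 != 0].
have oD : open D.
  apply: (@open_comp _ _ (fun z : 'rV[R]_n.+1 => 1 - s * z 0 ord0 : R^o) [set x | x != 0]).
    by move=> z _; exact: (Ck_continuous d).
  exact: open_neq.
have Dy : D y by rewrite /D /= subr_eq0 eq_sym.
suff C : Ck 0 D (stereo_inv s) by exact: (Ck_continuous C Dy).
apply/(Ck_mxP _ _ oD) => i k; rewrite (ord1 i) {i}.
apply: (Ck_eq oD (f := fun z => z 0 (lift ord0 k) * (1 - s * z 0 ord0)^-1)).
  by move=> z _; rewrite mxE.
apply: Ck_mul => //; first exact: Ck_coord.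
by apply: Ck_inv => //; exact: Ck_sub d.
Qed.

(** A nonzero vector is joined to the basis vector [e0] by a segment unless it
    is a multiple of [e0]; it is then joined to [e1], and so is [e0]. *)
Lemma punctured_connected : (2 <= n)%N -> connected [set x : E | x != 0].
Proof.
move=> n2; pose k0 := Ordinal (ltnW n2); pose k1 := Ordinal n2.
pose e0 : E := delta_mx 0 k0; pose e1 : E := delta_mx 0 k1.
have k01 : (k1 == k0) = false by [].
have seg (a y : E) : (forall t : R, 0 <= t <= 1 -> t *: y + (1 - t) *: a != 0) ->
    exists D, [/\ connected D, D `<=` [set x : E | x != 0], D a & D y].
  move=> H; exists [set t *: y + (1 - t) *: a | t in `[0, 1]%classic : set R].
  split.
  - exact: segment_connected_set.
  - by move=> z [t /=]; rewrite in_itv /= => t01 <-; exact: H.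
  - by exists 0; rewrite /= ?in_itv /= ?lexx ?ler01// scale0r subr0 scale1r add0r.
  - by exists 1; rewrite /= ?in_itv /= ?lexx ?ler01// subrr scale0r scale1r addr0.
(* if the segment from a basis vector to [y] meets the origin, then [y] is
   proportional to this basis vector *)
have hit (k : 'I_n) (y : E) : ~ (forall t : R, 0 <= t <= 1 ->
    t *: y + (1 - t) *: (delta_mx 0 k : E) != 0) -> forall j, j != k -> y 0 j = 0.
  move=> /existsNP[t /not_implyP[t01 /negP/negPn/eqP/rowP H]] j jk.
  have := H j; have := H k; rewrite !mxE !eqxx /= (negPf jk) /= mulr1 mulr0 addr0.
  have [->|t0] := eqVneq t 0.
    by rewrite mul0r add0r subr0 => /eqP; rewrite oner_eq0.
  by move=> _ /eqP; rewrite mulf_eq0 (negPf t0) /= => /eqP.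
have e0n : [set x : E | x != 0] e0.
  by apply/rV0Pn; exists k0; rewrite mxE !eqxx oner_eq0.
apply: (joined_connected e0n) => y /= y0.
have [H|/hit y_0] := pselect (forall t : R, 0 <= t <= 1 -> t *: y + (1 - t) *: e0 != 0).
  exact: seg.
have [D1 [c1 D1s D1a D1b]] : exists D, [/\ connected D, D `<=` [set x : E | x != 0], D e1 & D y].
  apply: seg; apply: contrapT => /hit y_1.
  move/negP: y0; apply; apply/eqP/rowP => j; rewrite mxE.
  have [->|jk] := eqVneq j k0; last exact: y_0.
  by apply: y_1; rewrite eq_sym.
have [D2 [c2 D2s D2a D2b]] : exists D, [/\ connected D, D `<=` [set x : E | x != 0], D e0 & D e1].
  apply: seg; apply: contrapT => /hit /(_ k1); rewrite k01 => /(_ isT) /eqP.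
  by rewrite mxE !eqxx oner_eq0.
exists (D2 `|` D1); split.
- by apply: connectedU => //; exists e1.
- by move=> z [/D2s|/D1s].
- by left.
- by right.
Qed.

End Stereographic.

(** Each complement of a pole is homeomorphic to a vector space, where
    [frame_section] applies, and the intersection of the two complements is
    connected in dimension at least two. *)
Theorem sphere_frame_section (R : realType) (n m : nat) (X : topologicalType)
    (F : X -> 'rV[R]_n.+1) (G : 'rV[R]_n.+1 -> X)
    (S : (X -> 'rV[R]_m) -> X -> Prop) :
  (2 <= n)%N -> continuous F -> (forall p, sphere (F p)) -> (forall p, G (F p) = p) ->
  (forall y, sphere y -> F (G y) = y) ->
  (forall phi : 'rV[R]_n -> 'rV[R]_n.+1, continuous phi -> (forall x, sphere (phi x)) ->
     continuous (G \o phi)) ->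
  frame_system S -> exists Phi, forall p, S Phi p.
Proof.
move=> n2 Fc FS GK FK Gc fS.
pose U (s : R) := [set p | s * F p 0 ord0 != 1].
pose pi (s : R) := G \o stereo (n := n) s.
have s1 : (1 : R) ^+ 2 = 1 by rewrite expr1n.
have sN1 : (-1 : R) ^+ 2 = 1 by rewrite sqrrN expr1n.
have Fk s x : s ^+ 2 = 1 -> F (pi s x) = stereo s x.
  by move=> ss; rewrite /pi /= FK//; exact: stereo_sphere.
have pic s : s ^+ 2 = 1 -> continuous (pi s).
  by move=> ss; apply: Gc; [exact: stereo_continuous|move=> x; exact: stereo_sphere].
have piK s y : s ^+ 2 = 1 -> (stereo_inv s \o F) (pi s y) = y.
  by move=> ss; rewrite /= Fk// stereoK.
have piU s y : s ^+ 2 = 1 -> U s (pi s y).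
  by move=> ss; rewrite /U /= Fk//; exact: stereo_pole.
have invK s p : s ^+ 2 = 1 -> U s p -> pi s (stereo_inv s (F p)) = p.
  by move=> ss Up; rewrite /pi /= stereo_invK.
have oU s : open (U s).
  have -> : U s = (fun p => s * F p 0 ord0) @^-1` [set x | x != 1] by [].
  apply: open_comp; last exact: open_neq.
  move=> p _; apply: cvgM; first exact: cvg_cst.
  have /continuous_mxP := Fc p; exact.
have pio s y (B : set 'rV[R]_n) : s ^+ 2 = 1 -> nbhs y B -> nbhs (pi s y) (pi s @` B).
  move=> ss yB.
  have cinv : {for pi s y, continuous (stereo_inv s \o F)}.
    apply: continuous_comp; first exact: Fc.
    by apply: stereo_inv_continuous; rewrite Fk//; exact: stereo_pole.
  have : nbhs (pi s y) ((stereo_inv s \o F) @^-1` B).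
    by apply: cinv; rewrite piK.
  have : nbhs (pi s y) (U s) by apply: open_nbhs_nbhs; split => //; exact: piU.
  by apply: filterS2 => p Up Bp; exists (stereo_inv s (F p)) => //; exact: invK.
have sec s : s ^+ 2 = 1 -> exists Phi, forall p, U s p -> S Phi p.
  move=> ss.
  have [Phi HPhi] := frame_section_image fS (pic _ ss)
    (fun y B => @pio s y B ss) (fun y => piK s y ss).
  by exists Phi => p Up; rewrite -(invK s p ss Up).
have [Phi1 H1] := sec 1 s1; have [Phi2 H2] := sec (-1) sN1.
have E : U 1 `&` U (-1) = pi 1 @` [set x | x != 0].
  apply/seteqP; split=> [p [U1p U2p]|p [x /= x0 <-]].
    exists (stereo_inv 1 (F p)); last exact: invK.
    apply/negP => /eqP x0.
    move/negP: U2p; apply; apply/eqP; rewrite -[X in F X](invK 1 p s1 U1p) x0.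
    rewrite Fk// stereo0.
    have -> : sqnorm (0 : 'rV[R]_n) = 0 by apply/eqP; rewrite sqnorm_eq0.
    by rewrite sub0r add0r divr1 mul1r mulrN1 opprK.
  split; first exact: piU.
  rewrite /U /= Fk// stereo0 mul1r mulN1r -subr_eq0.
  have q1 := sqnorm1_neq0 x.
  have -> : - ((sqnorm x - 1) / (sqnorm x + 1)) - 1 = - 2 * sqnorm x / (sqnorm x + 1).
    by field.
  by rewrite !mulf_neq0 ?invr_eq0 ?oppr_eq0// sqnorm_eq0.
pose x0 : 'rV[R]_n := delta_mx 0 (Ordinal n2).
have x0n : x0 != 0 by apply/rV0Pn; exists (Ordinal n2); rewrite mxE !eqxx oner_eq0.
apply: (@frame_glue _ _ _ _ fS (U 1) (U (-1)) Phi1 Phi2 (pi 1 x0)) => //.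
- move=> p; have [Up|/negP/negPn/eqP Up] := pselect (U 1 p); first by left.
  right; rewrite /U /=; move: Up; rewrite mul1r => ->.
  by rewrite mulr1 lt_eqF// (lt_trans _ ltr01)// oppr_lt0.
- rewrite E; apply: connected_continuous_connected.
    exact: punctured_connected.
  by apply: continuous_subspaceT; exact: pic.
- by rewrite E; exists x0.
Qed.

(** * Solutions on a manifold *)

Section ManifoldTopology.
Variables (R : realType) (n : nat) (M : manifold R n).
Local Notation E := 'rV[R]_n.
Implicit Types (i j : chart M) (p : M).

Lemma near_dom i p : dom i p -> \forall q \near p, dom i q.
Proof. by move=> dp; exact: (open_nbhs_nbhs (conj (dom_open i) dp)). Qed.

Lemma near_coord i p (P : E -> Prop) : dom i p -> (\forall x \near coord i p, P x) ->
  \forall q \near p, dom i q /\ P (coord i q).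
Proof.
move=> dp nP; apply: filterI; first exact: near_dom.
exact: (coord_continuous dp nP).
Qed.

Lemma near_param i x (P : M -> Prop) : cod i x -> (\forall q \near param i x, P q) ->
  \forall y \near x, cod i y /\ P (param i y).
Proof.
move=> cx nP; apply: filterI.
  by apply: open_nbhs_nbhs; split; [exact: cod_open|exact: cx].
exact: (param_continuous cx nP).
Qed.

Lemma open_cod_preimage i (A : set M) : (forall p, A p -> nbhs p A) ->
  open (cod i `&` param i @^-1` A).
Proof.
move=> oA; apply: open_nbhsP => x [cx Ax].
by have := near_param cx (oA _ Ax); apply: filterS => y [].
Qed.

Lemma overlap_open i j : open (overlap i j).
Proof. by apply: open_cod_preimage => p; exact: near_dom. Qed.

Lemma overlap_transition i j x : overlap i j x ->
  [/\ cod j (transition i j x), overlap j i (transition i j x) &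
      param j (transition i j x) = param i x].
Proof.
move=> [cx dx]; have E1 : param j (coord j (param i x)) = param i x by exact: coordK.
split => //; first exact: coord_cod.
split; first exact: coord_cod.
by rewrite /= /transition /= E1; exact: param_dom.
Qed.

Lemma transitionK i j x : overlap i j x -> transition j i (transition i j x) = x.
Proof.
move=> ox; have [_ _ E1] := overlap_transition ox.
by rewrite {1}/transition /= E1; apply: paramK; case: ox.
Qed.

Lemma transition_Ck i j k : Ck k (overlap i j) (transition i j).
Proof. exact: transition_smooth. Qed.

Lemma transition_derive_inj i j x u : overlap i j x ->
  'D_u (transition i j) x = 0 -> u = 0.
Proof.
move=> ox Du0; have [_ oy _] := overlap_transition ox.
have dt := derivableP (Ck_derivable (v := u) (transition_Ck i j 1) ox).
have ds := Ck1_differentiable (@mean_value_mx R 1 n) (@overlap_open j i)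
  (transition_Ck j i 1) oy.
have [_ dsE] := is_derive_chain ds dt.
have : 'D_u (transition j i \o transition i j) x = 'D_u id x.
  apply: near_eq_derive; apply: filterS (open_nbhs_nbhs (conj (@overlap_open i j) ox)).
  by move=> y; exact: transitionK.
by rewrite dsE Du0 linear0 derive_id.
Qed.

End ManifoldTopology.

Section ManifoldSolutions.
Variables (R : realType) (n : nat) (M : manifold R n) (N : connection M).
Local Notation E := 'rV[R]_n.
Local Notation T := 'rV[R]_(1 + n).
Implicit Types (i j : chart M) (p : M) (F G : M -> T).

Definition is_sol F p := exists i W, [/\ dom i p, W (coord i p), W `<=` cod i &
  solution (N i) W (F \o param i)].

Lemma is_sol_chart F p j : is_sol F p -> dom j p ->
  exists W, [/\ W (coord j p), W `<=` cod j & solution (N j) W (F \o param j)].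
Proof.
move=> [i [W [dip Wp Wi sF]]] djp; have [oW CF uF hF] := sF.
pose A := [set q : M | dom i q /\ W (coord i q)].
have oA q : A q -> nbhs q A.
  move=> [dq Wq]; have := near_coord dq (open_nbhs_nbhs (conj oW Wq)).
  by apply: filterS => r [].
pose O := cod j `&` param j @^-1` A.
have oO : open O by exact: open_cod_preimage.
have OO : O `<=` overlap j i by move=> x [cx [dx _]].
have Op : O (coord j p).
  by split; [exact: coord_cod|rewrite /= coordK].
exists O; split => //; first by move=> x [].
have sO : solution (N j) O ((F \o param i) \o transition j i).
  apply: (solution_comp (Gam' := N i) oO _ _ _ _ sF).
  - by move=> k; apply: Ck_sub OO _; exact: transition_Ck.
  - by move=> x u /OO; exact: transition_derive_inj.
  - by move=> x u v /OO; exact: christoffel_transition.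
  - by move=> x [_ []].
apply: solution_eq sO => x /OO [_ dx] /=.
by rewrite /transition /= coordK.
Qed.

Lemma is_sol_open F p : is_sol F p -> \forall q \near p, is_sol F q.
Proof.
move=> [i [W [dip Wp Wi sF]]]; have [oW _ _ _] := sF.
have := near_coord dip (open_nbhs_nbhs (conj oW Wp)).
by apply: filterS => q [dq Wq]; exists i, W.
Qed.

Lemma is_sol_germ F G p : (\forall q \near p, F q = G q) -> is_sol F p -> is_sol G p.
Proof.
move=> FG [i [W [dip Wp Wi sF]]]; have [oW _ _ _] := sF.
pose A : set M := [set q : M | \forall r \near (q : M), F r = G r].
have oA q : A q -> nbhs q A by exact: nbhs_interior.
pose W' := W `&` (cod i `&` param i @^-1` A).
have oW' : open W' by apply: openI => //; exact: open_cod_preimage.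
have W'W : W' `<=` W by move=> x [].
exists i, W'; split => //.
- by split => //; split; [exact: coord_cod|rewrite /= coordK].
- by move=> x /W'W/Wi.
apply: solution_eq (solution_sub oW' W'W sF) => x [_ [_ Ax]].
exact: (nbhs_singleton Ax).
Qed.

Definition locally_flat_tractor := forall p, exists i V h,
  [/\ dom i p, V (coord i p), V `<=` cod i & flat_tractor V (N i) h].

Hypotheses (n2 : (2 <= n)%N) (lf : locally_flat_tractor).

Lemma is_sol_frame_system : frame_system is_sol.
Proof.
split.
- exact: is_sol_open.
- exact: is_sol_germ.
- move=> p; have [i [V [h [dip Vp Vi ft]]]] := lf p.
  have [F [W [Wp WV sF]]] := solution_exists ft Vp.
  have Wi : W `<=` cod i := subset_trans WV Vi.
  exists (F \o coord i), i, W; split => //.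
  apply: solution_eq sF => x /Wi cx /=.
  by rewrite paramK.
- move=> F G p sF sG; have [i [V [h [dip Vp Vi ft]]]] := lf p.
  have [W1 [W1p W1i s1]] := is_sol_chart sF dip.
  have [W2 [W2p W2i s2]] := is_sol_chart sG dip.
  have [oW1 _ _ _] := s1; have [oW2 _ _ _] := s2.
  pose W := V `&` (W1 `&` W2).
  have oW : open W by apply: openI; [exact: ft_open ft|exact: openI].
  have Wp : W (coord i p) by [].
  have [A HA] := solution_unique (W := W) n2 ft (fun x Wx => Wx.1)
    (solution_sub oW (fun x Wx => Wx.2.1) s1) (solution_sub oW (fun x Wx => Wx.2.2) s2) Wp.
  exists A; have := near_coord dip HA; apply: filterS => q [dq] /=.
  by rewrite coordK.
- move=> F A p uA [i [W [dip Wp Wi sF]]]; exists i, W; split => //.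
  exact: solution_mulmx sF.
- move=> F A B p [i [W [dip Wp Wi sF]]] AB.
  have cp := coord_cod dip.
  apply: (solution_mulmx_eq sF Wp).
  have AB' : \forall q \near param i (coord i p), F q *m A = F q *m B by rewrite coordK.
  have := near_param cp AB'; apply: filterS => x [_].
  exact.
Qed.

Theorem global_solution : diffeomorphic_to_sphere M -> exists F, forall p, is_sol F p.
Proof.
move=> [F [G [FS GK FK Fsm Gsm]]].
apply: (sphere_frame_section n2 _ FS GK FK _ is_sol_frame_system).
- move=> p; have [i dip] := charts_cover p.
  have cp := coord_cod dip.
  have Fc := Ck_continuous (Fsm i 0) cp.
  have H : ((F \o param i) \o coord i) @ p --> F p.
    have := @continuous_comp _ _ _ (coord i) (F \o param i) p (coord_continuous dip) Fc.
    by rewrite /prop_for /continuous_at /= coordK.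
  apply: cvg_trans H; apply: near_eq_cvg.
  by apply: filterS (near_dom dip) => q dq /=; rewrite coordK.
- move=> phi phic phiS x.
  have [U [H [oU Uy [Hc _] HG]]] := Gsm _ (phiS x).
  have HGx : (G \o phi) x = H (phi x) by rewrite /= HG.
  have K : (H \o phi) @ x --> (G \o phi) x.
    have := @continuous_comp _ _ _ phi H x (phic x) (Hc _ Uy).
    by rewrite /prop_for /continuous_at HGx.
  have Ux : nbhs x (phi @^-1` U) by apply: phic; exact: open_nbhs_nbhs.
  move=> B /K HB; have {}HB : nbhs x ((H \o phi) @^-1` B) by [].
  have : nbhs x ((G \o phi) @^-1` B).
    by apply: filterS2 Ux HB => y Uphi; rewrite /= HG.
  by [].
Qed.

End ManifoldSolutions.

(** * The geodesic equation in a chart *)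

Section PhaseSpace.
Variables (R : realType) (n : nat).
Local Notation E := 'rV[R]_n.
Local Notation e_ k := (delta_mx 0 k : E).

Lemma norm_row_mx_le (a b : E) (c : R) : `|a| <= c -> `|b| <= c -> `|row_mx a b| <= c.
Proof.
move=> ac bc; apply: mx_norm_bound => [|i j]; first exact: le_trans (normr_ge0 _) ac.
rewrite mxE; case: (fintype.split j) => k.
  exact: le_trans (normr_coord_le a i k) ac.
exact: le_trans (normr_coord_le b i k) bc.
Qed.

Lemma norm_lsubmx_le (z : 'rV[R]_(n + n)) : `|lsubmx z| <= `|z|.
Proof. by apply: mx_norm_bound => // i j; rewrite mxE normr_coord_le. Qed.

Lemma norm_rsubmx_le (z : 'rV[R]_(n + n)) : `|rsubmx z| <= `|z|.
Proof. by apply: mx_norm_bound => // i j; rewrite mxE normr_coord_le. Qed.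

Lemma is_derive_row_mx (y v : R -> E) (a b : E) (t : R) :
  is_derive t 1 y a -> is_derive t 1 v b ->
  is_derive t 1 (fun s => row_mx (y s) (v s)) (row_mx a b).
Proof.
move=> /is_derive_mxP dy /is_derive_mxP dv; apply/is_derive_mxP => i j.
rewrite [X in is_derive _ _ _ X]mxE.
have -> : (fun s => row_mx (y s) (v s) i j : R^o) =
    match fintype.split j with inl k => fun s => y s i k | inr k => fun s => v s i k end.
  by apply/funext => s; rewrite mxE; case: fintype.split.
by case: (fintype.split j) => k; [exact: dy|exact: dv].
Qed.

Lemma is_derive_submx (z : R -> 'rV[R]_(n + n)) (a b : E) (t : R) :
  is_derive t 1 z (row_mx a b) ->
  is_derive t 1 (fun s => lsubmx (z s)) a /\ is_derive t 1 (fun s => rsubmx (z s)) b.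
Proof.
move=> /is_derive_mxP dz; split; apply/is_derive_mxP => i j.
  have := dz i (lshift n j); rewrite row_mxEl; congr (is_derive _ _ _ _).
  by apply/funext => s; rewrite mxE.
have := dz i (rshift n j); rewrite row_mxEr; congr (is_derive _ _ _ _).
by apply/funext => s; rewrite mxE.
Qed.

(** Truncation to a cube turns local estimates for the Christoffel symbols
    into global ones. *)
Definition vclamp (a : E) (T : R) (z : E) : E := \row_k (a 0 k + clamp T (z 0 k - a 0 k)).

Lemma vclamp_norm a T z : 0 <= T -> `|vclamp a T z - a| <= T.
Proof.
move=> T0; apply: mx_norm_bound => // i k; rewrite (ord1 i) !mxE addrAC subrr add0r.
exact: clamp_norm.
Qed.

Lemma vclamp_id a T z : `|z - a| <= T -> vclamp a T z = z.
Proof.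
move=> zT; apply/rowP => k; rewrite mxE clamp_id; first by rewrite addrC subrK.
by apply: le_trans zT; have := normr_coord_le (z - a) 0 k; rewrite !mxE.
Qed.

Lemma vclamp_dist a T z w : 0 <= T -> `|vclamp a T z - vclamp a T w| <= `|z - w|.
Proof.
move=> T0; apply: mx_norm_bound => // i k; rewrite (ord1 i) !mxE.
have -> : a 0 k + clamp T (z 0 k - a 0 k) - (a 0 k + clamp T (w 0 k - a 0 k)) =
  clamp T (z 0 k - a 0 k) - clamp T (w 0 k - a 0 k) by ring.
apply: le_trans (clamp_dist _ _ T0) _.
have -> : z 0 k - a 0 k - (w 0 k - a 0 k) = (z - w) 0 k by rewrite !mxE; ring.
exact: normr_coord_le.
Qed.

End PhaseSpace.

Section GeodesicField.
Variables (R : realType) (n : nat).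
Local Notation E := 'rV[R]_n.
Local Notation e_ k := (delta_mx 0 k : E).
Variables (V : set E) (Gam : E -> E -> E -> E).
Hypothesis oV : open V.
Hypothesis bG : forall x, V x -> bilin (Gam x).
Hypothesis sG : forall u v, smooth_on V (fun x => Gam x u v).

Lemma ler_double_sum (C : 'I_n -> 'I_n -> R) k l : (forall i j, 0 <= C i j) ->
  C k l <= \sum_i \sum_j C i j.
Proof.
move=> C0; apply: (@le_trans _ _ (\sum_j C k j)).
  by rewrite (bigD1 l)//= lerDl sumr_ge0.
rewrite [leRHS](bigD1 k)//= lerDl sumr_ge0// => i _.
by rewrite sumr_ge0.
Qed.

Lemma christoffel_bounds x0 : V x0 ->
  exists2 C, 0 <= C & \forall r \near (0 : R)^'+, ball x0 r `<=` V /\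
  forall y z a b, ball x0 r y -> ball x0 r z ->
  `|Gam y a b| <= C * `|a| * `|b| /\
  `|Gam y a b - Gam z a b| <= C * `|y - z| * `|a| * `|b|.
Proof.
move=> Vx0.
have H k l := local_taylor (@mean_value_mx R 1 n) oV Vx0 (sG (e_ k) (e_ l) 2).
pose C k l := s2val (cid2 (H k l)).
have C0 k l : 0 <= C k l by exact: (s2valP (cid2 (H k l))).
have HC k l := s2valP' (cid2 (H k l)); rewrite -/(C _ _) in HC.
have [S [S0 CS]] : exists S, 0 <= S /\ forall k l, C k l <= S.
  exists (\sum_k \sum_l C k l); split; last by move=> k l; exact: ler_double_sum.
  by apply: sumr_ge0 => k _; exact: sumr_ge0.
exists (n%:R * (n%:R * S)); first by rewrite !mulr_ge0.
have {}HC : \forall r \near (0 : R)^'+, forall k l, ball x0 r `<=` V /\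
    forall y h, ball x0 r y -> ball x0 r (h + y) ->
    [/\ `|Gam y (e_ k) (e_ l)| <= C k l,
        `|Gam (h + y) (e_ k) (e_ l) - Gam y (e_ k) (e_ l)| <= C k l * `|h| &
        `|Gam (h + y) (e_ k) (e_ l) - Gam y (e_ k) (e_ l) -
          'D_h (fun z => Gam z (e_ k) (e_ l)) y| <= C k l * `|h| ^+ 2].
  by apply: filter_forall => k; apply: filter_forall => l; exact: HC.
have HV : \forall r \near (0 : R)^'+, ball x0 r `<=` V.
  have /nbhs_ballP[r /= r0 rV] : nbhs x0 V by exact: open_nbhs_nbhs.
  near=> s; apply: subset_trans rV; apply: le_ball.
  by near: s; exact: nbhs_right_le.
apply: filterS (filterI HC HV) => r [{}HC rV].
split=> // y z a b yr zr; have Vy := rV _ yr; have Vz := rV _ zr.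
have expand x (Vx : V x) : Gam x a b =
   row_comb (fun k => row_comb (fun l => Gam x (e_ k) (e_ l)) b) a.
  rewrite (bilin_row_combl (bG Vx)); apply: eq_bigr => k _.
  by rewrite (bilin_row_combr (bG Vx)).
have rcB (d1 d2 : 'I_n -> E) (v : E) : row_comb d1 v - row_comb d2 v =
    row_comb (fun k => d1 k - d2 k) v.
  by rewrite /row_comb -sumrB; apply: eq_bigr => k _; rewrite scalerBr.
split.
  rewrite (expand _ Vy).
  rewrite [leRHS](_ : _ = n%:R * (n%:R * S * `|b|) * `|a|); last by ring.
  apply: norm_row_comb_le => k; apply: norm_row_comb_le => l.
  have [_ /(_ y 0 yr)] := HC k l; rewrite add0r => /(_ yr)[+ _ _].
  by move=> /le_trans; apply.
rewrite (expand _ Vy) (expand _ Vz) rcB.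
rewrite [leRHS](_ : _ = n%:R * (n%:R * (S * `|y - z|) * `|b|) * `|a|); last by ring.
apply: norm_row_comb_le => k; rewrite rcB; apply: norm_row_comb_le => l.
have [_ /(_ z (y - z) zr)] := HC k l; rewrite subrK => /(_ yr)[_ + _].
by move=> /le_trans; apply; rewrite ler_wpM2r.
Unshelve. all: by end_near. Qed.

(** Bounded velocities are required: the acceleration is quadratic in them. *)
Lemma acceleration_lipschitz (C K : R) (y z a b : E) : 0 <= C -> 0 <= K ->
  V y -> V z -> `|a| <= K -> `|b| <= K ->
  (forall x u v, x = y \/ x = z -> `|Gam x u v| <= C * `|u| * `|v|) ->
  (forall u v, `|Gam y u v - Gam z u v| <= C * `|y - z| * `|u| * `|v|) ->
  `|Gam y a a - Gam z b b| <= C * K ^+ 2 * `|y - z| + 2 * C * K * `|a - b|.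
Proof.
move=> C0 K0 Vy Vz aK bK Gb Gl.
have N u v : - Gam z u v = Gam z (- u) v.
  by rewrite -[- u]scaleN1r (bilinZl (bG Vz)) scaleN1r.
have N' u v : - Gam z u v = Gam z u (- v).
  by rewrite -[- v]scaleN1r (bilinZr (bG Vz)) scaleN1r.
have -> : Gam y a a - Gam z b b =
   (Gam y a a - Gam z a a) + (Gam z (a - b) a + Gam z b (a - b)).
  rewrite (bilinDl (bG Vz)) (bilinDr (bG Vz)) -N -N'.
  by rewrite !addrA !subrK.
rewrite (le_trans (ler_normD _ _))// lerD//.
  rewrite (le_trans (Gl _ _))// -!mulrA ler_wpM2l// mulrC.
  by rewrite mulrA ler_wpM2r// ler_pM.
rewrite (le_trans (ler_normD _ _))//.
have h1 : `|Gam z (a - b) a| <= C * K * `|a - b|.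
  rewrite (le_trans (Gb z _ _ (or_intror erefl)))// mulrAC.
  by rewrite ler_wpM2r// ler_wpM2l.
have h2 : `|Gam z b (a - b)| <= C * K * `|a - b|.
  rewrite (le_trans (Gb z _ _ (or_intror erefl)))//.
  by rewrite ler_wpM2r// ler_wpM2l.
apply: le_trans (lerD h1 h2) _.
by rewrite [leLHS](_ : _ = 2 * C * K * `|a - b|)//; ring.
Qed.

(** The survival time depends only on the bound [K] for the initial velocity.
    With truncated position and velocity the geodesic field is bounded and
    globally Lipschitz, and for a short time the truncations are not felt. *)
Lemma geodesic_flow_local x0 K : V x0 -> 0 <= K ->
  exists rho T : R, [/\ 0 < rho, 0 < T & forall y0 v0, `|y0 - x0| < rho -> `|v0| <= K ->
    exists y v : R -> E, [/\ y 0 = y0, v 0 = v0 & forall t : R, `|t| < T ->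
      [/\ V (y t), is_derive t 1 y (v t) & is_derive t 1 v (- Gam (y t) (v t) (v t))]]].
Proof.
move=> Vx0 K0; have [C C0 HC] := christoffel_bounds Vx0.
have [r [r0 [rV HB]]] := filter_ex (filterI (nbhs_right_gt (0 : R)) HC).
pose rho := r / 4; have rho0 : 0 < rho by rewrite divr_gt0.
pose K1 := K + 1.
have K10 : 0 <= K1 by rewrite addr_ge0.
pose Q y := vclamp x0 (2 * rho) y.
pose P (v : E) := vclamp 0 K1 v.
have rho20 : 0 <= 2 * rho by rewrite mulr_ge0// ltW.
have Qb y : ball x0 r (Q y).
  rewrite -ball_normE /= distrC (le_lt_trans (vclamp_norm _ _ rho20))//.
  by rewrite /rho; lra.
have Pb v : `|P v| <= K1 by have := vclamp_norm 0 v K10; rewrite subr0.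
pose X (t : R) (z : 'rV[R]_(n + n)) : 'rV[R]_(n + n) :=
  row_mx (P (rsubmx z)) (- Gam (Q (lsubmx z)) (P (rsubmx z)) (P (rsubmx z))).
pose L := 1 + C * K1 ^+ 2 + 2 * C * K1.
have L1 : 1 <= L by rewrite /L -addrA lerDl addr_ge0// !mulr_ge0// exprn_ge0.
have L0 : 0 < L by rewrite (lt_le_trans ltr01).
have XL t z w : `|X t z - X t w| <= L * `|z - w|.
  rewrite /X opp_row_mx add_row_mx.
  have dl : `|lsubmx z - lsubmx w| <= `|z - w| by rewrite -linearB norm_lsubmx_le.
  have dr : `|rsubmx z - rsubmx w| <= `|z - w| by rewrite -linearB norm_rsubmx_le.
  have dQ : `|Q (lsubmx z) - Q (lsubmx w)| <= `|z - w|.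
    exact: le_trans (vclamp_dist _ _ _ rho20) dl.
  have dP : `|P (rsubmx z) - P (rsubmx w)| <= `|z - w|.
    exact: le_trans (vclamp_dist _ _ _ K10) dr.
  apply: norm_row_mx_le; first by rewrite (le_trans dP)// ler_peMl.
  rewrite opprK addrC distrC.
  have [_ Gl] := HB (Q (lsubmx z)) (Q (lsubmx w)) 0 0 (Qb _) (Qb _).
  have := @acceleration_lipschitz C K1 (Q (lsubmx z)) (Q (lsubmx w))
    (P (rsubmx z)) (P (rsubmx w)) C0 K10 (rV _ (Qb _)) (rV _ (Qb _)) (Pb _) (Pb _).
  move=> /(_ _ _)/le_trans; apply.
  - move=> x u v [->|->].
      by have [] := HB (Q (lsubmx z)) (Q (lsubmx z)) u v (Qb _) (Qb _).
    by have [] := HB (Q (lsubmx w)) (Q (lsubmx w)) u v (Qb _) (Qb _).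
  - by move=> u v; have [] := HB (Q (lsubmx z)) (Q (lsubmx w)) u v (Qb _) (Qb _).
  - rewrite /L -addrA [leRHS]mulrDl mul1r [leRHS]addrC ler_wpDr// [leRHS]mulrDl lerD//.
      by rewrite ler_wpM2l// mulr_ge0// exprn_ge0.
    by rewrite ler_wpM2l// !mulr_ge0.
pose T0 := 2^-1 / L; have T00 : 0 < T0 by rewrite divr_gt0// invr_gt0.
pose Bd := K1 + C * K1 * K1.
have Bd0 : 0 <= Bd by rewrite addr_ge0// !mulr_ge0.
have Xb t z : `|X t z| <= Bd.
  apply: norm_row_mx_le.
    by rewrite (le_trans (Pb _))// /Bd lerDl !mulr_ge0.
  rewrite normrN; have [H _] := HB (Q (lsubmx z)) (Q (lsubmx z)) (P (rsubmx z)) (P (rsubmx z)) (Qb _) (Qb _).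
  rewrite (le_trans H)// /Bd ler_wpDl// ler_pM// ?mulr_ge0//.
  by rewrite ler_wpM2l.
pose T := Num.min T0 (Num.min rho 1 / (Bd + 1)).
have T_0 : 0 < T by rewrite lt_min T00 divr_gt0 ?lt_min ?rho0 ?ltr01// ltr_wpDl.
exists rho, T; split=> // y0 v0 y0r v0K.
have [|||z [zc z0 dz]] := @picard R 1 (n + n) X L T0 (row_mx y0 v0) T00.
- by rewrite /T0 mulrC mul1r divfK// gt_eqF.
- move=> z zc t; apply/cvgrPdist_le => e e0.
  have eL : 0 < e / L by rewrite divr_gt0.
  have /cvgrPdist_le/(_ _ eL) := zc t; apply: filterS => s zs.
  have -> : X s (z s) = X t (z s) by [].
  by rewrite (le_trans (XL _ _ _))// mulrC -ler_pdivlMr.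
- exact: XL.
exists (fun t => lsubmx (z t)), (fun t => rsubmx (z t)); split.
- by rewrite z0 row_mxKl.
- by rewrite z0 row_mxKr.
move=> t tT.
have tT0 : `|t| < T0 by rewrite (lt_le_trans tT)// ge_min lexx.
have drift : `|z t - z 0| <= Bd * `|t|.
  have := @segment_increment R _ _ (@mean_value_mx R 1 (n + n)) z (fun t => X t (z t)) 0 1 t Bd.
  rewrite [_ *: 1]mulr1 addr0; apply.
    move=> s st; rewrite [_ *: 1]mulr1 addr0; apply: dz.
    exact: le_lt_trans st tT0.
  by move=> s _; exact: Xb.
have small : `|z t - z 0| <= Num.min rho 1.
  apply: (le_trans drift); apply: (@le_trans _ _ ((Bd + 1) * T)).
    by apply: ler_pM => //; [rewrite lerDl|exact: ltW].
  by rewrite mulrC -ler_pdivlMr ?ltr_wpDl// ge_min lexx orbT.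
have yt : `|lsubmx (z t) - y0| <= rho.
  have -> : lsubmx (z t) - y0 = lsubmx (z t - z 0) by rewrite linearB/= z0 row_mxKl.
  by rewrite (le_trans (norm_lsubmx_le _))// (le_trans small)// ge_min lexx.
have vt : `|rsubmx (z t) - v0| <= 1.
  have -> : rsubmx (z t) - v0 = rsubmx (z t - z 0) by rewrite linearB/= z0 row_mxKr.
  by rewrite (le_trans (norm_rsubmx_le _))// (le_trans small)// ge_min lexx orbT.
have Qid : Q (lsubmx (z t)) = lsubmx (z t).
  apply: vclamp_id; rewrite -(subrKA y0) (le_trans (ler_normD _ _))//.
  by have := ltW y0r; lra.
have Pid : P (rsubmx (z t)) = rsubmx (z t).
  apply: vclamp_id; rewrite subr0 -[X in `|X|](subrK v0) (le_trans (ler_normD _ _))//.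
  by rewrite /K1; lra.
split; first by rewrite -Qid; exact: rV.
  have := dz t tT0; rewrite /X Qid Pid => /is_derive_submx[+ _].
  exact.
have := dz t tT0; rewrite /X Qid Pid => /is_derive_submx[_].
exact.
Qed.

(** The difference of the two curves in phase space satisfies the hypothesis
    of [short_gronwall] with [e = 0]. *)
Lemma geodesic_ode_unique (c1 v1 c2 v2 : R -> E) (t : R) :
  V (c1 t) -> c1 t = c2 t -> v1 t = v2 t ->
  (\forall s \near t, is_derive (s : R) 1 c1 (v1 s) /\
     is_derive (s : R) 1 v1 (- Gam (c1 s) (v1 s) (v1 s))) ->
  (\forall s \near t, is_derive (s : R) 1 c2 (v2 s) /\
     is_derive (s : R) 1 v2 (- Gam (c2 s) (v2 s) (v2 s))) ->
  \forall s \near t, c1 s = c2 s /\ v1 s = v2 s.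
Proof.
move=> Vt c12 v12 d1 d2; have [C C0 HC] := christoffel_bounds Vt.
have [r [r0 [rV HB]]] := filter_ex (filterI (nbhs_right_gt (0 : R)) HC).
pose K := `|v1 t| + 1; have K0 : 0 <= K by rewrite addr_ge0.
have cont (f : R -> E) (a : E) : is_derive t 1 f a -> {for t, continuous f}.
  by move=> [/derivable1_diffP/differentiable_continuous].
have nearball (c : R -> E) : c t = c1 t -> {for t, continuous c} ->
    \forall s \near t, ball (c1 t) r (c s).
  move=> ct cc; have /cvgrPdist_lt/(_ _ r0) := cc; apply: filterS => s.
  by rewrite ct -ball_normE.
have nearK (v : R -> E) : v t = v1 t -> {for t, continuous v} ->
    \forall s \near t, `|v s| <= K.
  move=> vt vc; have /cvgrPdist_le/(_ _ ltr01) := vc; apply: filterS => s vs.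
  rewrite -[X in `|X|](subrK (v t)) (le_trans (ler_normD _ _))// /K vt addrC lerD2l.
  by rewrite distrC -vt.
have [dc1 dv1] := nbhs_singleton d1; have [dc2 dv2] := nbhs_singleton d2.
have b1 := nearball _ erefl (cont _ _ dc1).
have b2 := nearball _ (esym c12) (cont _ _ dc2).
have k1 := nearK _ erefl (cont _ _ dv1).
have k2 := nearK _ (esym v12) (cont _ _ dv2).
have /nbhs_ballP[e /= e0 He] : nbhs t [set s : R |
    ((is_derive (s : R) 1 c1 (v1 s) /\ is_derive (s : R) 1 v1 (- Gam (c1 s) (v1 s) (v1 s))) /\
     (is_derive (s : R) 1 c2 (v2 s) /\ is_derive (s : R) 1 v2 (- Gam (c2 s) (v2 s) (v2 s)))) /\
    ((ball (c1 t) r (c1 s) /\ ball (c1 t) r (c2 s)) /\ (`|v1 s| <= K /\ `|v2 s| <= K))].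
  exact: filterI (filterI d1 d2) (filterI (filterI b1 b2) (filterI k1 k2)).
pose L := 1 + C * K ^+ 2 + 2 * C * K.
have L1 : 1 <= L by rewrite /L -addrA lerDl addr_ge0// !mulr_ge0// exprn_ge0.
have L0 : 0 < L by rewrite (lt_le_trans ltr01).
pose eta := Num.min (e / 2) (2^-1 / L).
have eta0 : 0 < eta by rewrite lt_min !divr_gt0// invr_gt0.
have inb s : `|s - t| <= eta -> ball t e s.
  move=> st; rewrite -ball_normE /= distrC (le_lt_trans st)//.
  by rewrite gt_min ltr_pdivrMr// ltr_pMr// ltr1n.
pose d s := row_mx (c1 s) (v1 s) - row_mx (c2 s) (v2 s).
pose dd s := row_mx (v1 s) (- Gam (c1 s) (v1 s) (v1 s)) -
  row_mx (v2 s) (- Gam (c2 s) (v2 s) (v2 s)).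
have dE s : d s = row_mx (c1 s - c2 s) (v1 s - v2 s).
  by rewrite /d opp_row_mx add_row_mx.
have d_c s : `|c1 s - c2 s| <= `|d s|.
  by rewrite dE -{1}(row_mxKl (c1 s - c2 s) (v1 s - v2 s)) norm_lsubmx_le.
have d_v s : `|v1 s - v2 s| <= `|d s|.
  by rewrite dE -{1}(row_mxKr (c1 s - c2 s) (v1 s - v2 s)) norm_rsubmx_le.
have d0 : d t = 0 by rewrite dE c12 v12 !subrr row_mx0.
have dd1 (s : R) : `|s - t| <= eta -> is_derive s 1 d (dd s).
  move=> /inb/He[[[h1 h2] [h3 h4]] _].
  by apply: is_deriveB; apply: is_derive_row_mx.
have Leta : L * eta <= 1 / 2.
  by rewrite mulrC -ler_pdivlMr// mul1r ge_min lexx orbT.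
have ddL (s : R) : `|s - t| <= eta -> `|dd s| <= L * `|d s| + 0.
  move=> /inb/He[_ [[h1 h2] [h3 h4]]]; rewrite addr0 /dd opp_row_mx add_row_mx.
  apply: norm_row_mx_le; first by rewrite (le_trans (d_v _))// ler_peMl.
  rewrite opprK addrC distrC.
  have := @acceleration_lipschitz C K (c1 s) (c2 s) (v1 s) (v2 s) C0 K0 (rV _ h1) (rV _ h2) h3 h4.
  move=> /(_ _ _)/le_trans; apply.
  - move=> x u w [->|->].
      by have [] := HB (c1 s) (c1 s) u w h1 h1.
    by have [] := HB (c2 s) (c2 s) u w h2 h2.
  - by move=> u w; have [] := HB (c1 s) (c2 s) u w h1 h2.
  - rewrite /L -addrA [leRHS]mulrDl mul1r [leRHS]addrC ler_wpDr// [leRHS]mulrDl lerD//.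
      by rewrite ler_wpM2l// mulr_ge0// exprn_ge0.
    by rewrite ler_wpM2l// !mulr_ge0.
have G := short_gronwall (@mean_value_mx R 1 (n + n)) (ltW eta0) (ltW L0) (lexx 0) Leta d0 dd1 ddL.
apply/nbhs_ballP; exists eta => //= s; rewrite -ball_normE /= distrC => /ltW/G.
rewrite mulr0 mul0r => ds; split; apply/eqP; rewrite -subr_eq0 -normr_le0.
  exact: le_trans (d_c s) ds.
exact: le_trans (d_v s) ds.
Qed.

End GeodesicField.

(** * Geodesics on a manifold *)

Section Geodesics.
Variables (R : realType) (n : nat) (M : manifold R n) (N : connection M).
Local Notation E := 'rV[R]_n.
Implicit Types (i j : chart M) (p : M) (gamma delta : R -> M) (I : set R).

Definition velocity i gamma : R -> E := 'D_1 (coord i \o gamma).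

(** Unlike [geodesic], this is visibly a condition on the germ of the curve at
    [t], and it refers to one chart only. *)
Definition geodesic_germ i gamma (t : R) : Prop := \forall s \near t,
  [/\ {for s, continuous gamma}, dom i (gamma s),
      is_derive (s : R) 1 (coord i \o gamma) (velocity i gamma s)
    & is_derive (s : R) 1 (velocity i gamma)
        (- N i (coord i (gamma s)) (velocity i gamma s) (velocity i gamma s))].

Lemma christoffel_bilin i : forall x, cod i x -> bilin (N i x).
Proof. by move=> x cx; have [b1 b2] := (christoffelP N i).1 x cx; split. Qed.

Lemma geodesic_geodesic_germ I gamma t i : open I -> geodesic N I gamma -> I t ->
  dom i (gamma t) -> geodesic_germ i gamma t.
Proof.
move=> oI [gc gd] It dt.
have nI : \forall s \near t, I s by exact: open_nbhs_nbhs.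
have nd : \forall s \near t, dom i (gamma s) := gc t It _ (near_dom dt).
apply: filterS2 nI nd => s Is ds; have [d1 d2 d3] := gd i s Is ds.
split; [exact: gc|exact: ds| |].
  by apply: DeriveDef; [exact: nbhs_singleton d1|].
by apply: DeriveDef; [exact: d2|apply/eqP; rewrite -addr_eq0; exact/eqP].
Qed.

Lemma geodesic_germ_eq i gamma delta t : (\forall s \near t, gamma s = delta s) ->
  geodesic_germ i gamma t -> geodesic_germ i delta t.
Proof.
move=> gd; rewrite /geodesic_germ => gg.
have gd2 := near_join gd.
have H1 (s : R) : (\forall r \near s, gamma r = delta r) ->
    \forall r \near s, (coord i \o gamma) r = (coord i \o delta) r.
  by apply: filterS => r /= ->.
have H2 (s : R) : (\forall r \near s, gamma r = delta r) ->
    velocity i gamma s = velocity i delta s.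
  by move=> /H1 H; apply: near_eq_derive.
apply: filterS2 gd2 gg => s gds [gc gdom g1 g2].
have Es := nbhs_singleton gds.
split.
- have H : gamma @ s --> delta s by rewrite -Es.
  move=> A /H sA; have {}sA : nbhs s (gamma @^-1` A) by [].
  by have : nbhs s (delta @^-1` A) by apply: filterS2 gds sA => r /= ->.
- by rewrite -Es.
- by rewrite -(H2 _ gds); apply: near_eq_is_derive g1; exact: H1.
- rewrite -(H2 _ gds) -Es; apply: near_eq_is_derive g2.
  by apply: filterS (near_join gds) => r; exact: H2.
Qed.

Lemma geodesic_germ_open i gamma t : geodesic_germ i gamma t ->
  \forall s \near t, geodesic_germ i gamma s.
Proof. exact: near_join. Qed.

(** The transformation law of Christoffel symbols is the invariance of the
    geodesic equation. *)
Lemma geodesic_germ_chart i j gamma t : geodesic_germ i gamma t -> dom j (gamma t) ->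
  geodesic_germ j gamma t.
Proof.
move=> gi djt; have [gct _ _ _] := nbhs_singleton gi.
have nj : \forall s \near t, dom j (gamma s) := gct _ (near_dom djt).
pose tr := transition i j.
have tC k : Ck k (overlap i j) tr := @transition_Ck _ _ _ i j k.
pose P (s : R) := [/\ {for s, continuous gamma}, dom i (gamma s), dom j (gamma s),
  is_derive (s : R) 1 (coord i \o gamma) (velocity i gamma s)
    & is_derive (s : R) 1 (velocity i gamma)
        (- N i (coord i (gamma s)) (velocity i gamma s) (velocity i gamma s))].
have nP : \forall s \near t, P s.
  by apply: filterS2 gi nj => s [h1 h2 h3 h4] h5; split.
have ov s : P s -> overlap i j (coord i (gamma s)).
  by move=> [_ di dj _ _]; split; [exact: coord_cod|rewrite /= coordK].
have H1 (s : R) : (\forall r \near s, P r) -> is_derive (s : R) 1 (coord j \o gamma)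
    (velocity i gamma s *m grad tr (coord i (gamma s))).
  move=> nPs; have Ps := nbhs_singleton nPs; have [_ _ _ d1 _] := Ps.
  have := is_derive_curve (F := tr) (c := coord i \o gamma) (@overlap_open _ _ _ i j) (tC 1%N) (ov _ Ps) d1.
  apply: near_eq_is_derive; apply: filterS nPs => r [_ di _ _ _] /=.
  by rewrite /tr /transition /= coordK.
have V1 (s : R) : (\forall r \near s, P r) ->
    velocity j gamma s = velocity i gamma s *m grad tr (coord i (gamma s)).
  by move=> /H1 [_].
apply: filterS (near_join nP) => s nPs; have Ps := nbhs_singleton nPs.
have [gc di dj d1 d2] := Ps.
split; [exact: gc|exact: dj|by rewrite V1//; exact: H1|].
have ovs := ov _ Ps.
have g1 v : 'D_v tr (coord i (gamma s)) = v *m grad tr (coord i (gamma s)).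
  exact: (derive_grad v (@overlap_open _ _ _ i j) (tC 1%N) ovs).
have H2 := is_derive_grad_curve (F := tr) (c := coord i \o gamma)
   (@overlap_open _ _ _ i j) (tC 2%N) ovs d1 d2.
have := christoffel_transition N (velocity i gamma s) (velocity i gamma s) ovs.
rewrite /= -/tr !g1 => E1; rewrite /= in H2.
have trE : tr (coord i (gamma s)) = coord j (gamma s).
  by rewrite /tr /transition /= coordK.
have {}H2 : is_derive s 1 (fun r => velocity i gamma r *m grad tr (coord i (gamma r)))
    (- N j (coord j (gamma s)) (velocity j gamma s) (velocity j gamma s)).
  apply: is_derive_eq H2 _; rewrite mulNmx E1 V1// trE.
  by rewrite opprD addrAC addNr add0r.
apply: near_eq_is_derive H2.
by apply: filterS (near_join nPs) => r /V1.
Qed.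

Lemma geodesic_germ_geodesic I gamma :
  (forall t, I t -> exists i, geodesic_germ i gamma t) -> geodesic N I gamma.
Proof.
move=> H; split=> [t It|i t It dt c]; have [j gj] := H t It.
  by have [] := nbhs_singleton gj.
have gi := geodesic_germ_chart gj dt.
have [_ _ _ d2] := nbhs_singleton gi.
split.
- by apply: filterS gi => s [_ _ [d1 _] _].
- by case: d2.
- by case: d2 => _; rewrite /velocity /c => ->; rewrite addNr.
Qed.

Lemma chart_curve_geodesic_germ i (y v : R -> E) t :
  (\forall s \near t, [/\ cod i (y s), is_derive (s : R) 1 y (v s)
     & is_derive (s : R) 1 v (- N i (y s) (v s) (v s))]) ->
  geodesic_germ i (param i \o y) t /\ \forall s \near t, velocity i (param i \o y) s = v s.
Proof.
move=> H.
have Y s : cod i (y s) -> (coord i \o (param i \o y)) s = y s.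
  by move=> cy /=; rewrite paramK.
have V (s : R) : (\forall r \near s, [/\ cod i (y r), is_derive (r : R) 1 y (v r)
     & is_derive (r : R) 1 v (- N i (y r) (v r) (v r))]) ->
     is_derive (s : R) 1 (coord i \o (param i \o y)) (v s).
  move=> nH; have [_ dy _] := nbhs_singleton nH.
  by apply: near_eq_is_derive dy; apply: filterS nH => r [/Y].
have V' : \forall s \near t, velocity i (param i \o y) s = v s.
  by apply: filterS (near_join H) => s /V[].
split=> //; apply: filterS2 (near_join H) (near_join V') => s nH V's.
have [cy dy dv] := nbhs_singleton nH; split.
- have yc : {for s, continuous y} by case: dy => /derivable1_diffP/differentiable_continuous.
  exact: (@continuous_comp _ _ _ y (param i) s yc (param_continuous cy)).
- exact: param_dom.
- by rewrite (nbhs_singleton V's); exact: V.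
- rewrite (nbhs_singleton V's) /= paramK//.
  apply: near_eq_is_derive dv; apply: filterS V's => r ->//.
Qed.

Lemma geodesic_germ_unique i gamma delta t :
  geodesic_germ i gamma t -> geodesic_germ i delta t -> gamma t = delta t ->
  velocity i gamma t = velocity i delta t -> \forall s \near t, gamma s = delta s.
Proof.
move=> gi di gdt vt; have [_ dt _ _] := nbhs_singleton gi.
have H1 : \forall s \near t, is_derive (s : R) 1 (coord i \o gamma) (velocity i gamma s) /\
    is_derive (s : R) 1 (velocity i gamma)
      (- N i ((coord i \o gamma) s) (velocity i gamma s) (velocity i gamma s)).
  by apply: filterS gi => s [].
have H2 : \forall s \near t, is_derive (s : R) 1 (coord i \o delta) (velocity i delta s) /\
    is_derive (s : R) 1 (velocity i delta)
      (- N i ((coord i \o delta) s) (velocity i delta s) (velocity i delta s)).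
  by apply: filterS di => s [].
have [_ sN] := christoffelP N i.
have c12 : (coord i \o gamma) t = (coord i \o delta) t by rewrite /= gdt.
have := geodesic_ode_unique (@cod_open R n M i) (christoffel_bilin (i := i)) sN (coord_cod dt)
  c12 vt H1 H2.
apply: filterS3 gi di => s [_ d1 _ _] [_ d2 _ _] [/= /(congr1 (param i))].
by rewrite !coordK.
Qed.

Lemma closure_eq_continuous (T : topologicalType) (f g : R -> T) (A : set R) (t : R) :
  hausdorff_space T -> {for t, continuous f} -> {for t, continuous g} ->
  closure A t -> (forall s, A s -> f s = g s) -> f t = g t.
Proof.
move=> hT fc gc At fg; apply: hT => B C /fc fB /gc gC.
have {}fB : nbhs t (f @^-1` B) by []; have {}gC : nbhs t (g @^-1` C) by [].
have [s [As [/= Bs Cs]]] := At _ (filterI fB gC).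
by exists (f s); split=> //; rewrite fg.
Qed.

(** The times where the germs agree form an open set, and a closed one in the
    interval: positions and velocities agree at a limit time, and then the
    equation in a chart has only one solution. *)
Lemma geodesic_unique_continuation (J : set R) gamma delta t0 : is_interval J ->
  (forall t, J t -> exists i, geodesic_germ i gamma t) ->
  (forall t, J t -> exists i, geodesic_germ i delta t) ->
  J t0 -> (\forall t \near t0, gamma t = delta t) ->
  forall t, J t -> gamma t = delta t.
Proof.
move=> /connected_intervalP cJ gJ dJ Jt0 n0.
pose A : set R := [set t : R | \forall s \near t, gamma s = delta s].
have oA : open A by rewrite openE => t; exact: near_join.
have AE t : A t -> gamma t = delta t by exact: nbhs_singleton.
have H : J `&` A = J.
  apply: cJ; first by exists t0.
    by exists A.
  exists (closure A); first exact: closed_closure.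
  apply/seteqP; split=> t [Jt At]; split=> //; first exact: subset_closure.
  have [i gi] := gJ t Jt; have [j dj] := dJ t Jt.
  have [gc di _ _] := nbhs_singleton gi; have [dc _ _ _] := nbhs_singleton dj.
  have gdt := closure_eq_continuous (@manifold_hausdorff _ _ M) gc dc At AE.
  have di' : dom i (delta t) by rewrite -gdt.
  have {dj}dgi := geodesic_germ_chart dj di'.
  apply: (geodesic_germ_unique gi dgi gdt).
  have cv (f : R -> E) (a : E) : is_derive t 1 f a -> {for t, continuous f}.
    by move=> [/derivable1_diffP/differentiable_continuous].
  have [_ _ _ /cv v1] := nbhs_singleton gi; have [_ _ _ /cv v2] := nbhs_singleton dgi.
  apply: (closure_eq_continuous _ v1 v2 At); first exact: norm_hausdorff.
  move=> s As; apply: near_eq_derive; apply: filterS As => r /=.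
  by move=> ->.
by move=> t; rewrite -H => -[_ /AE].
Qed.

End Geodesics.

(** * Completeness *)

Section VelocityBound.
Variables (R : realType).

Lemma norm_trmx_le p q (A : 'M[R]_(p, q)) : `|A^T| <= `|A|.
Proof. by apply: mx_norm_bound => // i j; rewrite mxE normr_coord_le. Qed.

Lemma congruence_expand p (S P : 'M[R]_p) :
  S = P^T *m S *m P - (S *m (P - 1%:M) + (P - 1%:M)^T *m S *m P).
Proof.
have -> : P^T = 1%:M + (P - 1%:M)^T by rewrite linearB /= trmx1 addrC subrK.
rewrite !mulmxDl mul1mx mulmxBr mulmx1.
by rewrite opprD addrACA subrr addr0 subKr.
Qed.

(** A congruence by a matrix close to the identity cannot shrink a matrix by
    more than a factor 2. *)
Lemma congruence_lower_bound p (S P : 'M[R]_p) (eps : R) : `|P - 1%:M| <= eps ->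
  eps <= 1 -> p%:R * eps <= 8^-1 -> p%:R * (p%:R * eps) <= 8^-1 ->
  `|S| <= 2 * `|P^T *m S *m P|.
Proof.
move=> Pe e1 pe ppe.
have e0 : 0 <= eps := le_trans (normr_ge0 _) Pe.
have P2 : `|P| <= 2.
  rewrite -(subrK 1%:M P) (le_trans (ler_normD _ _))//.
  by have := @norm_mx1_le R p; have := Pe; lra.
have h1 : `|S *m (P - 1%:M)| <= 8^-1 * `|S|.
  rewrite (le_trans (normr_mulmx_le _ _))//.
  apply: le_trans (ler_wpM2r (normr_ge0 S) pe); rewrite mulrAC.
  by rewrite ler_wpM2r// ler_wpM2l.
have h2 : `|(P - 1%:M)^T *m S *m P| <= 4^-1 * `|S|.
  rewrite (le_trans (normr_mulmx_le _ _))//.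
  apply: (@le_trans _ _ (p%:R * (p%:R * eps * `|S|) * 2)).
    apply: ler_pM => //.
    rewrite ler_wpM2l// (le_trans (normr_mulmx_le _ _))// ler_wpM2r// ler_wpM2l//.
    exact: le_trans (norm_trmx_le _) Pe.
  have -> : p%:R * (p%:R * eps * `|S|) * 2 = (p%:R * (p%:R * eps)) * (`|S| * 2) by ring.
  have -> : 4^-1 * `|S| = 8^-1 * (`|S| * 2) by field.
  by rewrite ler_wpM2r// mulr_ge0.
have := congruence_expand S P => /(congr1 (fun A => `|A|)) H.
have := ler_normB (P^T *m S *m P) (S *m (P - 1%:M) + (P - 1%:M)^T *m S *m P).
rewrite -H; have := ler_normD (S *m (P - 1%:M)) ((P - 1%:M)^T *m S *m P).
have := normr_ge0 S; lra.
Qed.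

Variable n : nat.
Local Notation E := 'rV[R]_n.
Local Notation e_ k := (delta_mx 0 k : E).

Lemma jet_Ck k W (F : E -> 'rV[R]_(1 + n)) : open W -> Ck k.+1 W F -> Ck k W (jet F).
Proof.
move=> oW CF; apply/Ck_mxP => // i j.
have -> : (fun x => jet F x i j : R^o) =
    match fintype.split i with inl _ => fun x => F x 0 j
    | inr l => fun x => 'D_(e_ l) F x 0 j end.
  by apply/funext => x; rewrite mxE; case: fintype.split => l; rewrite ?(ord1 l)// mxE.
case: fintype.split => l.
  have /Ck_mxP := Ck_le (leqnSn k) CF; exact.
have /Ck_mxP := Ck_derive (e_ l) CF; exact.
Qed.

(** The wedge of a point of the immersion with a tangent vector controls the
    tangent vector: transformed by the inverse of the jet, it becomes the
    wedge of the first basis vector with the coordinates of the tangent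
    vector. *)
Lemma velocity_bound Gam W (F : E -> 'rV[R]_(1 + n)) x0 : solution Gam W F -> W x0 ->
  exists2 K, 0 <= K & \forall x \near x0, forall u : E,
    `|u| <= K * `|(F x)^T *m (u *m grad F x) - (u *m grad F x)^T *m F x|.
Proof.
move=> [oW CF uF _] Wx0; pose B := invmx (jet F x0).
pose N : R := (1 + n)%:R; have N1 : 1 <= N by rewrite ler1n.
have N0 : 0 < N by rewrite (lt_le_trans ltr01).
pose eps := 8^-1 / (N * N).
have eps0 : 0 < eps by rewrite divr_gt0 ?mulr_gt0// invr_gt0.
have e1 : N * (N * eps) <= 8^-1.
  by rewrite mulrA /eps mulrCA divff ?mulr1// gt_eqF// mulr_gt0.
have e2 : N * eps <= 8^-1.
  by rewrite (le_trans _ e1)// ler_peMl// mulr_ge0// ltW.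
have e3 : eps <= 1.
  have : eps <= N * eps by rewrite ler_peMl// ltW.
  by move: e2; lra.
exists (2 * (N * (N * `|B|)) * `|B|); first by rewrite !mulr_ge0// ltW.
have Pc : {for x0, continuous (fun x => jet F x *m B)}.
  have CP : Ck 0 W (fun x => jet F x *m B).
    by apply: Ck_mulmx => //; [exact: jet_Ck (CF 1%N)|exact: Ck_cst].
  exact: Ck_continuous CP Wx0.
have PB : jet F x0 *m B = 1%:M by rewrite mulmxV// uF.
have Pc1 : (fun x => jet F x *m B) x @[x --> x0] --> (1%:M : 'M[R]_(1 + n)).
  by rewrite -PB; exact: Pc.
have nP : \forall x \near x0, `|1%:M - jet F x *m B| <= eps.
  by move/cvgrPdist_le: Pc1 => /(_ _ eps0).
apply: filterS nP => x xe u.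
pose e0 : 'rV[R]_(1 + n) := row_mx (1%:M : 'M[R]_1) 0.
pose U : 'rV[R]_(1 + n) := row_mx 0 u.
pose S := e0^T *m U - U^T *m e0.
have e0J : e0 *m jet F x = F x by rewrite mul_row_col mul1mx mul0mx addr0.
have UJ : U *m jet F x = u *m grad F x by rewrite mul_row_col mul0mx add0r.
set A := _ - _ ; have AE : A = (jet F x)^T *m S *m jet F x.
  rewrite /A -e0J -UJ !trmx_mul /S mulmxBr mulmxBl !mulmxA //.
have uS : `|u| <= `|S|.
  apply: mx_norm_bound => // i j; rewrite (ord1 i).
  have <- : S (lshift n 0) (rshift 1 j) = u 0 j.
    rewrite /S !mxE !big_ord1 !mxE.
    rewrite (unsplitK (inl 0)) (unsplitK (inr j)) /= !mxE eqxx mul1r.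
    by rewrite mul0r subr0.
  exact: normr_coord_le.
have xe' : `|jet F x *m B - 1%:M| <= eps by rewrite distrC.
apply: le_trans uS _.
apply: le_trans (congruence_lower_bound S xe' e3 e2 e1) _.
rewrite -[leRHS]mulrA -[leRHS]mulrA ler_wpM2l//.
have -> : (jet F x *m B)^T *m S *m (jet F x *m B) = B^T *m A *m B.
  by rewrite AE trmx_mul !mulmxA.
rewrite (le_trans (normr_mulmx_le _ _))// -/N [leRHS]mulrA [leRHS]mulrAC ler_wpM2r//.
rewrite -mulrA ler_wpM2l ?(ltW N0)//.
rewrite (le_trans (normr_mulmx_le _ _))// -/N.
by rewrite ler_wpM2r// ler_wpM2l ?(ltW N0)// norm_trmx_le.
Qed.

End VelocityBound.

Section Completeness.
Variables (R : realType) (n : nat) (M : manifold R n) (N : connection M).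
Local Notation E := 'rV[R]_n.
Local Notation T := 'rV[R]_(1 + n).
Implicit Types (i j : chart M) (p : M) (gamma delta : R -> M) (I : set R).
Variable Phi : M -> T.
Hypothesis solPhi : forall p, is_sol N Phi p.

(** Wedge product of the image of a curve under [Phi] with the derivative of
    this image. *)
Definition wronskian gamma (t : R) : 'M[R]_(1 + n) :=
  let f := Phi \o gamma in (f t)^T *m 'D_1 f t - ('D_1 f t)^T *m f t.

Lemma image_curve_derive i gamma t W : geodesic_germ N i gamma t ->
  W (coord i (gamma t)) -> solution (N i) W (Phi \o param i) ->
  is_derive t 1 (Phi \o gamma) (velocity i gamma t *m grad (Phi \o param i) (coord i (gamma t))).
Proof.
move=> gi Wt [oW CF _ _]; have [_ _ d1 _] := nbhs_singleton gi.
have := is_derive_curve (c := coord i \o gamma) oW (CF 1%N) Wt d1.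
by apply: near_eq_is_derive; apply: filterS gi => s [_ ds _ _] /=; rewrite coordK.
Qed.

Lemma curve_near i gamma t W : geodesic_germ N i gamma t -> open W ->
  W (coord i (gamma t)) -> \forall s \near t, W (coord i (gamma s)).
Proof.
move=> gi oW Wt; have [_ _ [/derivable1_diffP/differentiable_continuous cc _] _] :=
  nbhs_singleton gi.
exact: cc _ (open_nbhs_nbhs (conj oW Wt)).
Qed.

Lemma wronskian_chart i gamma t W : geodesic_germ N i gamma t ->
  W (coord i (gamma t)) -> solution (N i) W (Phi \o param i) ->
  wronskian gamma t =
  let F := Phi \o param i in let x := coord i (gamma t) in let v := velocity i gamma t in
  (F x)^T *m (v *m grad F x) - (v *m grad F x)^T *m F x.
Proof.
move=> gi Wt sW; have [_ D] := image_curve_derive gi Wt sW.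
have [_ dt _ _] := nbhs_singleton gi.
by rewrite /wronskian D /= coordK.
Qed.

Lemma is_derive_trmx (a b : nat) (f : R -> 'M[R]_(a, b)) (A : 'M[R]_(a, b)) (t : R) :
  is_derive t 1 f A -> is_derive t 1 (fun s => (f s)^T) A^T.
Proof.
move=> /is_derive_mxP df; apply/is_derive_mxP => i j; rewrite mxE.
by have := df j i; congr (is_derive _ _ _ _); apply/funext => s; rewrite mxE.
Qed.

Lemma wronskian_derive_algebra (f v : T) (c : R) :
  v^T *m v + f^T *m (c *: f) - ((c *: f)^T *m f + v^T *m v) = 0.
Proof.
have -> : (c *: f)^T = c *: f^T by rewrite linearZ.
by rewrite -scalemxAl -scalemxAr [X in _ - X]addrC subrr.
Qed.

(** Along a geodesic the image has acceleration proportional to its position. *)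
Lemma wronskian_derive i gamma t : geodesic_germ N i gamma t ->
  is_derive t 1 (wronskian gamma) 0.
Proof.
move=> gi; have [_ dt d1 d2] := nbhs_singleton gi.
have [W [Wt _ sW]] := is_sol_chart (solPhi (gamma t)) dt.
have [oW CF _ [h hF]] := sW; set F := Phi \o param i in sW CF hF.
set x := coord i (gamma t) in Wt; set v := velocity i gamma t in d1 d2.
pose phi := Phi \o gamma; pose phi' (s : R) := velocity i gamma s *m grad F (coord i (gamma s)).
have nW := curve_near gi oW Wt.
have n1 : \forall s \near t, is_derive (s : R) 1 phi (phi' s).
  apply: filterS2 nW (geodesic_germ_open gi) => s Ws gis.
  exact: (image_curve_derive gis Ws sW).
have H1 : is_derive t 1 phi (phi' t) := nbhs_singleton n1.
have H2 : is_derive t 1 phi' (- h x v v *: phi t).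
  have := is_derive_grad_curve (F := F) (c := coord i \o gamma) (v := velocity i gamma) oW (CF 2%N) Wt d1 d2.
  move=> H; apply: is_derive_eq H _; rewrite -/v /= -/x hF// mulNmx.
  rewrite -(derive_grad _ oW (CF 1%N) Wt) addrA addNr sub0r scaleNr.
  by rewrite /phi /F /= /x coordK.
have H3 := is_derive_trmx H1; have H4 := is_derive_trmx H2.
have H5 := is_deriveB (is_derive_mulmx H3 H2) (is_derive_mulmx H4 H1).
rewrite wronskian_derive_algebra in H5.
apply: near_eq_is_derive H5.
by apply: filterS n1 => s [_ D]; rewrite /wronskian -/phi D.
Qed.

Lemma wronskian_cst (I : set R) gamma s t : is_interval I ->
  (forall r, I r -> exists i, geodesic_germ N i gamma r) -> I s -> I t ->
  wronskian gamma s = wronskian gamma t.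
Proof.
move=> iI gI; wlog st : s t / s <= t.
  by move=> H Is It; have [st|/ltW ts] := leP s t; [exact: H|apply: esym; exact: H].
move=> Is It; have Ir r : s <= r <= t -> I r by exact: iI.
apply/esym/eqP; rewrite -subr_eq0 -normr_le0.
have := @mean_value_mx R (1 + n) (1 + n) (wronskian gamma) (fun=> 0) 0 s t st.
rewrite mul0r; apply.
  by move=> r /Ir/gI[i]; exact: wronskian_derive.
by move=> r _; rewrite normr0.
Qed.

(** The bound on the Wronskian bounds the velocity in a chart, and then
    [geodesic_flow_local] applies. *)
Lemma local_survival_time (w : R) p : 0 <= w ->
  \forall q \near p & tau \near (0 : R)^'+, forall gamma s, gamma s = q ->
    (exists i, geodesic_germ N i gamma s) -> `|wronskian gamma s| <= w ->
    exists delta, (forall t, `|t - s| < tau -> exists i, geodesic_germ N i delta t) /\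
      \forall t \near s, gamma t = delta t.
Proof.
move=> w0; have [i dp] := charts_cover p.
have [W [Wp Wi sW]] := is_sol_chart (solPhi p) dp.
have [oW _ _ _] := sW.
have [K K0 HK] := velocity_bound sW Wp.
have [_ sN] := christoffelP N i.
have Kw0 : 0 <= K * w by rewrite mulr_ge0.
have [rho [T0 [rho0 T00 flow]]] := geodesic_flow_local (@cod_open R n M i)
  (@christoffel_bilin _ _ _ N i) sN (coord_cod dp) Kw0.
pose good (x : E) : Prop := W x /\ (`|x - coord i p| < rho /\ forall u : E,
    `|u| <= K * `|((Phi \o param i) x)^T *m (u *m grad (Phi \o param i) x) -
      (u *m grad (Phi \o param i) x)^T *m (Phi \o param i) x|).
have nb : \forall x \near coord i p, good x.
  apply: filterI; first exact: open_nbhs_nbhs.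
  apply: filterI; last exact: HK.
  apply/nbhs_ballP; exists rho => // x; rewrite -ball_normE /= distrC.
  exact.
have nT : \forall tau \near (0 : R)^'+, tau <= T0 by exact: nbhs_right_le.
have nq := near_coord dp nb.
exists ([set q | dom i q /\ good (coord i q)], [set tau | tau <= T0]); first by split; [exact: nq|exact: nT].
move=> [q tau] /= [[dq [Wq [xq Hq]]] tauT] gamma s gsq [j gj] Ws.
have gi : geodesic_germ N i gamma s.
  by apply: (geodesic_germ_chart gj); rewrite gsq.
have vs : `|velocity i gamma s| <= K * w.
  apply: le_trans (Hq _) _; rewrite ler_wpM2l//; apply: le_trans Ws.
  rewrite (wronskian_chart gi _ sW) gsq//.
have [y [v [y0 v0 yv]]] := flow _ _ xq vs.
pose y' (t : R) := y (t - s); pose v' (t : R) := v (t - s).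
have shiftd (f : R -> E) (t : R) a : is_derive (t - s) 1 f a -> is_derive t 1 (fun r => f (r - s)) a.
  move=> H; have := @is_derive_line R _ _ f (- s) 1 t a.
  have -> : (fun r : R => f (r *: 1 + - s)) = (fun r => f (r - s)).
    by apply/funext => r; rewrite [_ *: 1]mulr1.
  by rewrite [_ *: 1]mulr1; apply.
have ode t : `|t - s| < tau -> \forall r \near t, [/\ cod i (y' r),
    is_derive (r : R) 1 y' (v' r) & is_derive (r : R) 1 v' (- N i (y' r) (v' r) (v' r))].
  move=> ts.
  have : \forall r \near t, `|r - s| < tau.
    apply/nbhs_ballP; exists (tau - `|t - s|) => /=; first by rewrite subr_gt0.
    move=> r; rewrite -ball_normE /= => tr.
    by have := ler_distD t r s; rewrite (distrC r t); lra.
  apply: filterS => r rs; have [h1 h2 h3] := yv _ (lt_le_trans rs tauT).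
  by split=> //; exact: shiftd.
have [taup|taun] := ltP 0 tau; last first.
  exists gamma; split; last by apply: filterE.
  by move=> t ts; have := normr_ge0 (t - s); lra.
exists (param i \o y'); split.
  by move=> t /ode/chart_curve_geodesic_germ[gt _]; exists i.
have ss : `|s - s| < tau by rewrite subrr normr0.
have [gd vd] := chart_curve_geodesic_germ (ode s ss).
apply: (geodesic_germ_unique gi gd).
  by rewrite /y' /= subrr y0 -gsq coordK// gsq.
by rewrite (nbhs_singleton vd) /v' subrr v0.
Qed.

Lemma is_intervalI (A B : set R) : is_interval A -> is_interval B -> is_interval (A `&` B).
Proof. by move=> iA iB x y [Ax Bx] [Ay By] z xyz; split; [exact: iA xyz|exact: iB xyz]. Qed.

Lemma is_intervalU (A B : set R) x : is_interval A -> is_interval B -> A x -> B x ->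
  is_interval (A `|` B).
Proof.
move=> /connected_intervalP cA /connected_intervalP cB Ax Bx.
apply/connected_intervalP; apply: connectedU => //.
by exists x.
Qed.

(** By unique continuation the two geodesics agree on the intersection of the
    intervals, so that together they define a geodesic on the union. *)
Lemma geodesic_extend (I J : set R) gamma delta s : open_interval I -> open_interval J ->
  (forall t, I t -> exists i, geodesic_germ N i gamma t) ->
  (forall t, J t -> exists i, geodesic_germ N i delta t) ->
  I s -> J s -> (\forall t \near s, gamma t = delta t) ->
  maximal_geodesic N I gamma -> J `<=` I.
Proof.
move=> oI oJ gI gJ Is Js gd [_ _ mI].
have [opI iI _] := oI; have [opJ iJ _] := oJ.
have agree t : I t -> J t -> gamma t = delta t.
  move=> It Jt; apply: (geodesic_unique_continuation (is_intervalI iI iJ) _ _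
    (conj Is Js) gd (conj It Jt)).
  - by move=> r [Ir _]; exact: gI.
  - by move=> r [_ Jr]; exact: gJ.
pose eps t := if `[< I t >] then gamma t else delta t.
have epsI t : I t -> gamma t = eps t by move=> It; rewrite /eps asboolT.
have epsJ t : J t -> delta t = eps t.
  by move=> Jt; rewrite /eps; case: asboolP => // It; rewrite agree.
have E1 : I `|` J = I.
  apply: (mI _ eps).
  - split; [exact: openU|exact: is_intervalU iI iJ Is Js|by exists s; left].
  - by move=> t; left.
  - apply: geodesic_germ_geodesic => t [It|Jt].
      have [i gi] := gI t It; exists i; apply: geodesic_germ_eq gi.
      by apply: filterS (open_nbhs_nbhs (conj opI It)) => r; exact: epsI.
    have [i gi] := gJ t Jt; exists i; apply: geodesic_germ_eq gi.
    by apply: filterS (open_nbhs_nbhs (conj opJ Jt)) => r; exact: epsJ.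
  - by move=> t It; rewrite -epsI.
by move=> t Jt; rewrite -E1; right.
Qed.

(** The Wronskian is constant along the geodesic, so that compactness gives a
    survival time [tau] that serves at all times in [I]: with each time, [I]
    contains an interval of radius [tau] around it. *)
Theorem complete_of_compact : compact [set: M] -> complete_connection N.
Proof.
move=> cM I gamma mg; have [oI gg _] := mg; have [opI iI [t0 It0]] := oI.
have gI t : I t -> exists i, geodesic_germ N i gamma t.
  move=> It; have [i di] := charts_cover (gamma t); exists i.
  exact: geodesic_geodesic_germ opI gg It di.
pose w := `|wronskian gamma t0|.
have Hloc q : [set: M] q -> _ := fun=> @local_survival_time w q (normr_ge0 _).
have /compact_near_coveringP/(_ _ _ _ _ Hloc) survive := cM.
have [tau [tau0 Htau]] := filter_ex (filterI (nbhs_right_gt (0 : R)) survive).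
have step s : I s -> [set t : R | `|t - s| < tau] `<=` I.
  move=> Is; have [|delta [dJ gd]] := Htau _ Logic.I gamma s erefl (gI s Is).
    by rewrite (wronskian_cst iI gI Is It0).
  have sJ : `|s - s| < tau by rewrite subrr normr0.
  apply: (geodesic_extend oI _ gI dJ Is sJ gd mg); split.
  - have E1 : ball s tau = (fun t : R => is_true (`|t - s| < tau)).
      by apply/funext => t; rewrite -ball_normE /= distrC.
    by rewrite -E1; exact: ball_open.
  - move=> x y; rewrite /= !ltr_norml => /andP[x1 x2] /andP[y1 y2] z /andP[xz zy].
    by rewrite ltr_norml; apply/andP; split; lra.
  - by exists s.
have steps k : forall t, `|t - t0| <= k%:R * (tau / 2) -> I t.
  elim: k => [|k IH] t.
    by rewrite mul0r normr_le0 subr_eq0 => /eqP->.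
  move=> tk; pose c : R := k%:R / k.+1%:R.
  have c0 : 0 <= c by rewrite divr_ge0.
  have cE : 1 - c = k.+1%:R^-1.
    have k0 : k.+1%:R != 0 :> R by rewrite pnatr_eq0.
    by apply: (mulIf k0); rewrite mulrBl mul1r divfK// mulVf// -natr1 addrAC subrr add0r.
  have cK : c * k.+1%:R = k%:R by rewrite divfK ?pnatr_eq0.
  (* [t] is reached from [t0] in [k.+1] equal steps, each of length at most
     [tau / 2]; [s] is the last but one time *)
  pose s := t0 + c * (t - t0).
  have st0 : `|s - t0| <= k%:R * (tau / 2).
    rewrite addrAC subrr add0r normrM (ger0_norm c0).
    apply: le_trans (ler_wpM2l c0 tk) _.
    by rewrite (mulrA c) cK.
  apply: (step _ (IH _ st0)) => /=.
  have -> : t - s = (1 - c) * (t - t0) by rewrite /s; ring.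
  rewrite cE normrM ger0_norm ?invr_ge0// mulrC ltr_pdivrMr ?ltr0n//.
  apply: le_lt_trans tk _; rewrite mulrC ltr_pM2r ?ltr0n//.
  by rewrite ltr_pdivrMr// ltr_pMr// ltr1n.
apply/seteqP; split=> // t _.
apply: (steps (Num.bound (`|t - t0| / (tau / 2)))).
have tau20 : 0 < tau / 2 by rewrite divr_gt0.
by rewrite -ler_pdivrMr// ltW// archi_boundP// divr_ge0// ltW.
Qed.

End Completeness.

Section SphereCompact.
Variables (R : realType) (n : nat).

Lemma sphere_compact : compact (@sphere R n).
Proof.
apply: bounded_closed_compact.
  exists 1; split; first exact: num_real.
  move=> x x1 y sy; apply: ltW; apply: le_lt_trans x1.
  apply: mx_norm_bound => // i k; rewrite (ord1 i) -(ler_pXn2r (ltn0Sn 1)) ?nnegrE//.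
  rewrite expr1n -normrX ger0_norm ?sqr_ge0// -sy (bigD1 k)//= lerDl.
  by apply: sumr_ge0 => j _; exact: sqr_ge0.
have -> : @sphere R n = (fun y : 'rV[R]_n.+1 => \sum_k y 0 k ^+ 2) @^-1` [set 1] by [].
apply: closed_comp; last exact: closed_eq.
by move=> y _; exact: (Ck_continuous (@sqnorm_Ck R n.+1 0) Logic.I).
Qed.

Lemma compact_of_sphere (M : manifold R n) : diffeomorphic_to_sphere M ->
  compact [set: M].
Proof.
move=> [F [G [FS GK FK _ Gsm]]].
have -> : [set: M] = G @` @sphere R n.
  by apply/seteqP; split=> p _ //; exists (F p).
apply: continuous_compact; last exact: sphere_compact.
apply/subspace_continuousP => y sy.
have [U [H [oU Uy [Hc _] HG]]] := Gsm _ sy.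
have E1 : H y = G y by exact: HG.
have : H x @[x --> y] --> G y by rewrite -E1; exact: Hc.
move=> HcG A /HcG HA; have {}HA : nbhs y (H @^-1` A) by [].
have nU : nbhs y U by exact: open_nbhs_nbhs.
rewrite /within /=; have : nbhs y [set z | sphere z -> A (G z)].
  by apply: filterS2 nU HA => z Uz Az sz; rewrite -HG.
by [].
Qed.

End SphereCompact.

Section Complete.
Variables (R : realType) (n : nat) (M : manifold R n) (N : connection M).

Theorem complete_of_flat_tractor : (2 <= n)%N -> diffeomorphic_to_sphere M ->
  locally_flat_tractor N -> complete_connection N.
Proof.
move=> n2 hM lf; have [Phi solPhi] := global_solution n2 lf hM.
exact: complete_of_compact solPhi (compact_of_sphere hM).
Qed.

End Complete.

(** * Projectively flat connections *)

Section LinearFamily.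
Variables (R : realType) (n : nat).
Local Notation E := 'rV[R]_n.
Local Notation e_ k := (delta_mx 0 k : E).
Variables (V : set E) (B : E -> E -> R^o).
Hypothesis oV : open V.
Hypothesis lB : forall x, V x -> linear (B x).

Lemma linear_expand x w : V x -> B x w = \sum_k w 0 k * B x (e_ k).
Proof. by move=> Vx; exact: linear_row_comb (lB Vx). Qed.

Lemma is_derive_sum_family (Z : E -> E) x u DZ :
  (forall w, derivable (fun y => B y w) x u) -> V x -> is_derive x u Z DZ ->
  is_derive x u (fun y => B y (Z y))
    (\sum_k (Z x 0 k * 'D_u (fun y => B y (e_ k)) x + DZ 0 k * B x (e_ k))).
Proof.
move=> dB Vx /is_derive_mxP dZ.
have H k : is_derive x u (fun y => Z y 0 k * B y (e_ k) : R^o)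
    (Z x 0 k * 'D_u (fun y => B y (e_ k)) x + DZ 0 k * B x (e_ k)).
  have H1 := dZ 0 k; have H2 := derivableP (dB (e_ k)).
  have H3 := is_deriveM H1 H2.
  by apply: is_derive_eq H3 _; rewrite /= [B x (e_ k) *: _]mulrC.
have HS := is_derive_sum H.
apply: near_eq_is_derive HS.
apply: filterS (open_nbhs_nbhs (conj oV Vx)) => y Vy.
by rewrite (linear_expand _ Vy) fct_sumE.
Qed.

Lemma derive_family_expand x u w :
  (forall w, derivable (fun y => B y w) x u) -> V x ->
  'D_u (fun y => B y w) x = \sum_k w 0 k * 'D_u (fun y => B y (e_ k)) x.
Proof.
move=> dB Vx; have [_ ->] := is_derive_sum_family dB Vx (is_derive_cst w x u).
by apply: eq_bigr => k _; rewrite mxE mul0r addr0.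
Qed.

Lemma derive_family_linear x u : (forall w, derivable (fun y => B y w) x u) -> V x ->
  linear (fun w => 'D_u (fun y => B y w) x).
Proof.
move=> dB Vx a v w; rewrite !(derive_family_expand _ dB Vx) scaler_sumr -big_split.
by apply: eq_bigr => k _ /=; rewrite !mxE mulrDl -mulrA.
Qed.

(** Leibniz rule for a linear form depending on the point. *)
Lemma is_derive_family (Z : E -> E) x u DZ :
  (forall w, derivable (fun y => B y w) x u) -> V x -> is_derive x u Z DZ ->
  is_derive x u (fun y => B y (Z y)) ('D_u (fun y => B y (Z x)) x + B x DZ).
Proof.
move=> dB Vx dZ; apply: is_derive_eq (is_derive_sum_family dB Vx dZ) _.
by rewrite big_split (derive_family_expand _ dB Vx) (linear_expand _ Vx).
Qed.

Lemma Ck_family k (Z : E -> E) : (forall w, Ck k V (fun x => B x w)) -> Ck k V Z ->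
  Ck k V (fun x => B x (Z x)).
Proof.
move=> CB CZ.
apply: (@Ck_eq _ _ _ k V (fun x => \sum_k Z x 0 k * B x (e_ k) : R^o)) => //.
  by move=> x Vx; rewrite (linear_expand _ Vx).
apply: Ck_sum => // j _; apply: Ck_mul => //.
by move/Ck_mxP: CZ; apply.
Qed.

End LinearFamily.

Section Projective.
Variables (R : realType) (n : nat).
Local Notation E := 'rV[R]_n.
Local Notation e_ k := (delta_mx 0 k : E).

Lemma is_derive_scale_vector (Y : normedModType R) (f : Y -> R^o) (w : E) x v (a : R^o) :
  is_derive x v f a -> is_derive x v (fun y => f y *: w) (a *: w).
Proof.
move=> df; apply/is_derive_mxP => i j.
have := is_deriveZ (w i j) df.
have -> : (w i j \*: f : Y -> R^o) = (fun y => (f y *: w) i j).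
  by apply/funext => y; rewrite mxE mulrC.
by move=> H; apply: is_derive_eq H _; rewrite mxE mulrC.
Qed.

Variables (V : set E) (Gam Gam' : E -> E -> E -> E) (omega : E -> E -> R^o).
Hypotheses (oV : open V).
Hypothesis bG' : forall x, V x -> bilin (Gam' x).
Hypothesis sG' : forall u v, smooth_on V (fun x => Gam' x u v).
Hypothesis symG' : forall x u v, V x -> Gam' x u v = Gam' x v u.
Hypothesis flat' : forall x u v w, V x -> curv Gam' x u v w = 0.
Hypothesis lw : forall x, V x -> linear (omega x).
Hypothesis sw : forall v, smooth_on V (fun x => omega x v).
Hypothesis projG : forall x u v, V x ->
  Gam x u v = Gam' x u v + omega x u *: v + omega x v *: u.

(** The tensor that measures the difference of the curvatures of two
    projectively equivalent connections. *)
Definition schouten (x u v : E) : R^o :=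
  'D_u (fun y => omega y v) x - omega x (Gam' x u v) - omega x u * omega x v.

Let dw x u w : V x -> derivable (fun y => omega y w) x u.
Proof. by move=> Vx; exact: Ck_derivable (sw w 1) Vx. Qed.

Let dG' x u v w : V x -> is_derive x u (fun y => Gam' y v w) ('D_u (fun y => Gam' y v w) x).
Proof. by move=> Vx; apply: derivableP; exact: Ck_derivable (sG' v w 1) Vx. Qed.

Arguments dw : clear implicits.
Arguments dG' : clear implicits.

Lemma projective_derive x u v w : V x ->
  'D_u (fun y => Gam y v w) x = 'D_u (fun y => Gam' y v w) x +
    'D_u (fun y => omega y v) x *: w + 'D_u (fun y => omega y w) x *: v.
Proof.
move=> Vx.
have H1 := is_derive_scale_vector w (derivableP (dw x u v Vx)).
have H2 := is_derive_scale_vector v (derivableP (dw x u w Vx)).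
have H3 := is_deriveD (is_deriveD (dG' x u v w Vx) H1) H2.
have [_ <-] := H3; apply: near_eq_derive.
by apply: filterS (open_nbhs_nbhs (conj oV Vx)) => y Vy; rewrite projG.
Qed.


(** Expansion of the curvature of the first connection; the terms that are
    symmetric in [u] and [v] cancel, and so does the curvature of the second
    one. *)
Lemma projective_curv x u v w : V x -> curv Gam x u v w =
  (schouten x u v - schouten x v u) *: w + schouten x u w *: v - schouten x v w *: u.
Proof.
move=> Vx; have bx := bG' Vx; have lx := lw Vx.
have oD a b : omega x (a + b) = omega x a + omega x b.
  by have := lx 1 a b; rewrite !scale1r.
have o0 : omega x 0 = 0 by have := lx (-1) 0 0; rewrite !scaleN1r !addNr.
have oZ c a : omega x (c *: a) = c * omega x a.
  by have := lx c a 0; rewrite !addr0 o0 addr0.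
have F := flat' u v w Vx; rewrite /curv in F.
rewrite /curv !projective_derive// (projG u (Gam x v w) Vx) (projG v (Gam x u w) Vx).
rewrite !(projG _ _ Vx) !oD !oZ !(bilinDr bx) !(bilinZr bx) /schouten.
rewrite (symG' v u Vx).
move: F.
move: ('D_u (fun y => Gam' y v w) x) ('D_v (fun y => Gam' y u w) x)
  (Gam' x u (Gam' x v w)) (Gam' x v (Gam' x u w)) => d1 d2 g1 g2.
move: (Gam' x u w) (Gam' x v w) (Gam' x u v) => a1 a2 a3 F.
have {F} -> : d1 = d2 + g2 - g1 by apply/eqP; rewrite eq_sym subr_eq eq_sym -subr_eq0 F.
apply/rowP => j; rewrite !mxE; ring.
Qed.

Lemma schouten_bilin x : V x -> bilin (schouten x).
Proof.
move=> Vx; have bx := bG' Vx; have lx := lw Vx.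
have oL c a b : omega x (c *: a + b) = c * omega x a + omega x b by exact: lx.
split=> [w a u v|u a v w]; rewrite /schouten.
  rewrite (derive_linear (@mean_value_real R) a u v oV (sw w 1) Vx).
  rewrite (bilinDl bx) (bilinZl bx) !oL /GRing.scale /=; ring.
rewrite (derive_family_linear oV lw (fun w => dw x u w Vx) Vx a v w).
rewrite (bilinDr bx) (bilinZr bx) !oL /GRing.scale /=; ring.
Qed.

Lemma schouten_smooth u v : smooth_on V (fun x => schouten x u v).
Proof.
move=> k; rewrite /schouten.
apply: Ck_add => //; first apply: Ck_add => //.
- exact: Ck_derive (sw v k.+1).
- apply: Ck_opp => //; apply: Ck_family => //; last exact: sG'.
  by move=> w; exact: sw.
- by apply: Ck_opp => //; apply: Ck_mul => //; exact: sw.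
Qed.

Lemma schouten_derive x u v w : V x ->
  'D_u (fun y => schouten y v w) x =
  'D_u ('D_v (fun y => omega y w)) x
  - ('D_u (fun y => omega y (Gam' x v w)) x + omega x ('D_u (fun y => Gam' y v w) x))
  - (omega x v * 'D_u (fun y => omega y w) x + omega x w * 'D_u (fun y => omega y v) x).
Proof.
move=> Vx.
have H1 := derivableP (Ck_derivable (v := u) (Ck_derive v (sw w 2)) Vx).
have H2 := is_derive_family oV lw (fun w => dw x u w Vx) Vx (dG' x u v w Vx).
have H3 := is_deriveM (derivableP (dw x u v Vx)) (derivableP (dw x u w Vx)).
have [_ <-] := is_deriveB (is_deriveB H1 H2) H3.
by [].
Qed.

Lemma schouten_asym x u v : V x ->
  schouten x u v - schouten x v u = 'D_u (fun y => omega y v) x - 'D_v (fun y => omega y u) x.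
Proof. by move=> Vx; rewrite /schouten (symG' v u Vx); ring. Qed.

Hypothesis schouten_sym : forall x u v, V x -> schouten x u v = schouten x v u.

(** After expansion the terms match by flatness of [Gam'], by symmetry of the
    second derivatives of [omega], and because [omega] is closed, which is
    what symmetry of the tensor means. *)
Lemma schouten_codazzi x u v w : V x ->
  'D_u (fun y => schouten y v w) x + schouten x u (Gam x v w) =
  'D_v (fun y => schouten y u w) x + schouten x v (Gam x u w).
Proof.
move=> Vx; have bP := schouten_bilin Vx; have lx := lw Vx.
rewrite !projG// !(bilinDr bP) !(bilinZr bP) (schouten_sym v u Vx) !schouten_derive//.
rewrite /schouten.
have oD a b : omega x (a + b) = omega x a + omega x b.
  by have := lx 1 a b; rewrite !scale1r.
have closed : 'D_v (fun y => omega y u) x = 'D_u (fun y => omega y v) x.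
  have := schouten_asym u v Vx; rewrite (schouten_sym u v Vx) subrr => /esym/eqP.
  by rewrite subr_eq0 => /eqP.
have schwarz : 'D_u ('D_v (fun y => omega y w)) x = 'D_v ('D_u (fun y => omega y w)) x.
  exact: (Ck_derive_swap (@mean_value_real R) u v oV (sw w 2) Vx).
have F : omega x ('D_u (fun y => Gam' y v w) x) + omega x (Gam' x u (Gam' x v w)) =
    omega x ('D_v (fun y => Gam' y u w) x) + omega x (Gam' x v (Gam' x u w)).
  rewrite -!oD; congr (omega x _); apply/eqP; rewrite -subr_eq0; apply/eqP.
  exact: flat'.
rewrite schwarz closed /GRing.scale /=; move: F.
have F' (a b c d : R) : a + b = c + d -> a = c + d - b by move=> <-; rewrite addrK.
move=> /F' ->; ring.
Qed.

Lemma projective_flat_tractor :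
  (forall x, V x -> bilin (Gam x)) -> (forall u v, smooth_on V (fun x => Gam x u v)) ->
  flat_tractor V Gam (fun x u v => - schouten x u v).
Proof.
move=> bG sG; have bP x (Vx : V x) := schouten_bilin Vx.
split=> //.
- by move=> x u v Vx; rewrite !projG// (symG' v u Vx) addrAC.
- move=> x Vx; split=> [w a u v|u a v w].
    by rewrite (bilinDl (bP x Vx)) (bilinZl (bP x Vx)) opprD scalerN.
  by rewrite (bilinDr (bP x Vx)) (bilinZr (bP x Vx)) opprD scalerN.
- by move=> u v k; apply: Ck_opp => //; exact: schouten_smooth.
- by move=> x u v Vx; rewrite schouten_sym.
- move=> x u v w Vx; rewrite projective_curv// (schouten_sym u v Vx) subrr scale0r add0r.
  by rewrite !scaleNr opprK addrC.
- move=> x u v w Vx.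
  have D a b : 'D_a (fun y => - schouten y b w) x = - 'D_a (fun y => schouten y b w) x.
    have [_ <-] := is_deriveN (derivableP (Ck_derivable (v := a) (schouten_smooth b w 1) Vx)).
    by [].
  by rewrite !D -!opprD schouten_codazzi.
Qed.

End Projective.

Section Ricci.
Variables (R : realType) (n : nat).
Local Notation E := 'rV[R]_n.
Local Notation e_ k := (delta_mx 0 k : E).

(** The trace of the curvature formula is P(w,v) - n P(v,w), whose
    antisymmetric part is that of [P] up to a nonzero factor. *)
Lemma schouten_sym_of_ricci (P : E -> E -> R^o) (f : E -> E -> E -> E) :
  bilin P ->
  (forall u v w, f u v w = (P u v - P v u) *: w + P u w *: v - P v w *: u) ->
  (forall v w, \tr (lin1_mx (fun u => f u v w)) = \tr (lin1_mx (fun u => f u w v))) ->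
  forall v w, P v w = P w v.
Proof.
move=> bP fE ric.
have trE v w : \tr (lin1_mx (fun u => f u v w)) = P w v - n%:R * P v w.
  have Tk k : lin1_mx (fun u => f u v w) k k =
      w 0 k * P (e_ k) v - w 0 k * P v (e_ k) + v 0 k * P (e_ k) w - P v w.
    by rewrite mxE fE !mxE !eqxx /=; ring.
  have S1 : \sum_k w 0 k * P (e_ k) v = P w v by rewrite (bilin_row_combl bP w v).
  have S2 : \sum_k w 0 k * P v (e_ k) = P v w by rewrite (bilin_row_combr bP v w).
  have S3 : \sum_k v 0 k * P (e_ k) w = P v w by rewrite (bilin_row_combl bP v w).
  rewrite /mxtrace (eq_bigr _ (fun k _ => Tk k)) sumrB big_split /= sumrB S1 S2 S3.
  by rewrite sumr_const card_ord subrK mulr_natl.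
move=> v w; have := ric v w; rewrite !trE => H.
have : (n%:R + 1) * (P v w - P w v) = 0 by rewrite mulrBr; move: H; lra.
move/eqP; rewrite mulf_eq0 subr_eq0 => /orP[|/eqP//].
by rewrite natr1 pnatr_eq0.
Qed.

End Ricci.

Section Transport.
Variables (R : realType) (n : nat).
Local Notation E := 'rV[R]_n.
Local Notation e_ k := (delta_mx 0 k : E).

(** Testing skewness with the third argument equal to one of the first two
    shows that [P] vanishes on orthogonal pairs, and such a bilinear form is a
    multiple of the scalar product. *)
Lemma schouten_proportional (P g : E -> E -> R^o) (f : E -> E -> E -> E) :
  bilin P -> bilin g -> (forall u v, g u v = g v u) -> (forall u, u != 0 -> 0 < g u u) ->
  (forall u v w, f u v w = (P u v - P v u) *: w + P u w *: v - P v w *: u) ->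
  (forall u v w, g (f u v w) w = 0) ->
  exists k : R, forall u v, P u v = k * g u v.
Proof.
move=> bP bg gs gp fE skew.
have S u v w : (P u v - P v u) * g w w + P u w * g v w - P v w * g u w = 0.
  have gN a c : g (- a) c = - g a c.
    by rewrite -scaleN1r (bilinZl bg) scaleN1r.
  have := skew u v w; rewrite fE (bilinDl bg) gN (bilinDl bg) !(bilinZl bg).
  exact.
have orth u v : u != 0 -> v != 0 -> g u v = 0 -> P u v = 0.
  move=> u0 v0 guv; have gu := gp _ u0; have gv := gp _ v0.
  have H1 := S u v u; have H2 := S u v v.
  rewrite (gs v u) guv mulr0 addr0 in H1; rewrite guv mulr0 subr0 in H2.
  have E1 : (P u v - 2 * P v u) * g u u = 0 by rewrite -H1; ring.
  have E2 : (2 * P u v - P v u) * g v v = 0 by rewrite -H2; ring.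
  move/eqP: E1; rewrite mulf_eq0 (gt_eqF gu) orbF => /eqP E1.
  move/eqP: E2; rewrite mulf_eq0 (gt_eqF gv) orbF => /eqP E2.
  lra.
have key u v : P u v * g u u = P u u * g u v /\ P v u * g u u = P u u * g u v.
  have [->|u0] := eqVneq u 0.
    by rewrite !(bilin0l bP) !(bilin0r bP) !mul0r.
  have gu := gp _ u0; have gu0 : g u u != 0 by rewrite gt_eqF.
  pose a := g u v / g u u; pose v' := v - a *: u.
  have vE : v = a *: u + v' by rewrite /v' addrC subrK.
  have gv' : g u v' = 0.
    rewrite /v' -scaleN1r scalerA (bilinDr bg) (bilinZr bg) /GRing.scale /= mulN1r /a mulNr divfK// subrr.
    by [].
  have [Puv' Pv'u] : P u v' = 0 /\ P v' u = 0.
    have [->|v0] := eqVneq v' 0; first by rewrite (bilin0l bP) (bilin0r bP).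
    by split; apply: orth => //; rewrite gs.
  rewrite {1 3}vE (bilinDr bP) (bilinDl bP) (bilinZr bP) (bilinZl bP) Puv' Pv'u !addr0.
  by rewrite /GRing.scale /= mulrAC /a divfK// mulrC.
have [n0|[e e0]] : (forall u : E, u = 0) \/ exists e : E, e != 0.
  have [[e e0]|H] := pselect (exists e : E, e != 0); first by right; exists e.
  by left=> u; apply/eqP/negPn/negP => u0; apply: H; exists u.
  by exists 0 => u v; rewrite (n0 u) (bilin0l bP) mul0r.
pose k := P e e / g e e; exists k.
have ge := gp _ e0; have ge0 : g e e != 0 by rewrite gt_eqF.
(* [Q] differs from [P] by a multiple of [g] that makes [Q e e] vanish *)
pose Q u v := P u v - k * g u v.
have Qsym u v : Q u v = Q v u.
  rewrite /Q (gs v u); congr (_ - _); have [->|u0] := eqVneq u 0.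
    by rewrite (bilin0l bP) (bilin0r bP).
  have gu0 : g u u != 0 by rewrite gt_eqF// gp.
  by apply: (mulIf gu0); have [-> ->] := key u v.
have Qkey u v : Q u v * g u u = Q u u * g u v.
  by rewrite /Q mulrBl (key u v).1; ring.
have Qee : Q e e = 0 by rewrite /Q /k divfK// subrr.
have Qe v : Q e v = 0.
  by apply: (mulIf ge0); rewrite Qkey Qee !mul0r.
have Qdiag v : g e v != 0 -> Q v v = 0.
  move=> gv; apply: (mulIf gv); rewrite (gs e v) -Qkey Qsym Qe !mul0r.
  by [].
have QD u v w : Q (u + v) w = Q u w + Q v w.
  by rewrite /Q (bilinDl bP) (bilinDl bg); ring.
have Qall v : Q v v = 0.
  have [gv|/Qdiag//] := eqVneq (g e v) 0.
  have := @Qdiag (e + v); rewrite (bilinDr bg) gv addr0 => /(_ ge0).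
  by rewrite QD Qe add0r Qsym QD Qe add0r.
move=> u v; apply/eqP; rewrite -subr_eq0; apply/eqP.
have [->|u0] := eqVneq u 0; first by rewrite (bilin0l bP) (bilin0l bg) mulr0 subr0.
have gu0 : g u u != 0 by rewrite gt_eqF// gp.
by apply: (mulIf gu0); rewrite -/(Q u v) Qkey Qall !mul0r.
Qed.

(** Apart from its curvature, the connection enters only in the Codazzi
    equation, which changes by the last hypothesis on the difference of the
    connections. *)
Lemma flat_tractor_transport V (Gam Gamb : E -> E -> E -> E) (h : E -> E -> E -> R^o) :
  flat_tractor V Gam h ->
  (forall x, V x -> bilin (Gamb x)) -> (forall u v, smooth_on V (fun x => Gamb x u v)) ->
  (forall x u v, V x -> Gamb x u v = Gamb x v u) ->
  (forall x u v w, V x -> curv Gamb x u v w = curv Gam x u v w) ->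
  (forall x u v w, V x -> h x u (Gamb x v w - Gam x v w) = h x v (Gamb x u w - Gam x u w)) ->
  flat_tractor V Gamb h.
Proof.
move=> ft bG sG yG cG hC; split=> //.
- exact: ft_open ft.
- exact: ft_hbilin ft.
- exact: ft_hsmooth ft.
- exact: ft_hsym ft.
- by move=> x u v w Vx; rewrite cG// (ft_curv ft).
- move=> x u v w Vx; have bh := ft_hbilin ft Vx.
  have E1 a b : Gamb x a b = Gam x a b + (Gamb x a b - Gam x a b) by rewrite addrC subrK.
  rewrite (E1 v w) (E1 u w) (bilinDr bh u (Gam x v w)) (bilinDr bh v (Gam x u w)).
  rewrite !addrA (ft_codazzi ft)//.
  by congr (_ + _); exact: hC.
Qed.

End Transport.

(** * Metrics and dual connections *)

Section ProjectivelyFlat.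
Variables (R : realType) (n : nat) (M : manifold R n).
Local Notation E := 'rV[R]_n.
Implicit Types (i : chart M) (N : connection M) (g : metric M).

Lemma christoffel_sym N i x u v : torsion_free N -> cod i x -> N i x u v = N i x v u.
Proof. by move=> tf; apply: torsion_free_sym (tf i); exact: cod_open. Qed.

Lemma christoffel_smooth N i u v : smooth_on (cod i) (fun x => N i x u v).
Proof. exact: (christoffelP N i).2. Qed.

Lemma smooth_sub (W : normedModType R) (U V : set E) (f : E -> W) : V `<=` U ->
  smooth_on U f -> smooth_on V f.
Proof. by move=> VU sf k; exact: Ck_sub VU (sf k). Qed.

(** The second hypothesis makes the tensor in the curvature formula symmetric,
    and its opposite is then the required [h]. The conclusion recalls how [h]
    is tied to the curvature, so that further properties of [h] can be read
    off from it. *)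
Lemma projectively_flat_tractor N : projectively_flat N ->
  (forall i x (P : E -> E -> R^o), cod i x -> bilin P ->
    (forall u v w, curv (N i) x u v w =
       (P u v - P v u) *: w + P u w *: v - P v w *: u) -> forall u v, P u v = P v u) ->
  forall p, exists i V (h : E -> E -> E -> R^o),
    [/\ dom i p, V (coord i p), V `<=` cod i, flat_tractor V (N i) h
    & forall x, V x -> exists P : E -> E -> R^o, [/\ bilin P, forall u v, h x u v = - P u v
       & forall u v w, curv (N i) x u v w =
         (P u v - P v u) *: w + P u w *: v - P v w *: u]].
Proof.
move=> pf symP p; have [i [V [G' [w [[dp oV Vi Vp] [[bG' sG'] tf fl [lw sw] pr]]]]]] := pf p.
have bG x : V x -> bilin (G' x) by move=> Vx; have [b1 b2] := bG' x Vx; split.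
have sc (u : E) : smooth_on V (cst u) by exact: smooth_cst.
have symG' x u v : V x -> G' x u v = G' x v u by exact: torsion_free_sym oV tf.
have flat' x u v z : V x -> curv G' x u v z = 0.
  move=> Vx; rewrite -(curvature_cst u v z (conj bG' sG') Vx).
  by apply: fl => //; exact: sc.
have projG x u v : V x -> N i x u v = G' x u v + w x u *: v + w x v *: u.
  move=> Vx; have := pr _ _ (sc u) (sc v) x Vx.
  by rewrite /nabla !derive_cst !add0r.
have bN x : V x -> bilin (N i x) by move=> Vx; exact: christoffel_bilin (Vi _ Vx).
have sN u v : smooth_on V (fun x => N i x u v).
  exact: smooth_sub Vi (christoffel_smooth N i u v).
have curvE x u v z (Vx : V x) := projective_curv oV bG sG' symG' flat' lw sw projG u v z Vx.
have bP x (Vx : V x) := schouten_bilin oV bG lw sw Vx.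
have symS x u v : V x -> schouten G' w x u v = schouten G' w x v u.
  move=> Vx; apply: (symP i x _ (Vi _ Vx) (bP x Vx)) => a b c.
  exact: curvE.
exists i, V, (fun x u v => - schouten G' w x u v); split=> //.
  exact: (projective_flat_tractor oV bG sG' symG' flat' lw sw projG).
move=> x Vx; exists (schouten G' w x); split=> //.
- exact: bP.
- by move=> u v z; exact: curvE.
Qed.

Lemma flat_tractor_of_ricci N : ricci_symmetric N -> projectively_flat N ->
  locally_flat_tractor N.
Proof.
move=> ric pf p.
have [|i [V [h [dp Vp Vi ft _]]]] := projectively_flat_tractor pf _ p; last first.
  by exists i, V, h.
move=> i x P cx bP cE u v; apply: (schouten_sym_of_ricci bP cE) => a b.
have RE c d : \tr (lin1_mx (fun u0 : E => curv (N i) x u0 c d)) = ricci (N i) x c d.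
  rewrite /ricci; congr (\tr (lin1_mx _)); apply/funext => z.
  by rewrite (curvature_cst z c d (christoffelP N i) cx).
by rewrite !RE ric.
Qed.

Section Duality.
Variables (g : metric M) (N Nb : connection M).
Hypotheses (hgN : statistical g N) (dual : dual_connection g N Nb).

Lemma inner_bilin i x : cod i x -> bilin (g i x : E -> E -> R^o).
Proof. by move=> cx; have [b1 b2] := inner_bilinear g cx; split. Qed.

Let sc i (u : E) : smooth_on (cod i) (cst u) := smooth_cst u (@cod_open R n M i).

Lemma inner_derive i x u a b : cod i x ->
  'D_u (fun y => g i y a b : R^o) x = g i x (N i x u a) b + g i x a (Nb i x u b).
Proof.
move=> cx; have := dual (@sc i u) (@sc i a) (@sc i b) cx.
by rewrite /nabla !derive_cst !add0r.
Qed.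

(** Differentiate the duality relation in a second direction and
    antisymmetrize: the mixed terms are symmetric, and the second derivatives
    of the metric cancel. *)
Lemma curvature_duality i x u v a b : cod i x ->
  g i x (curv (N i) x u v a) b + g i x a (curv (Nb i) x u v b) = 0.
Proof.
move=> cx; have bg := inner_bilin cx.
have sD s t c d : 'D_s ('D_t (fun y => g i y c d : R^o)) x =
   g i x ('D_s (fun y => N i y t c) x + N i x s (N i x t c)) d + g i x (N i x t c) (Nb i x s d)
   + (g i x (N i x s c) (Nb i x t d) + g i x c ('D_s (fun y => Nb i y t d) x + Nb i x s (Nb i x t d))).
  have S1 := @christoffel_smooth N i t c; have S2 := @christoffel_smooth Nb i t d.
  have D1 := dual (@sc i s) S1 (@sc i d) cx.
  have D2 := dual (@sc i s) (@sc i c) S2 cx.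
  rewrite /nabla !derive_cst !add0r /= in D1 D2.
  have l1 y : cod i y -> linear (fun z => g i y z d : R^o).
    by move=> cy; exact: (inner_bilin cy).1.
  have l2 y : cod i y -> linear (fun z => g i y c z : R^o).
    by move=> cy; exact: (inner_bilin cy).2.
  have C1 := @Ck_family _ _ _ _ (@cod_open R n M i) l1 1 _ (fun z => inner_smooth g i z d 1%N) (S1 1%N).
  have C2 := @Ck_family _ _ _ _ (@cod_open R n M i) l2 1 _ (fun z => inner_smooth g i c z 1%N) (S2 1%N).
  have H1 := derivableP (Ck_derivable (v := s) C1 cx).
  have H2 := derivableP (Ck_derivable (v := s) C2 cx).
  have [_] := is_deriveD H1 H2; rewrite D1 D2 => <-.
  apply: near_eq_derive; apply: filterS (open_nbhs_nbhs (conj (@cod_open R n M i) cx)) => y cy.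
  by rewrite inner_derive.
have SW : 'D_u ('D_v (fun y => g i y a b : R^o)) x = 'D_v ('D_u (fun y => g i y a b : R^o)) x.
  exact: (Ck_derive_swap (@mean_value_real R) u v (@cod_open R n M i) (inner_smooth g i a b 2%N) cx).
rewrite !sD in SW.
have gN c d : g i x (- c) d = - g i x c d.
  by rewrite -scaleN1r (bilinZl bg) scaleN1r.
have gN' c d : g i x c (- d) = - g i x c d.
  by rewrite -scaleN1r (bilinZr bg) scaleN1r.
rewrite /curv (bilinDl bg) gN (bilinDr bg a) gN'; move: SW; lra.
Qed.

Lemma inner_nondegenerate i x a b : cod i x -> (forall c, g i x a c = g i x b c) -> a = b.
Proof.
move=> cx H; have bg := inner_bilin cx; apply/eqP; rewrite -subr_eq0; apply/negPn/negP => ab.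
have gB c : g i x (a - b) c = g i x a c - g i x b c.
  by rewrite -[- b]scaleN1r (bilinDl bg) (bilinZl bg) scaleN1r.
by have := inner_pos g cx ab; rewrite gB H subrr ltxx.
Qed.

(** Through this identity the symmetries of the cubic form become symmetries
    of the difference of the two connections. *)
Lemma difference_cubic i x u a b : cod i x ->
  g i x a (Nb i x u b - N i x u b) = cubic_form g N i (cst u) (cst a) (cst b) x.
Proof.
move=> cx; have bg := inner_bilin cx.
rewrite /cubic_form /nabla !derive_cst !add0r /= inner_derive//.
rewrite -[- N i x u b]scaleN1r (bilinDr bg) (bilinZr bg) scaleN1r; ring.
Qed.

Lemma difference_sym i x u a b : cod i x ->
  g i x a (Nb i x u b - N i x u b) = g i x u (Nb i x a b - N i x a b).
Proof.
move=> cx; rewrite !difference_cubic//.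
by have [-> _] := hgN.2 _ _ _ _ (@sc i u) (@sc i a) (@sc i b) _ cx.
Qed.

Lemma dual_christoffel_sym i x u v : cod i x -> Nb i x u v = Nb i x v u.
Proof.
move=> cx; have H : Nb i x u v - N i x u v = Nb i x v u - N i x v u.
  apply: (inner_nondegenerate cx) => c.
  rewrite !(inner_sym g _ c cx) !difference_cubic//.
  have [_ ->] := hgN.2 _ _ _ _ (@sc i u) (@sc i c) (@sc i v) _ cx.
  have [-> _] := hgN.2 _ _ _ _ (@sc i u) (@sc i v) (@sc i c) _ cx.
  by have [_ ->] := hgN.2 _ _ _ _ (@sc i v) (@sc i u) (@sc i c) _ cx.
by move: H; rewrite (christoffel_sym u v hgN.1 cx) => /addIr.
Qed.

Hypothesis same : same_curvature N Nb.

Lemma curvature_skew i x u v w : cod i x -> g i x (curv (N i) x u v w) w = 0.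
Proof.
move=> cx; have := curvature_duality u v w w cx.
have := same (@sc i u) (@sc i v) (@sc i w) cx.
rewrite (curvature_cst u v w (christoffelP N i) cx).
rewrite (curvature_cst u v w (christoffelP Nb i) cx) => <-.
rewrite (inner_sym g w _ cx); lra.
Qed.

Lemma schouten_metric i x (P : E -> E -> R^o) : cod i x -> bilin P ->
  (forall u v w, curv (N i) x u v w =
       (P u v - P v u) *: w + P u w *: v - P v w *: u) ->
  exists k : R, forall u v, P u v = k * g i x u v.
Proof.
move=> cx bP cE; apply: (schouten_proportional bP (inner_bilin cx) _ _ cE).
- by move=> u v; exact: inner_sym.
- by move=> u; exact: inner_pos.
- by move=> u v w; exact: curvature_skew.
Qed.

(** The same [h] serves for both connections: they have the same curvature,
    and [h] is proportional to the metric, with respect to which their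
    difference is totally symmetric. *)
Lemma flat_tractor_of_conjugate_symmetric : projectively_flat N ->
  locally_flat_tractor N /\ locally_flat_tractor Nb.
Proof.
move=> pf.
have H p : exists i V (h : E -> E -> E -> R^o),
    [/\ dom i p, V (coord i p), V `<=` cod i, flat_tractor V (N i) h & flat_tractor V (Nb i) h].
  have [|i [V [h [dp Vp Vi ft hP]]]] := projectively_flat_tractor pf _ p.
    move=> i x P cx bP cE u v; have [k Pk] := schouten_metric cx bP cE.
    by rewrite !Pk (inner_sym g u v cx).
  exists i, V, h; split=> //; apply: (flat_tractor_transport ft).
  - by move=> x Vx; exact: christoffel_bilin (Vi _ Vx).
  - by move=> u v; exact: smooth_sub Vi (christoffel_smooth Nb i u v).
  - by move=> x u v Vx; exact: dual_christoffel_sym (Vi _ Vx).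
  - move=> x u v w /Vi cx; have := same (@sc i u) (@sc i v) (@sc i w) cx.
    rewrite (curvature_cst u v w (christoffelP N i) cx).
    by rewrite (curvature_cst u v w (christoffelP Nb i) cx).
  - move=> x u v w Vx; have cx := Vi _ Vx.
    have [P [bP hE cE]] := hP x Vx; have [k Pk] := schouten_metric cx bP cE.
    rewrite !hE !Pk; congr (- (_ * _)); exact: difference_sym.
by split=> p; have [i [V [h [dp Vp Vi f1 f2]]]] := H p; exists i, V, h.
Qed.

End Duality.
End ProjectivelyFlat.

Theorem theorem5p6 (R : realType) (n : nat) (hn : (2 <= n)%N)
    (M : manifold R n) (hM : diffeomorphic_to_sphere M)
    (g : metric M) (N : connection M) (hgN : statistical g N) :
  (ricci_symmetric N -> ricci_nondegenerate N -> projectively_flat N ->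
     complete_connection N) /\
  (forall Nb : connection M, dual_connection g N Nb ->
     same_curvature N Nb -> projectively_flat N ->
     complete_connection N /\ complete_connection Nb).
Proof.
split=> [ric _ pf|Nb dual same pf].
  exact: complete_of_flat_tractor hn hM (flat_tractor_of_ricci ric pf).
have [lf lfb] := flat_tractor_of_conjugate_symmetric hgN dual same pf.
by split; exact: complete_of_flat_tractor hn hM _.
Qed.
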